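(* Let $(M^n,g,f)$ be a nontrivial shrinking gradient Ricci soliton, i.e. a smooth $n$-dimensional complete Riemannian manifold $(M,g)$ with a smooth function $f:M\to\mathbb{R}$ satisfying $\operatorname{Ric}+\operatorname{Hess}f=\lambda g$ for some constant $\lambda>0$, with $\operatorname{Hess} f$ not identically zero on $M$. Suppose that the scalar curvature $R$ of $(M,g)$ satisfies $R\geq (n-1)\lambda$ on $M$. Then any smooth compact (without boundary) 2-sided stable minimal hypersurface $\Sigma$ in $M$ is totally geodesic and has vanishing normal Ricci curvature; that is, the second fundamental form $A$ of $\Sigma$ vanishes identically and $\operatorname{Ric}(\nu,\nu)=0$ at every point of $\Sigma$, where $\nu$ is the unit normal vector field of $\Sigma$.
   Context: $\operatorname{Ric}$ is the Ricci tensor of $(M,g)$ and $\operatorname{Hess} f$ is the Hessian of $f$. A gradient Ricci soliton $(M,g,f)$ is a smooth complete Riemannian manifold $(M,g)$ with a smooth function $f:M\to\mathbb{R}$ such that $\operatorname{Ric}+\operatorname{Hess}f=\lambda g$ for some $\lambda\in\mathbb{R}$; it is shrinking if $\lambda>0$, and nontrivial if $\operatorname{Hess} f$ is not equal to zero on $M$ (i.e. not identically zero). A hypersurface is 2-sided if it admits a global smooth unit normal vector field $\nu$, and minimal if its mean curvature vanishes. A smooth compact (without boundary) minimal hypersurface $\Sigma$ in $(M,g)$ is stable if for every $\phi\in C^\infty(\Sigma)$ $$\int_{\Sigma}\left[|\nabla^{\Sigma}\phi|^2-(\operatorname{Ric}(\nu,\nu)+|A|^2)\phi^2\right]\geq 0,$$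 where $\nabla^\Sigma$ is the connection on $\Sigma$ induced from $(M,g)$, $\nu$ is the (outward pointing) unit normal vector of $\Sigma$ and $A$ is the second fundamental form of $\Sigma$. *)

(* Defs.v *)
(* Everything is written in local coordinates.  Points of R^n and coordinate
   vectors are row vectors 'rV[R]_n, so the differential of a map acts on the
   right: v |-> v *m jacobian f x.  Tensors on a manifold are families of
   coordinate expressions, one per chart of the atlas, subject to the usual
   transformation laws. *)
From HB Require Import structures.
From mathcomp Require Import all_boot all_order all_algebra.
From mathcomp Require Import all_classical all_reals all_analysis.

Set Implicit Arguments.
Unset Strict Implicit.
Unset Printing Implicit Defensive.

Import Order.TTheory GRing.Theory Num.Theory.
Import numFieldNormedType.Exports.

Local Open Scope classical_set_scope.
Local Open Scope ring_scope.

Section Euclidean.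
Context {R : realType} {n : nat}.

Definition basis_vec (i : 'I_n) : 'rV[R]_n := delta_mx 0 i.

Definition partial {W : normedModType R} (i : 'I_n) (f : 'rV[R]_n -> W)
    (x : 'rV[R]_n) : W := 'D_(basis_vec i) f x.

Fixpoint Ck {W : normedModType R} (k : nat) (U : set 'rV[R]_n)
    (f : 'rV[R]_n -> W) : Prop :=
  (forall x, U x -> {for x, continuous f}) /\
  if k is k'.+1 then
    forall i, (forall x, U x -> derivable f x (basis_vec i)) /\
              Ck k' U (partial i f)
  else True.

(* Meaningful for open U. *)
Definition smooth_on {W : normedModType R} (U : set 'rV[R]_n)
    (f : 'rV[R]_n -> W) : Prop := forall k, Ck k U f.

Definition bilin (B : 'M[R]_n) (v w : 'rV[R]_n) : R := (v *m B *m w^T) 0 0.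

End Euclidean.

(* Integral over R^n for Lebesgue measure, computed as an iterated integral;
   only used for continuous functions with compact support. *)
Fixpoint integral_Rn {R : realType} (n : nat) : ('rV[R]_n -> R) -> R :=
  match n with
  | 0 => fun f => f 0
  | n'.+1 => fun f =>
      Rintegral (@lebesgue_measure R) setT
        (fun t : R => integral_Rn (fun y : 'rV[R]_n' =>
           f (row_mx (t%:M : 'rV[R]_1) y)))
  end.

Section LocalRiemannian.
Context {R : realType} {n : nat}.
Variable G : 'rV[R]_n -> 'M[R]_n.

(* Gamma^k_ij *)
Definition christoffel (k i j : 'I_n) (x : 'rV[R]_n) : R :=
  2^-1 * \sum_l invmx (G x) k l *
    (partial i (fun y => G y j l) x + partial j (fun y => G y i l) x
     - partial l (fun y => G y i j) x).

Definition christoffel_op (x v w : 'rV[R]_n) : 'rV[R]_n :=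
  \row_k \sum_i \sum_j christoffel k i j x * v 0 i * w 0 j.

(* The component along d_l of
   nabla_{d_i} nabla_{d_j} d_k - nabla_{d_j} nabla_{d_i} d_k. *)
Definition riemann (l i j k : 'I_n) (x : 'rV[R]_n) : R :=
  partial i (christoffel l j k) x - partial j (christoffel l i k) x
  + \sum_p (christoffel l i p x * christoffel p j k x
            - christoffel l j p x * christoffel p i k x).

(* Ric(Y, Z) is the trace of X |-> Rm(X, Y) Z. *)
Definition ricci (x : 'rV[R]_n) : 'M[R]_n :=
  \matrix_(j, k) \sum_i riemann i i j k x.

Definition scalar_curv (x : 'rV[R]_n) : R := \tr (invmx (G x) *m ricci x).

Definition hessian (f : 'rV[R]_n -> R) (x : 'rV[R]_n) : 'M[R]_n :=
  \matrix_(i, j) (partial i (partial j f) x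
                  - \sum_k christoffel k i j x * partial k f x).

End LocalRiemannian.

Section LocalImmersion.
Context {R : realType} {m n : nat}.
Variable G : 'rV[R]_n -> 'M[R]_n.
Variable F : 'rV[R]_m -> 'rV[R]_n.

Definition first_form (x : 'rV[R]_m) : 'M[R]_m :=
  jacobian F x *m G (F x) *m (jacobian F x)^T.

(* Covariant derivative, in the direction d_a, of a vector field V along F. *)
Definition cov_along (a : 'I_m) (V : 'rV[R]_m -> 'rV[R]_n) (x : 'rV[R]_m) :
    'rV[R]_n :=
  partial a V x + christoffel_op G (F x) (partial a F x) (V x).

(* A(d_a, d_b) = g(nabla_{d_a} d_b, N), where d_b is pushed forward by F. *)
Definition second_form (N : 'rV[R]_n) (x : 'rV[R]_m) : 'M[R]_m :=
  \matrix_(a, b) bilin (G (F x)) (cov_along a (partial b F) x) N.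

Definition mean_curv (N : 'rV[R]_n) (x : 'rV[R]_m) : R :=
  \tr (invmx (first_form x) *m second_form N x).

(* |A|^2 = h^{ac} h^{bd} A_{ab} A_{cd} *)
Definition second_form_sqnorm (N : 'rV[R]_n) (x : 'rV[R]_m) : R :=
  \tr (invmx (first_form x) *m second_form N x
       *m invmx (first_form x) *m (second_form N x)^T).

(* |nabla phi|^2 = h^{ab} d_a phi d_b phi *)
Definition grad_sqnorm (phi : 'rV[R]_m -> R) (x : 'rV[R]_m) : R :=
  let dphi := \row_a partial a phi x in
  bilin (invmx (first_form x)) dphi dphi.

End LocalImmersion.

Record chart (R : realType) (n : nat) (M : topologicalType) := Chart {
  cdom : set M;
  cimg : set 'rV[R]_n;
  cmap :> M -> 'rV[R]_n;
  cinv : 'rV[R]_n -> M;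
  cdom_open : open cdom;
  cimg_open : open cimg;
  cmap_img : forall p, cdom p -> cimg (cmap p);
  cinv_dom : forall x, cimg x -> cdom (cinv x);
  cmapK : forall p, cdom p -> cinv (cmap p) = p;
  cinvK : forall x, cimg x -> cmap (cinv x) = x;
  cmap_cont : forall p, cdom p -> {for p, continuous cmap};
  cinv_cont : forall x, cimg x -> {for x, continuous cinv}
}.

(* A map F between manifolds, read in the charts u (source) and c (target),
   and the open set on which this local expression is meaningful. *)
Definition local_rep (R : realType) (m n : nat) (S M : topologicalType)
    (F : S -> M) (u : chart R m S) (c : chart R n M) :
    'rV[R]_m -> 'rV[R]_n := fun x => c (F (cinv u x)).

Definition local_dom (R : realType) (m n : nat) (S M : topologicalType)
    (F : S -> M) (u : chart R m S) (c : chart R n M) : set 'rV[R]_m :=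
  [set x | cimg u x /\ cdom c (F (cinv u x))].

(* Smooth nonempty n-manifold without boundary.  The atlas need not be maximal;
   chart_at selects one chart of the atlas around each point.  The base point
   of mspace plays no role; generated sigma-algebras require a pointed type. *)
Record manifold (R : realType) (n : nat) := Manifold {
  mspace :> ptopologicalType;
  atlas : set (chart R n mspace);
  chart_at : mspace -> chart R n mspace;
  mspace_hausdorff : hausdorff_space mspace;
  mspace_second_countable : @second_countable mspace;
  chart_at_atlas : forall p, atlas (chart_at p);
  chart_at_dom : forall p, cdom (chart_at p) p;
  atlas_compat : forall c d, atlas c -> atlas d ->
    smooth_on (local_dom idfun c d) (local_rep idfun c d)
}.
Arguments atlas {R n} _.
Arguments chart_at {R n} _ _.

Definition smooth_fun (R : realType) (n : nat) (M : manifold R n)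
    (f : M -> R) : Prop :=
  forall c, atlas M c -> smooth_on (cimg c) (f \o cinv c).

Definition smooth_map (R : realType) (m n : nat) (S : manifold R m)
    (M : manifold R n) (F : S -> M) : Prop :=
  continuous F /\
  forall u c, atlas S u -> atlas M c ->
    smooth_on (local_dom F u c) (local_rep F u c).

Record metric (R : realType) (n : nat) (M : manifold R n) := Metric {
  gmx :> chart R n M -> 'rV[R]_n -> 'M[R]_n;
  gmx_smooth : forall c, atlas M c -> smooth_on (cimg c) (gmx c);
  gmx_sym : forall c x, atlas M c -> cimg c x -> (gmx c x)^T = gmx c x;
  gmx_pos : forall c x v, atlas M c -> cimg c x -> v != 0 ->
    0 < bilin (gmx c x) v v;
  gmx_compat : forall c d x, atlas M c -> atlas M d ->
    local_dom idfun c d x ->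
    let J := jacobian (local_rep idfun c d) x in
    gmx c x = J *m gmx d (local_rep idfun c d x) *m J^T
}.

Section Soliton.
Context {R : realType} {n : nat} {M : manifold R n}.
Variable g : metric M.

Definition geodesic (gamma : R -> M) : Prop :=
  continuous gamma /\
  forall c t, atlas M c -> cdom c (gamma t) ->
    let x : R -> 'rV[R]_n := fun s => c (gamma s) in
    let x' := derive1 x in
    [/\ derivable x t 1, derivable x' t 1 &
        derive1 x' t + christoffel_op (g c) (x t) (x' t) (x' t) = 0].

(* Geodesic completeness; the initial velocity v is given by its components
   in a chart c around p. *)
Definition complete : Prop :=
  forall c p (v : 'rV[R]_n), atlas M c -> cdom c p ->
    exists gamma : R -> M, [/\ geodesic gamma, gamma 0 = p &
      derive1 (fun s : R => c (gamma s)) 0 = v].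

Definition gradient_ricci_soliton (f : M -> R) (lambda : R) : Prop :=
  [/\ complete, smooth_fun f &
      forall c x, atlas M c -> cimg c x ->
        ricci (g c) x + hessian (g c) (f \o cinv c) x = lambda *: g c x].

Definition nontrivial (f : M -> R) : Prop :=
  exists c x, [/\ atlas M c, cimg c x &
                  hessian (g c) (f \o cinv c) x != 0].

Definition scalar_curv_ge (k : R) : Prop :=
  forall c x, atlas M c -> cimg c x -> k <= scalar_curv (g c) x.

End Soliton.

Record immersion (R : realType) (m n : nat) (S : manifold R m)
    (M : manifold R n) := Immersion {
  imm :> S -> M;
  imm_smooth : smooth_map imm;
  imm_free : forall u c x, atlas S u -> atlas M c -> local_dom imm u c x ->
    row_free (jacobian (local_rep imm u c) x)
}.

(* A smooth unit normal field along F: nu c p is the component vector, in the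
   chart c around F p, of the normal vector at p. *)
Record unit_normal (R : realType) (m : nat) (M : manifold R m.+1)
    (g : metric M) (S : manifold R m) (F : immersion S M) := UnitNormal {
  nvec :> chart R m.+1 M -> S -> 'rV[R]_m.+1;
  nvec_compat : forall c d p, atlas M c -> atlas M d ->
    cdom c (F p) -> cdom d (F p) ->
    nvec d p = nvec c p *m jacobian (local_rep idfun c d) (c (F p));
  nvec_smooth : forall u c, atlas S u -> atlas M c ->
    smooth_on (local_dom F u c) (nvec c \o cinv u);
  nvec_unit : forall c p, atlas M c -> cdom c (F p) ->
    bilin (g c (c (F p))) (nvec c p) (nvec c p) = 1;
  nvec_normal : forall u c x a, atlas S u -> atlas M c ->
    local_dom F u c x ->
    bilin (g c (local_rep F u c x)) (partial a (local_rep F u c) x)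
      (nvec c (cinv u x)) = 0
}.

Notation borel T := (g_sigma_algebraType (@open T)).

(* mu is the Riemannian volume measure of the metric with components h u in the
   chart u: in every chart it is sqrt(det h) dx.  It is enough to test this on
   continuous functions with compact support in the chart. *)
Definition volume_measure (R : realType) (m : nat) (S : manifold R m)
    (h : chart R m S -> 'rV[R]_m -> 'M[R]_m)
    (mu : {measure set (borel S) -> \bar R}) : Prop :=
  forall u (psi : S -> R) (K : set S), atlas S u -> continuous psi ->
    compact K -> K `<=` cdom u -> (forall p, ~ K p -> psi p = 0) ->
    (\int[mu]_p (psi p)%:E)%E =
    (integral_Rn
      ((fun x => psi (cinv u x) * Num.sqrt (\det (h u x))) \_ (cimg u)))%:E.

Section Hypersurface.
Context {R : realType} {m : nat} {M : manifold R m.+1}.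
Variables (g : metric M) (S : manifold R m) (F : immersion S M).
Variable nu : unit_normal g F.

(* The first fundamental form does not depend on the chart of M used. *)
Definition induced_metric (u : chart R m S) (x : 'rV[R]_m) : 'M[R]_m :=
  let c := chart_at M (F (cinv u x)) in
  first_form (g c) (local_rep F u c) x.

Definition A_form (u : chart R m S) (c : chart R m.+1 M) (x : 'rV[R]_m) :
    'M[R]_m :=
  second_form (g c) (local_rep F u c) (nu c (cinv u x)) x.

Definition minimal : Prop :=
  forall u c x, atlas S u -> atlas M c -> local_dom F u c x ->
    mean_curv (g c) (local_rep F u c) (nu c (cinv u x)) x = 0.

Definition ric_normal (c : chart R m.+1 M) (p : S) : R :=
  bilin (ricci (g c) (c (F p))) (nu c p) (nu c p).

(* |nabla phi|^2 - (Ric(nu, nu) + |A|^2) phi^2 at p, a quantity independent of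
   the charts used to compute it. *)
Definition stability_integrand (phi : S -> R) (p : S) : R :=
  let u := chart_at S p in
  let c := chart_at M (F p) in
  grad_sqnorm (g c) (local_rep F u c) (phi \o cinv u) (u p)
  - (ric_normal c p
     + second_form_sqnorm (g c) (local_rep F u c) (nu c p) (u p))
    * phi p ^+ 2.

(* mu is meant to be the volume measure of the induced metric. *)
Definition stable (mu : {measure set (borel S) -> \bar R}) : Prop :=
  forall phi : S -> R, smooth_fun phi ->
    (0 <= \int[mu]_p (stability_integrand phi p)%:E)%E.

Definition totally_geodesic : Prop :=
  forall u c x, atlas S u -> atlas M c -> local_dom F u c x ->
    A_form u c x = 0.

Definition vanishing_normal_ricci : Prop :=
  forall c p, atlas M c -> cdom c (F p) -> ric_normal c p = 0.

End Hypersurface.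

(* Main.v *)
(** Let F : S -> M be the immersion and take the test function
    phi = C - f o F, with C so large that phi >= 1.  The traced Gauss formula
    (minimality kills the mean curvature term) and the traced soliton equation give
      Ric(nu, nu) = Lap_S (f o F) + (R - (n - 1) lambda),
    so that the integrand of the stability inequality for phi equals
      div (phi ^ 2 grad phi) - P,
      P = (2 phi - 1) |grad phi| ^ 2 + (R - (n - 1) lambda + |A| ^ 2) phi ^ 2 >= 0.
    By the divergence theorem stability forces the integral of P to be nonpositive,
    hence P = 0.  So A = 0, R = (n - 1) lambda and f o F is locally constant, and
    then the displayed identity gives Ric(nu, nu) = 0.
    The curvature tensor is never unfolded: Ric is replaced by lambda g - Hess f, so
    only the behaviour of Hessians under maps is needed.  The divergence theorem is
    localized by a C^1 partition of unity, in charts, where it is the vanishing of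
    iterated integrals of partial derivatives of compactly supported functions. *)

Require Import Defs.
From HB Require Import structures.
From mathcomp Require Import all_boot all_order all_algebra.
From mathcomp Require Import perm ring lra.
From mathcomp Require Import all_classical all_reals all_analysis measurable_realfun.
Set Implicit Arguments.
Unset Strict Implicit.
Unset Printing Implicit Defensive.
Import Order.TTheory GRing.Theory Num.Theory.
Import numFieldNormedType.Exports.
Local Open Scope classical_set_scope.
Local Open Scope ring_scope.

(** * Calculus on coordinate spaces *)

(** In the stability integrand the term - Ric(nu, nu) phi ^ 2 equals phi ^ 2 Lap phi - (R - (n - 1)
    lambda) phi ^ 2. Completing phi ^ 2 Lap phi to a divergence costs 2 phi |grad phi| ^ 2, against
    the single |grad phi| ^ 2 that the integrand supplies: [phi] has to stay above 1/2, and the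
    bound 1 is a convenient choice. Two constraints shape the rest. Quantities on S are evaluated at
    each point in the charts that [chart_at] picks there, and these jump from point to point, so
    even continuity rests on invariance under changes of charts. And the volume measure is known
    only through continuous functions supported in one chart, so both the divergence and P are
    multiplied by partition functions before they are integrated. The cutoff functions are
    differentiated only once, in div (chi phi ^ 2 grad phi); hence C^1 is enough, and the squared
    positive part of a polynomial can replace the usual flat exponential. *)

Lemma normr_coord (R : realType) m n (A : 'M[R]_(m, n)) i j : `|A i j| <= `|A|.
Proof.
rewrite [leRHS]/Num.Def.normr/= mx_normrE.
exact: (le_bigmax _ (fun ij : 'I_m * 'I_n => `|A ij.1 ij.2|) (i, j)).
Qed.

Lemma mx_norm_le (R : realType) m n (A : 'M[R]_(m, n)) e :
  0 <= e -> (forall i j, `|A i j| <= e) -> `|A| <= e.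
Proof.
by move=> e0 Ae; rewrite [leLHS]/Num.Def.normr/= mx_normrE bigmax_le.
Qed.

Lemma cvg_mxP (R : realType) (T : Type) (F : set_system T) {FF : Filter F} m n
    (A : T -> 'M[R]_(m, n)) (l : 'M[R]_(m, n)) :
  A x @[x --> F] --> l <-> forall i j, A x i j @[x --> F] --> l i j.
Proof.
split=> [Al i j|Al].
  exact: (@cvg_comp _ _ _ A (fun M : 'M[R]_(m, n) => M i j) _ _ _ Al
    (@coord_continuous _ m n i j l)).
apply/cvgrPdist_le => /= e e0.
have H : \forall x \near F, forall ij : 'I_m * 'I_n,
    `|l ij.1 ij.2 - A x ij.1 ij.2| <= e.
  apply: (@filter_forall T ('I_m * 'I_n)%type
    (fun ij x => `|l ij.1 ij.2 - A x ij.1 ij.2| <= e) F FF) => ij.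
  by move/cvgrPdist_le: (Al ij.1 ij.2); apply.
apply: filterS H => x H; apply: mx_norm_le => [|i j]; first exact: ltW.
by rewrite !mxE; exact: (H (i, j)).
Qed.

Lemma continuous_at_mxP (R : realType) (T : topologicalType) m n
    (A : T -> 'M[R]_(m, n)) x :
  {for x, continuous A} <->
  forall i j, {for x, continuous (fun y => A y i j)}.
Proof. exact: cvg_mxP. Qed.

Lemma cvg_sumr (R : realType) (V : normedModType R) (T : Type)
    (F : set_system T) {FF : Filter F} (I : finType) (f : I -> T -> V) l :
  (forall i, f i x @[x --> F] --> l i) ->
  \sum_i f i x @[x --> F] --> \sum_i l i.
Proof. by move=> fl; apply: cvg_big => //; exact: add_continuous. Qed.

Section Line.
Context {R : realType} {n : nat}.
Implicit Types (f : 'rV[R]_n -> R) (x y v : 'rV[R]_n).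

Lemma is_derive_line (W : normedModType R) (f : 'rV[R]_n -> W) x v (t : R) :
  derivable f (x + t *: v) v ->
  is_derive t 1 (fun s : R => f (x + s *: v)) ('D_v f (x + t *: v)).
Proof.
have E : (fun h : R => h^-1 *: (f (x + (h *: 1 + t) *: v) - f (x + t *: v)))
       = (fun h : R => h^-1 *: (f (h *: v + (x + t *: v)) - f (x + t *: v))).
  apply/funext => h; congr (_ *: (f _ - _)).
  by rewrite -[h *: 1]/(h * 1) mulr1 scalerDl addrCA.
move=> fD; split; first by rewrite /derivable /= E.
by rewrite /derive /= E.
Qed.

(** The step [s] may have either sign, whence the two applications of the one-variable theorem. The
    bound on [c] is what callers need to keep the intermediate point in a ball. *)
Lemma partial_mvt f y i (s : R) :
  (forall c : R, `|c| <= `|s| -> derivable f (y + c *: basis_vec i) (basis_vec i)) ->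
  exists2 c, `|c| <= `|s| &
    f (y + s *: basis_vec i) - f y = s * partial i f (y + c *: basis_vec i).
Proof.
move=> fD; set e := basis_vec i.
pose phi := fun t : R => f (y + t *: e).
have phiD (t : R) : `|t| <= `|s| -> is_derive t 1 phi (partial i f (y + t *: e)).
  by move=> ts; apply: is_derive_line; exact: fD.
have phic (t : R) : `|t| <= `|s| -> {for t, continuous phi}.
  by move=> /phiD[+ _] => /derivable1_diffP/differentiable_continuous.
have phi0 : phi 0 = f y by rewrite /phi scale0r addr0.
have [s0|s0] := leP 0 s.
  have [||c] := @MVT_segment _ phi (fun t => partial i f (y + t *: e)) 0 s s0.
  - move=> t; rewrite in_itv /= => /andP[t0 ts]; apply: phiD.
    by rewrite !ger0_norm // ltW.
  - apply: continuous_in_subspaceT => t; rewrite inE /= in_itv /= => /andP[t0 ts].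
    by apply: phic; rewrite !ger0_norm.
  rewrite in_itv /= => /andP[c0 cs]; rewrite phi0 subr0 => E.
  by exists c; [rewrite !ger0_norm|rewrite [LHS]E mulrC].
have [||c] := @MVT_segment _ phi (fun t => partial i f (y + t *: e)) s 0 (ltW s0).
- move=> t; rewrite in_itv /= => /andP[t0 ts]; apply: phiD.
  by rewrite !ltr0_norm // lerN2 ltW.
- apply: continuous_in_subspaceT => t; rewrite inE /= in_itv /= => /andP[t0 ts].
  by apply: phic; rewrite ler0_norm // (ltr0_norm s0) lerN2.
rewrite in_itv /= => /andP[c0 cs]; rewrite phi0 sub0r => E.
exists c; first by rewrite ler0_norm // (ltr0_norm s0) lerN2.
by rewrite -[LHS]opprB E mulrN opprK mulrC.
Qed.

Lemma coord_basis_vec i j : (basis_vec i : 'rV[R]_n) 0 j = (j == i)%:R.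
Proof. by rewrite mxE. Qed.

Lemma norm_basis_vec i (s : R) : `|s *: (basis_vec i : 'rV[R]_n)| <= `|s|.
Proof.
apply: mx_norm_le => // k j; rewrite mxE ord1 coord_basis_vec.
by case: (_ == _); rewrite ?mulr1 ?mulr0 ?normr0.
Qed.

(** The vectors [trunc_vec j v] form a staircase from 0 to [v] that moves one coordinate at a
    time. *)
Definition trunc_vec (j : nat) (v : 'rV[R]_n) : 'rV[R]_n :=
  \row_i (if (i < j)%N then v 0 i else 0).

Lemma trunc_vec0 v : trunc_vec 0 v = 0.
Proof. by apply/rowP => i; rewrite !mxE. Qed.

Lemma trunc_vec_full v : trunc_vec n v = v.
Proof. by apply/rowP => i; rewrite !mxE ltn_ord. Qed.

Lemma trunc_vecS (j : 'I_n) v :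
  trunc_vec j.+1 v = trunc_vec j v + v 0 j *: basis_vec j.
Proof.
apply/rowP => i; rewrite !mxE /=.
have -> : (i == j) = (i == j :> nat) by [].
by rewrite ltnS; case: ltngtP => [_|_|/ord_inj->];
  rewrite ?(mulr0n, mulr1n, mulr0, mulr1, addr0, add0r).
Qed.

Lemma norm_trunc_vec j v (c : R) (k : 'I_n) : (k >= j)%N -> `|c| <= `|v 0 k| ->
  `|trunc_vec j v + c *: basis_vec k| <= `|v|.
Proof.
move=> kj cv; apply: mx_norm_le => // i l; rewrite ord1 !mxE /=.
have [->|lk] := eqVneq l k.
  by rewrite ltnNge kj /= add0r mulr1n mulr1 (le_trans cv) // normr_coord.
by rewrite mulr0n mulr0 addr0; case: ifP => _; rewrite ?normr0 // normr_coord.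
Qed.

(** The increment of [f] is telescoped along the staircase [x + trunc_vec j h]. By [partial_mvt]
    each stair contributes a partial derivative at a point no farther than [h] from [x], hence close
    to the one at [x]. *)
Lemma continuous_partials_differentiable f x :
  (\forall y \near x, forall i, derivable f y (basis_vec i)) ->
  (forall i, {for x, continuous (partial i f)}) ->
  differentiable f x.
Proof.
move=> /nbhs_ballP[r /= r0 fD] fc.
pose df := fun v : 'rV[R]_n => \sum_j v 0 j * partial j f x.
have dfl : linear df.
  move=> a u v; rewrite /df scaler_sumr -big_split /=; apply: eq_bigr => i _.
  by rewrite !mxE mulrDl -mulrA.
pose dfL := GRing.isLinear.Build _ _ _ _ df dfl.
pose dfl' : {linear 'rV[R]_n -> R} := HB.pack df dfL.
have dfc : continuous dfl'.
  move=> v; rewrite /= /df.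
  apply: (@cvg_sumr _ _ _ (nbhs v) _ _
    (fun j (u : 'rV[R]_n) => u 0 j * partial j f x)) => j.
  by apply: cvgMl; exact: coord_continuous.
(* [diff_unique] turns a first-order expansion into the value of the differential. The expansion,
   proved below, is kept by [conj] because [diff_locallyP] needs it too. *)
have [|fE dE] := (fun H => conj H (@diff_unique _ _ _ f dfl' x dfc H));
  last by apply/diff_locallyP; rewrite dE.
apply/eqaddoP => /= e e0.
(* There are [n] stairs; dividing by [n.+1] also covers [n = 0]. *)
have en0 : 0 < e / n.+1%:R by rewrite divr_gt0.
have fc' : \forall y \near x, forall i, `|partial i f x - partial i f y| <= e / n.+1%:R.
  apply: (@filter_forall _ _
    (fun i y => `|partial i f x - partial i f y| <= e / n.+1%:R) (nbhs x) _) => i.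
  by move: (fc i) => /cvgrPdist_le; apply.
have [d /= d0 fd] := (nbhs_ballP _ _).1 fc'.
have rd0 : 0 < Num.min r d by rewrite lt_min r0.
apply: filterS (@nbhs0_lt _ 'rV[R]_n _ rd0) => h; rewrite lt_min => /andP[hr hd].
rewrite [X in `|X| <= _](_ : _ = f (h + x) - (f x + df h)) //.
have -> : f (h + x) = f x + \sum_(j < n) (f (x + trunc_vec j.+1 h) - f (x + trunc_vec j h)).
  rewrite -(big_mkord xpredT (fun j => f (x + trunc_vec j.+1 h) - f (x + trunc_vec j h))).
  by rewrite telescope_sumr // trunc_vec0 trunc_vec_full addr0 subrKC [x + h]addrC.
rewrite opprD addrACA subrr add0r /df -sumrB.
apply: (le_trans (ler_norm_sum _ _ _)).
apply: (@le_trans _ _ (\sum_(j < n) (e / n.+1%:R * `|h|))); last first.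
  rewrite sumr_const card_ord -mulrnAl ler_wpM2r // -mulr_natr -mulrA.
  by rewrite ler_piMr ?ltW // mulrC ltr_pdivrMr // mul1r ltr_nat.
apply: ler_sum => j _.
have xb (c : R) : `|c| <= `|h 0 j| ->
    ball x (Num.min r d) (x + trunc_vec j h + c *: basis_vec j).
  move=> ch; rewrite -ball_normE /= -addrA opprD addNKr normrN lt_min.
  by rewrite !(le_lt_trans (norm_trunc_vec (leqnn j) ch)).
rewrite trunc_vecS addrA.
have [|c ch ->] := @partial_mvt f (x + trunc_vec j h) j (h 0 j).
  by move=> c /xb xc; apply: fD; apply: le_ball xc; rewrite ge_min lexx.
rewrite -mulrBr normrM mulrC; apply: ler_pM => //; last exact: normr_coord.
by rewrite distrC; apply: fd; apply: le_ball (xb c ch); rewrite ge_min lexx orbT.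
Qed.

End Line.

(** * Closure properties of [Ck] and symmetry of second derivatives *)

Section CkTheory.
Context {R : realType} {n : nat}.
Implicit Types (U V : set 'rV[R]_n) (x : 'rV[R]_n).

Lemma Ck_cont (W : normedModType R) k U (f : 'rV[R]_n -> W) x :
  Ck k U f -> U x -> {for x, continuous f}.
Proof. by case: k => [|k] [fc _]; exact: fc. Qed.

Lemma Ck_derivable (W : normedModType R) k U (f : 'rV[R]_n -> W) x i :
  Ck k.+1 U f -> U x -> derivable f x (basis_vec i).
Proof. by move=> [_ fD]; exact: (fD i).1. Qed.

Lemma Ck_partial (W : normedModType R) k U (f : 'rV[R]_n -> W) i :
  Ck k.+1 U f -> Ck k U (partial i f).
Proof. by move=> [_ fD]; exact: (fD i).2. Qed.

Lemma CkW (W : normedModType R) k U (f : 'rV[R]_n -> W) :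
  Ck k.+1 U f -> Ck k U f.
Proof.
elim: k f => [|k IH] f [fc fD]; first by split.
by split=> // i; have [? ?] := fD i; split=> //; exact: IH.
Qed.

Lemma Ck_sub (W : normedModType R) k U V (f : 'rV[R]_n -> W) :
  V `<=` U -> Ck k U f -> Ck k V f.
Proof.
move=> VU; elim: k f => [|k IH] f [fc fD]; (split; first by move=> x /VU; exact: fc) => // i.
by have [f1 f2] := fD i; split=> [x /VU|]; [exact: f1|exact: IH].
Qed.

Lemma partial_near (W : normedModType R) (f g : 'rV[R]_n -> W) i x :
  (\forall y \near x, f y = g y) -> partial i f x = partial i g x.
Proof. exact: near_eq_derive. Qed.

Lemma partial_open (W : normedModType R) U (f g : 'rV[R]_n -> W) i x :
  open U -> (forall y, U y -> f y = g y) -> U x -> partial i f x = partial i g x.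
Proof.
move=> oU fg Ux; apply: partial_near.
by apply: filterS fg _; apply: open_nbhs_nbhs.
Qed.

Lemma derivable_open (W : normedModType R) U (f g : 'rV[R]_n -> W) v x :
  open U -> (forall y, U y -> f y = g y) -> U x -> derivable f x v ->
  derivable g x v.
Proof.
move=> oU fg Ux; apply: near_eq_derivable.
by apply: filterS fg _; apply: open_nbhs_nbhs.
Qed.

Lemma continuous_open (T T' : topologicalType) (U : set T) (f g : T -> T') (x : T) :
  open U -> (forall y, U y -> f y = g y) -> U x -> {for x, continuous f} ->
  {for x, continuous g}.
Proof.
move=> oU fg Ux fc; rewrite /prop_for /continuous_at -(fg x Ux).
apply: cvg_trans fc; apply: near_eq_cvg.
by apply: filterS fg _; apply: open_nbhs_nbhs.
Qed.

Lemma Ck_eq (W : normedModType R) k U (f g : 'rV[R]_n -> W) :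
  open U -> (forall x, U x -> f x = g x) -> Ck k U f -> Ck k U g.
Proof.
move=> oU; elim: k f g => [|k IH] f g fg [fc fD];
  (split; first by move=> x Ux; exact: continuous_open oU fg Ux (fc x Ux)) => // i.
have [f1 f2] := fD i; split=> [x Ux|]; first exact: derivable_open oU fg Ux (f1 x Ux).
by apply: IH f2 => x Ux; exact: partial_open oU fg Ux.
Qed.

(** The sets [V] need not be open: [Ck] imposes continuity and derivability of the unrestricted
    function at the points of the set. *)
Lemma Ck_local (W : normedModType R) k U (f : 'rV[R]_n -> W) :
  (forall x, U x -> exists V, V x /\ Ck k V f) -> Ck k U f.
Proof.
elim: k f => [|k IH] f fV;
  (split; first by move=> x /fV[V [Vx [+ _]]]; exact) => // i.
split=> [x /fV[V [Vx fk]]|]; first exact: Ck_derivable fk Vx.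
by apply: IH => x /fV[V [Vx fk]]; exists V; split=> //; exact: Ck_partial.
Qed.

Lemma Ck_cst (W : normedModType R) k U (w : W) : Ck k U (fun=> w).
Proof.
elim: k w => [|k IH] w; (split; first by move=> x _; exact: cst_continuous) => // i.
split=> [x _|]; first exact: derivable_cst.
suff -> : partial i (fun=> w) = (fun=> 0) by [].
by apply/funext => x; exact: derive_cst.
Qed.

Lemma CkD (W : normedModType R) k U (f g : 'rV[R]_n -> W) : open U ->
  Ck k U f -> Ck k U g -> Ck k U (fun x => f x + g x).
Proof.
move=> oU; elim: k f g => [|k IH] f g [fc fD] [gc gD];
  (split; first by move=> x Ux; apply: continuousD; [exact: fc|exact: gc]) => // i.
have [f1 f2] := fD i; have [g1 g2] := gD i; split=> [x Ux|].
  by apply: derivableD; [exact: f1|exact: g1].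
apply: Ck_eq (IH _ _ f2 g2) => // x Ux.
by rewrite /partial deriveD //; [exact: f1|exact: g1].
Qed.

Lemma CkM k U (f g : 'rV[R]_n -> R) : open U ->
  Ck k U f -> Ck k U g -> Ck k U (fun x => f x * g x).
Proof.
move=> oU; elim: k f g => [|k IH] f g fk gk; have [fc fD] := fk;
  have [gc gD] := gk;
  (split; first by move=> x Ux; apply: continuousM; [exact: fc|exact: gc]) => // i.
have [f1 f2] := fD i; have [g1 g2] := gD i; split=> [x Ux|].
  by apply: derivableM; [exact: f1|exact: g1].
apply: (@Ck_eq _ _ _ (fun x => f x * partial i g x + g x * partial i f x)) => //.
  by move=> x Ux; rewrite /partial deriveM //; [exact: f1|exact: g1].
by apply: CkD => //; apply: IH => //; exact: CkW.
Qed.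

Lemma Ck_sum (W : normedModType R) k U (I : Type) (r : seq I) (P : pred I)
    (f : I -> 'rV[R]_n -> W) : open U ->
  (forall i, P i -> Ck k U (f i)) ->
  Ck k U (fun x => \sum_(i <- r | P i) f i x).
Proof.
move=> oU fk; elim: r => [|a r IH].
  by apply: Ck_eq (@Ck_cst _ k U 0) => // x _; rewrite big_nil.
have [Pa|nPa] := boolP (P a).
  apply: Ck_eq (CkD oU (fk a Pa) IH) => // x _.
  by rewrite big_cons Pa.
by apply: Ck_eq IH => // x _; rewrite big_cons (negPf nPa).
Qed.

Lemma CkN k U (f : 'rV[R]_n -> R) : open U -> Ck k U f -> Ck k U (fun x => - f x).
Proof.
move=> oU fk; apply: Ck_eq (CkM oU (@Ck_cst _ k U (-1 : R)) fk) => // x _.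
by rewrite mulN1r.
Qed.

Lemma CkB k U (f g : 'rV[R]_n -> R) : open U ->
  Ck k U f -> Ck k U g -> Ck k U (fun x => f x - g x).
Proof. by move=> oU fk gk; apply: CkD => //; exact: CkN. Qed.

Lemma Ck_prod k U (I : Type) (r : seq I) (P : pred I)
    (f : I -> 'rV[R]_n -> R) : open U ->
  (forall i, P i -> Ck k U (f i)) ->
  Ck k U (fun x => \prod_(i <- r | P i) f i x).
Proof.
move=> oU fk; elim: r => [|a r IH].
  by apply: Ck_eq (@Ck_cst R k U 1) => // x _; rewrite big_nil.
have [Pa|nPa] := boolP (P a).
  apply: Ck_eq (CkM oU (fk a Pa) IH) => // x _.
  by rewrite big_cons Pa.
by apply: Ck_eq IH => // x _; rewrite big_cons (negPf nPa).
Qed.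

(** The induction closes because the partial derivatives of the inverse are products of the inverse
    itself with a derivative of [f]. The same mechanism gives [Ck_sqrt]. *)
Lemma CkV k U (f : 'rV[R]_n -> R) : open U -> (forall x, U x -> f x != 0) ->
  Ck k U f -> Ck k U (fun x => (f x)^-1).
Proof.
move=> oU f0; elim: k => [|k IH] fk; have [fc fD] := fk;
  (split; first by move=> x Ux; apply: continuousV; [exact: f0|exact: fc]) => // i.
have [f1 f2] := fD i; split=> [x Ux|].
  by apply: derivableV; [exact: f0|exact: f1].
apply: (@Ck_eq _ _ _ (fun x => - ((f x)^-1 * (f x)^-1 * partial i f x))) => //.
  move=> x Ux; rewrite /partial deriveV ?f0 //; last exact: f1.
  by rewrite expr2 invfM -[RHS]/(_ * _) mulNr.
have fV := IH (CkW fk); apply: CkN => //; apply: CkM => //; exact: CkM.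
Qed.

Lemma is_derive_line0 (W : normedModType R) (f : 'rV[R]_n -> W) x v d :
  is_derive x v f d <-> is_derive (0 : R) 1 (fun s : R => f (x + s *: v)) d.
Proof.
have E : (fun h : R => h^-1 *: (f (x + (h *: 1 + 0) *: v) - f (x + 0 *: v)))
       = (fun h : R => h^-1 *: (f (h *: v + x) - f x)).
  apply/funext => h; rewrite scale0r !addr0; congr (_ *: (f _ - _)).
  by rewrite -[h *: 1]/(h * 1) mulr1 addrC.
split=> -[fD fd]; split.
- by rewrite /derivable /= E.
- by rewrite /derive /= E.
- by move: fD; rewrite /derivable /= E.
- by move: fd; rewrite /derive /= E.
Qed.

(** [f] is only known to have a derivative along [v], so the composite is moved to the line through
    [x], where the one-variable chain rule applies. *)
Lemma is_derive_comp1 (g : R -> R) (f : 'rV[R]_n -> R) x v dg df :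
  is_derive x v f df -> is_derive (f x) 1 g dg ->
  is_derive x v (g \o f) (dg * df).
Proof.
move=> /is_derive_line0 fD gD; apply/is_derive_line0.
rewrite -[dg * df]/(dg *: df).
by apply: (@is_derive1_comp _ g (fun s : R => f (x + s *: v))); rewrite scale0r addr0.
Qed.

Lemma is_derive_sqrt (f : 'rV[R]_n -> R) x v : derivable f x v -> 0 < f x ->
  is_derive x v (fun y => Num.sqrt (f y)) ((2 * Num.sqrt (f x))^-1 * 'D_v f x).
Proof.
move=> /derivableP fD f0; apply: (is_derive_comp1 fD).
exact: is_derive1_sqrt.
Qed.

Lemma Ck_sqrt k U (f : 'rV[R]_n -> R) : open U -> (forall x, U x -> 0 < f x) ->
  Ck k U f -> Ck k U (fun x => Num.sqrt (f x)).
Proof.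
move=> oU f0; elim: k => [|k IH] fk; have [fc fD] := fk;
  (split; first by move=> x Ux;
     apply: (@continuous_comp _ _ _ f); [exact: fc|exact: sqrt_continuous]) => // i.
have [f1 f2] := fD i; split=> [x Ux|].
  by have [] := is_derive_sqrt (f1 x Ux) (f0 x Ux).
apply: (@Ck_eq _ _ _ (fun x => (2 * Num.sqrt (f x))^-1 * partial i f x)) => //.
  by move=> x Ux; have [_ <-] := is_derive_sqrt (f1 x Ux) (f0 x Ux).
apply: CkM => //; apply: CkV => // [x Ux|].
  by rewrite mulf_neq0 // sqrtr_eq0 -ltNge f0.
by apply: CkM => //; [exact: Ck_cst|exact: IH (CkW fk)].
Qed.

Lemma partial_mx m p (A : 'rV[R]_n -> 'M[R]_(m, p)) a x i j :
  derivable A x (basis_vec a) ->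
  partial a (fun y => A y i j) x = partial a A x i j.
Proof. by move=> AD; rewrite /partial (derive_mx AD) mxE. Qed.

Lemma Ck_mxP m p k U (A : 'rV[R]_n -> 'M[R]_(m, p)) : open U ->
  Ck k U A <-> forall i j, Ck k U (fun x => A x i j).
Proof.
move=> oU; split.
  elim: k A => [|k IH] A [Ac AD] i j;
    (split; first by move=> x Ux; move: (Ac x Ux) => /continuous_at_mxP; exact) => // a.
  have [A1 A2] := AD a; split=> [x Ux|].
    by move: (A1 x Ux) => /derivable_mxP; exact.
  apply: Ck_eq (IH _ A2 i j) => // x Ux; rewrite partial_mx //; exact: A1.
elim: k A => [|k IH] A Aij;
  (split; first by move=> x Ux; apply/continuous_at_mxP => i j;
     exact: Ck_cont (Aij i j) Ux) => // a.
have A1 x : U x -> derivable A x (basis_vec a).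
  by move=> Ux; apply/derivable_mxP => i j; exact: Ck_derivable (Aij i j) Ux.
split=> //; apply: IH => i j.
apply: Ck_eq (Ck_partial a (Aij i j)) => // x Ux; rewrite partial_mx //; exact: A1.
Qed.

Lemma Ck_coord k U i : open U -> Ck k U (fun x => x 0 i).
Proof.
have De j x : derivable (fun x : 'rV[R]_n => x 0 i) x (basis_vec j) /\
    partial j (fun x : 'rV[R]_n => x 0 i) x = (i == j)%:R.
  have /derivable_mxP Di := @derivable_id _ 'rV[R]_n x (basis_vec j); split => //.
  rewrite (@partial_mx _ _ id); last exact: derivable_id.
  by rewrite /partial derive_id coord_basis_vec.
move=> oU; case: k => [|k]; (split; first by move=> x _; exact: coord_continuous) => // j.
split=> [x _|]; first exact: (De j x).1.
have -> : partial j (fun x : 'rV[R]_n => x 0 i) = fun=> (i == j)%:R.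
  by apply/funext => x; exact: (De j x).2.
exact: Ck_cst.
Qed.

Lemma Ck1_differentiable k U (f : 'rV[R]_n -> R) x : open U -> U x ->
  Ck k.+1 U f -> differentiable f x.
Proof.
move=> oU Ux fk; apply: continuous_partials_differentiable => [|i].
  apply: filterS (open_nbhs_nbhs (conj oU Ux)) => y Uy i.
  exact: Ck_derivable fk Uy.
exact: Ck_cont (Ck_partial i fk) Ux.
Qed.

Lemma differentiable_rV p (F : 'rV[R]_n -> 'rV[R]_p) x :
  (forall j, differentiable (fun y => F y 0 j) x) -> differentiable F x.
Proof.
move=> FD.
have -> : F = \sum_(j < p) (fun y => F y 0 j *: (delta_mx 0 j : 'rV[R]_p)).
  apply/funext => y; rewrite fct_sumE; exact: row_sum_delta.
by apply: differentiable_sum => j; exact: differentiableZl.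
Qed.

Lemma Ck1_differentiable_rV p k U (F : 'rV[R]_n -> 'rV[R]_p) x : open U -> U x ->
  Ck k.+1 U F -> differentiable F x.
Proof.
move=> oU Ux /(Ck_mxP _ _ oU) Fk; apply: differentiable_rV => j.
exact: Ck1_differentiable (Fk 0 j).
Qed.

(** The mean value theorem is used twice: in direction [i] for the difference [phi] of [f] in
    direction [j], then in direction [j] for [partial i f]. *)
Lemma second_difference_mvt U (f : 'rV[R]_n -> R) i j x (r s : R) : Ck 2 U f ->
  ball x r `<=` U -> `|s| + `|s| < r ->
  exists2 y, ball x r y &
    f (x + s *: basis_vec i + s *: basis_vec j) - f (x + s *: basis_vec i)
    - (f (x + s *: basis_vec j) - f x) = s * (s * partial j (partial i f) y).
Proof.
move=> fk xU sr.
have bx (c d : R) k l : `|c| <= `|s| -> `|d| <= `|s| ->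
    ball x r (x + c *: basis_vec k + d *: basis_vec l).
  move=> cs ds; rewrite -ball_normE /= -addrA opprD addNKr normrN.
  apply: le_lt_trans (ler_normD _ _) _; apply: le_lt_trans sr.
  by rewrite lerD // (le_trans (norm_basis_vec _ _)).
pose phi y := f (y + s *: basis_vec j) - f y.
have bx1 (c : R) k : `|c| <= `|s| -> ball x r (x + c *: basis_vec k).
  by move=> cs; have := @bx c 0 k k cs; rewrite scale0r addr0 normr0; apply.
have shiftD (c : R) : `|c| <= `|s| ->
    is_derive (x + c *: basis_vec i) (basis_vec i) (fun y => f (y + s *: basis_vec j))
      (partial i f (x + c *: basis_vec i + s *: basis_vec j)).
  move=> cs; apply/is_derive_line0.
  have -> : (fun t : R => f (x + c *: basis_vec i + t *: basis_vec i + s *: basis_vec j))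
          = (fun t : R => f (x + c *: basis_vec i + s *: basis_vec j + t *: basis_vec i)).
    by apply/funext => t; rewrite addrAC.
  apply/is_derive_line0; apply: derivableP.
  by apply: (Ck_derivable fk); apply: xU; exact: bx.
have fD (c : R) : `|c| <= `|s| -> derivable f (x + c *: basis_vec i) (basis_vec i).
  by move=> cs; apply: (Ck_derivable fk); apply: xU; exact: bx1.
have [|c cs phiE] := @partial_mvt _ _ phi x i s.
  by move=> c cs; apply: derivableB; [have [] := shiftD c cs|exact: fD].
have [|d ds E] := @partial_mvt _ _ (partial i f) (x + c *: basis_vec i) j s.
  move=> d ds; apply: (Ck_derivable (Ck_partial i fk)); apply: xU; exact: bx.
exists (x + c *: basis_vec i + d *: basis_vec j); first exact: bx.
rewrite -E -[LHS]/(phi _ - phi _) phiE; congr (_ * _).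
rewrite /partial deriveB; [|by have [] := shiftD c cs|exact: fD].
by have [_ ->] := shiftD c cs.
Qed.

Lemma second_difference_swap (V : zmodType) (a b c d : V) :
  a - b - (c - d) = a - c - (b - d).
Proof. by rewrite !opprB ![a - _ + _]addrACA [- b - c]addrC. Qed.

Lemma not_near_both (a b c : R) :
  `|a - c| < `|a - b| / 2 -> `|b - c| < `|a - b| / 2 -> False.
Proof.
move=> ac bc; suff : `|a - b| < `|a - b| by rewrite ltxx.
rewrite [ltRHS]splitr -{1}(subrKA c).
by apply: le_lt_trans (ler_normD _ _) _; rewrite ltrD // distrC.
Qed.

Lemma quarter_add_lt (r : R) : 0 < r -> r / 4 + r / 4 < r.
Proof. lra. Qed.

(** The second difference over a small square is symmetric in the two directions, so dividing it by
    [s] twice gives a value of each mixed derivative near [x]. This common value would be within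
    half the gap of both mixed derivatives at [x]. *)
Lemma schwarz U (f : 'rV[R]_n -> R) i j x : open U -> U x -> Ck 2 U f ->
  partial i (partial j f) x = partial j (partial i f) x.
Proof.
move=> oU Ux fk; apply/eqP/negPn/negP => neq.
pose e := `|partial i (partial j f) x - partial j (partial i f) x| / 2.
have e0 : 0 < e by rewrite divr_gt0 // normr_gt0 subr_eq0.
have near_partial k l : \forall y \near x,
    `|partial k (partial l f) x - partial k (partial l f) y| < e.
  have := Ck_cont (Ck_partial k (Ck_partial l fk)) Ux.
  by move=> /cvgrPdist_lt; apply.
have : nbhs x U by exact: open_nbhs_nbhs.
move=> /(filterI (filterI (near_partial i j) (near_partial j i)))/nbhs_ballP[r /= r0 rU].
(* A corner of the square is at most two steps away from [x]; with a quarter of [r] two steps stay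
   below [r]. *)
pose s := r / 4.
have s0 : 0 < s by rewrite divr_gt0.
have sr : `|s| + `|s| < r.
  by rewrite gtr0_norm //; exact: quarter_add_lt.
have [|y yr E1] := @second_difference_mvt U f i j x r s fk _ sr.
  by move=> z /rU[].
have [|z zr E2] := @second_difference_mvt U f j i x r s fk _ sr.
  by move=> z /rU[].
have E : partial j (partial i f) y = partial i (partial j f) z.
  apply: (mulfI (lt0r_neq0 s0)); apply: (mulfI (lt0r_neq0 s0)).
  apply: etrans (esym E1) _.
  apply: etrans _ E2.
  rewrite (addrAC x (s *: basis_vec j)).
  exact: second_difference_swap.
have [[_ y2] _] := rU y yr; have [[z1 _] _] := rU z zr.
move: y2; rewrite [X in `|_ - X|]E => y2.
exact: (@not_near_both _ _ _ z1 y2).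
Qed.

End CkTheory.

Section MatrixDerivatives.
Context {R : realType} {V : normedModType R}.
Implicit Types (x v : V).

Lemma is_derive_mxP m n (A : V -> 'M[R]_(m, n)) x v dA :
  is_derive x v A dA <-> forall i j, is_derive x v (fun y => A y i j) (dA i j).
Proof.
split=> [[AD <-] i j|AD].
  have /derivable_mxP/(_ i j) Aij := AD.
  by split=> //; rewrite derive_mx // mxE.
have AD' : derivable A x v by apply/derivable_mxP => i j; case: (AD i j).
split=> //; rewrite derive_mx //; apply/matrixP => i j; rewrite mxE.
by case: (AD i j).
Qed.

Lemma is_derive_sumr (W : normedModType R) n (f : 'I_n -> V -> W) x v df :
  (forall i, is_derive x v (f i) (df i)) ->
  is_derive x v (fun y => \sum_i f i y) (\sum_i df i).
Proof.
move=> fD; have -> : (fun y => \sum_i f i y) = \sum_i f i.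
  by apply/funext => y; rewrite fct_sumE.
exact: is_derive_sum.
Qed.

Lemma is_derive_mulmx m n p (A : V -> 'M[R]_(m, n)) (B : V -> 'M[R]_(n, p))
    x v dA dB : is_derive x v A dA -> is_derive x v B dB ->
  is_derive x v (fun y => A y *m B y) (dA *m B x + A x *m dB).
Proof.
move=> /is_derive_mxP AD /is_derive_mxP BD; apply/is_derive_mxP => i j.
rewrite !mxE -big_split /=.
under [fun y => _]eq_fun do rewrite mxE.
apply: is_derive_sumr => k.
have D := is_deriveM (AD i k) (BD k j).
apply: (is_derive_eq D).
by rewrite -[X in X + _]/(_ * _) -[X in _ + X]/(_ * _) [in RHS]addrC [dA i k * _]mulrC.
Qed.

Lemma is_derive_trmx m n (A : V -> 'M[R]_(m, n)) x v dA :
  is_derive x v A dA -> is_derive x v (fun y => (A y)^T) dA^T.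
Proof.
move=> /is_derive_mxP AD; apply/is_derive_mxP => i j; rewrite mxE.
by under [fun y => _]eq_fun do rewrite mxE.
Qed.

End MatrixDerivatives.

Section BilinTheory.
Context {R : realType} {n : nat}.
Implicit Types (B : 'M[R]_n) (u v w : 'rV[R]_n).

Lemma bilinE B v w : bilin B v w = \sum_i \sum_j v 0 i * w 0 j * B i j.
Proof.
rewrite /bilin mxE exchange_big /=; apply: eq_bigr => j _.
rewrite !mxE mulr_suml; apply: eq_bigr => i _; by rewrite mulrAC.
Qed.

Lemma bilinDl B u v w : bilin B (u + v) w = bilin B u w + bilin B v w.
Proof. by rewrite /bilin !mulmxDl mxE. Qed.

Lemma bilinZl B (a : R) v w : bilin B (a *: v) w = a * bilin B v w.
Proof. by rewrite /bilin -!scalemxAl mxE. Qed.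

Lemma bilinBl B u v w : bilin B (u - v) w = bilin B u w - bilin B v w.
Proof. by rewrite -scaleN1r bilinDl bilinZl mulN1r. Qed.

Lemma bilin0l B w : bilin B 0 w = 0.
Proof. by rewrite /bilin !mul0mx mxE. Qed.

Lemma bilinDm B B' v w : bilin (B + B') v w = bilin B v w + bilin B' v w.
Proof. by rewrite /bilin mulmxDr mulmxDl mxE. Qed.

Lemma bilinZm B (a : R) v w : bilin (a *: B) v w = a * bilin B v w.
Proof. by rewrite /bilin -scalemxAr -scalemxAl mxE. Qed.

Lemma bilinBm B B' v w : bilin (B - B') v w = bilin B v w - bilin B' v w.
Proof. by rewrite -scaleN1r bilinDm bilinZm mulN1r. Qed.

Lemma bilinT B v w : bilin B^T v w = bilin B w v.
Proof.
rewrite /bilin -[in RHS](trmxK (w *m B *m v^T)) [in RHS]mxE.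
by rewrite !trmx_mul trmxK mulmxA.
Qed.

Lemma bilin_sym B v w : B^T = B -> bilin B v w = bilin B w v.
Proof. by move=> BT; rewrite -bilinT BT. Qed.

Lemma bilin_basis B i j : bilin B (basis_vec i) (basis_vec j) = B i j.
Proof.
rewrite /bilin -rowE trmx_delta -colE !mxE //.
Qed.

Lemma bilin_suml B (I : Type) (r : seq I) (F : I -> 'rV[R]_n) v :
  bilin B (\sum_(i <- r) F i) v = \sum_(i <- r) bilin B (F i) v.
Proof.
elim: r => [|i r IH]; last by rewrite !big_cons bilinDl IH.
by rewrite !big_nil bilin0l.
Qed.

Lemma row_basis v : v = \sum_i v 0 i *: basis_vec i.
Proof. exact: row_sum_delta. Qed.

Lemma bilin_eq0 B v : B \in unitmx -> (forall i, bilin B v (basis_vec i) = 0) ->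
  v = 0.
Proof.
move=> Bu vB; apply: (can_inj (mulmxK Bu)); rewrite mul0mx.
apply/rowP => i; have := vB i; rewrite /bilin trmx_delta -colE !mxE //.
Qed.

End BilinTheory.

Lemma bilin_mulmx (R : realType) m n (J : 'M[R]_(m, n)) (B : 'M[R]_n) v w :
  bilin (J *m B *m J^T) v w = bilin B (v *m J) (w *m J).
Proof. by rewrite /bilin trmx_mul !mulmxA. Qed.

Lemma is_derive_bilin (R : realType) (V : normedModType R) n
    (B : V -> 'M[R]_n) (p q : V -> 'rV[R]_n) x v dB dp dq :
  is_derive x v B dB -> is_derive x v p dp -> is_derive x v q dq ->
  is_derive x v (fun y => bilin (B y) (p y) (q y))
    (bilin dB (p x) (q x) + bilin (B x) dp (q x) + bilin (B x) (p x) dq).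
Proof.
move=> BD pD qD; rewrite /bilin.
have D := is_derive_mulmx (is_derive_mulmx pD BD) (is_derive_trmx qD).
move/is_derive_mxP: D => /(_ 0 0) D; apply: (is_derive_eq D).
by rewrite mulmxDl !mxE; congr (_ + _); rewrite addrC.
Qed.

Section JacobianEntries.
Context {R : realType} {m n : nat}.
Implicit Types (F : 'rV[R]_m -> 'rV[R]_n).

Lemma partial_jacobian F a x : differentiable F x ->
  partial a F x = basis_vec a *m jacobian F x.
Proof. exact: deriveEjacobian. Qed.

Lemma jacobianE F a j x : differentiable F x ->
  jacobian F x a j = partial a F x 0 j.
Proof. by move=> FD; rewrite partial_jacobian // /basis_vec -rowE [RHS]mxE. Qed.

End JacobianEntries.

Section ChainRule.
Context {R : realType} {m n : nat}.
Implicit Types (F : 'rV[R]_m -> 'rV[R]_n).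

Lemma derive_comp (W : normedModType R) F (f : 'rV[R]_n -> W) x v :
  differentiable F x -> differentiable f (F x) ->
  'D_v (f \o F) x = 'D_('D_v F x) f (F x).
Proof.
move=> FD fD; rewrite !deriveE //; last exact: differentiable_comp.
by rewrite diff_comp.
Qed.

Lemma derive_partial (f : 'rV[R]_n -> R) y v : differentiable f y ->
  'D_v f y = \sum_j v 0 j * partial j f y.
Proof.
move=> fD; rewrite deriveE // {1}(row_basis v) linear_sum /=.
by apply: eq_bigr => j _; rewrite linearZ /= /partial deriveE.
Qed.

Lemma partial_comp F (f : 'rV[R]_n -> R) a x :
  differentiable F x -> differentiable f (F x) ->
  partial a (f \o F) x = \sum_j partial a F x 0 j * partial j f (F x).
Proof. by move=> FD fD; rewrite /partial derive_comp // derive_partial. Qed.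

Lemma partial_comp_rV p F (f : 'rV[R]_n -> 'rV[R]_p) a x :
  differentiable F x -> differentiable f (F x) ->
  partial a (f \o F) x = partial a F x *m jacobian f (F x).
Proof.
by move=> FD fD; rewrite {1}/partial derive_comp // deriveEjacobian.
Qed.

Lemma jacobian_comp p F (f : 'rV[R]_n -> 'rV[R]_p) x :
  differentiable F x -> differentiable f (F x) ->
  jacobian (f \o F) x = jacobian F x *m jacobian f (F x).
Proof.
move=> FD fD; apply/row_matrixP => a; rewrite row_mul !rowE.
have <- := partial_jacobian a (differentiable_comp FD fD).
by rewrite partial_comp_rV // partial_jacobian.
Qed.

(** Only [f] varies in the induction: the partial derivatives of the composite are sums of
    derivatives of [F] times functions [partial j f \o F], with the same [F]. *)
Lemma Ck_comp k (U : set 'rV[R]_m) (V : set 'rV[R]_n) F (f : 'rV[R]_n -> R) :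
  open U -> open V -> (forall x, U x -> V (F x)) ->
  Ck k V f -> Ck k U F -> Ck k U (f \o F).
Proof.
move=> oU oV UV; elim: k f => [|k IH] f fk Fk;
  (split; first by move=> x Ux; apply: continuous_comp;
     [exact: Ck_cont Fk Ux|exact: Ck_cont fk (UV _ Ux)]) => // a.
have FD x : U x -> differentiable F x by move=> Ux; exact: Ck1_differentiable_rV Fk.
have fD x : U x -> differentiable f (F x).
  by move=> Ux; apply: Ck1_differentiable fk; [exact: oV|exact: UV].
split=> [x Ux|].
  by apply: diff_derivable; apply: differentiable_comp; [exact: FD|exact: fD].
apply: (@Ck_eq _ _ _ _ _ (fun x => \sum_j partial a F x 0 j * partial j f (F x))) => //.
  by move=> x Ux; rewrite partial_comp //; [exact: FD|exact: fD].
apply: Ck_sum => // j _; apply: CkM => //.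
  by have /(Ck_mxP _ _ oU) := Ck_partial a Fk; apply.
by apply: IH; [exact: Ck_partial fk|exact: CkW].
Qed.

Lemma Ck_comp_mx p q k (U : set 'rV[R]_m) (V : set 'rV[R]_n) F
    (A : 'rV[R]_n -> 'M[R]_(p, q)) :
  open U -> open V -> (forall x, U x -> V (F x)) ->
  Ck k V A -> Ck k U F -> Ck k U (A \o F).
Proof.
move=> oU oV UV /(Ck_mxP _ _ oV) Ak Fk; apply/(Ck_mxP _ _ oU) => i j.
exact: (Ck_comp oU oV UV (Ak i j)).
Qed.

End ChainRule.

Section Determinant.
Context {R : realType} {V : normedModType R}.

Lemma is_derive_prod n (f : 'I_n -> V -> R) x v (df : 'I_n -> R) :
  (forall i, is_derive x v (f i) (df i)) ->
  is_derive x v (fun y => \prod_i f i y)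
    (\sum_i \prod_j (if j == i then df j else f j x)).
Proof.
elim: n f df => [|n IH] f df fD.
  rewrite big_ord0; under [fun y => _]eq_fun do rewrite big_ord0.
  exact: is_derive_cst.
under [fun y => _]eq_fun do rewrite big_ord_recl.
have D := is_deriveM (fD ord0) (IH _ _ (fun i => fD (lift ord0 i))).
apply: (is_derive_eq D); rewrite big_ord_recl addrC; congr (_ + _).
  by rewrite big_ord_recl /= -[LHS]/(_ * _) mulrC.
rewrite -[LHS]/(_ * _) mulr_sumr; apply: eq_bigr => i _.
rewrite big_ord_recl /=; congr (_ * _); apply: eq_bigr.
Qed.

(** Jacobi's formula. Differentiating the Leibniz products replaces one row at a time by its
    derivative, which gives the matrices [B i]; expanding [\det (B i)] along row [i] produces the
    cofactors of [A x]. *)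
Lemma is_derive_det n (A : V -> 'M[R]_n) x v dA : is_derive x v A dA ->
  is_derive x v (fun y => \det (A y)) (\tr (dA *m \adj (A x))).
Proof.
move=> /is_derive_mxP AD.
pose B i := \matrix_(k, j) (if k == i then dA k j else A x k j).
have E : \tr (dA *m \adj (A x)) = \sum_i \det (B i).
  apply: eq_bigr => i _; rewrite mxE (expand_det_row _ i); apply: eq_bigr => j _.
  rewrite !mxE eqxx; congr (_ * _); rewrite /cofactor; congr (_ * \det _).
  by apply/matrixP => k l; rewrite !mxE eq_sym (negPf (neq_lift _ _)).
rewrite E exchange_big /=.
have Dp (s : 'S_n) : is_derive x v (fun y => (-1) ^+ s * \prod_i A y i (s i))
    ((-1) ^+ s * \sum_i \prod_j B i j (s j)).
  have D := is_derive_prod (fun i => AD i (s i)).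
  have D' := is_deriveZ ((-1) ^+ s : R) D.
  apply: (is_derive_eq D'); congr (_ * _); apply: eq_bigr => i _; apply: eq_bigr => j _.
  by rewrite mxE.
(* Permutations are enumerated by ordinals to match the index type of [is_derive_sumr]. *)
have -> : (fun y => \det (A y)) =
    (fun y => \sum_(i < #|{: 'S_n}|) (-1) ^+ (enum_val i : 'S_n) * \prod_j A y j ((enum_val i : 'S_n) j)).
  apply/funext => y; rewrite /determinant (reindex (@enum_val _ {: 'S_n})) //.
  exact: (onW_bij _ (enum_val_bij _)).
rewrite (reindex (@enum_val _ {: 'S_n})) /=; last exact: (onW_bij _ (enum_val_bij _)).
have D := is_derive_sumr (fun i : 'I_#|{: 'S_n}| => Dp (enum_val i)).
apply: (is_derive_eq D); apply: eq_bigr => s _.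
by rewrite mulr_sumr.
Qed.

(** Existence of the derivative is assumed here and comes from [Ck_invmx]; only its value is found,
    by differentiating [A y *m invmx (A y) = 1]. *)
Lemma is_derive_invmx n (A : V -> 'M[R]_n) x v dA iA :
  (\forall y \near x, A y \in unitmx) ->
  is_derive x v A dA -> is_derive x v (fun y => invmx (A y)) iA ->
  iA = - (invmx (A x) *m dA *m invmx (A x)).
Proof.
move=> Au AD iAD; have Ax : A x \in unitmx := nbhs_singleton Au.
have D := is_derive_mulmx AD iAD.
have D1 : is_derive x v (fun y => A y *m invmx (A y)) 0.
  apply: (@near_eq_is_derive _ _ _ (fun=> 1%:M)).
    by apply: filterS Au => y Ay; rewrite mulmxV.
have E : dA *m invmx (A x) + A x *m iA = 0.
  by rewrite -(@derive_val _ _ _ _ _ _ _ D) (@derive_val _ _ _ _ _ _ _ D1).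
move/eqP: E; rewrite addrC addr_eq0 => /eqP E.
by rewrite -[LHS](mulKmx Ax) E mulmxN mulmxA.
Qed.

End Determinant.

Section CkMatrix.
Context {R : realType} {n : nat}.
Implicit Types (U : set 'rV[R]_n).

Lemma Ck_mulmx m p q k U (A : 'rV[R]_n -> 'M[R]_(m, p)) (B : 'rV[R]_n -> 'M[R]_(p, q)) :
  open U -> Ck k U A -> Ck k U B -> Ck k U (fun x => A x *m B x).
Proof.
move=> oU /(Ck_mxP _ _ oU) Ak /(Ck_mxP _ _ oU) Bk; apply/(Ck_mxP _ _ oU) => i j.
apply: (@Ck_eq _ _ _ _ _ (fun x => \sum_l A x i l * B x l j)) => //.
  by move=> x _; rewrite mxE.
by apply: Ck_sum => // l _; exact: CkM.
Qed.

Lemma Ck_trmx m p k U (A : 'rV[R]_n -> 'M[R]_(m, p)) :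
  open U -> Ck k U A -> Ck k U (fun x => (A x)^T).
Proof.
move=> oU /(Ck_mxP _ _ oU) Ak; apply/(Ck_mxP _ _ oU) => i j.
by apply: Ck_eq (Ak j i) => // x _; rewrite mxE.
Qed.

Lemma Ck_bilin p k U (A : 'rV[R]_n -> 'M[R]_p) (v w : 'rV[R]_n -> 'rV[R]_p) :
  open U -> Ck k U A -> Ck k U v -> Ck k U w ->
  Ck k U (fun x => bilin (A x) (v x) (w x)).
Proof.
move=> oU Ak vk wk; rewrite /bilin.
have := Ck_mulmx oU (Ck_mulmx oU vk Ak) (Ck_trmx oU wk).
by move=> /(Ck_mxP _ _ oU); apply.
Qed.

Lemma Ck_det p k U (A : 'rV[R]_n -> 'M[R]_p) :
  open U -> Ck k U A -> Ck k U (fun x => \det (A x)).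
Proof.
move=> oU /(Ck_mxP _ _ oU) Ak; rewrite /determinant.
apply: Ck_sum => // s _; apply: CkM => //; first exact: Ck_cst.
by apply: Ck_prod => // i _.
Qed.

(** By Cramer's formula the entries are cofactors divided by the determinant, which does not vanish
    on [U]. *)
Lemma Ck_invmx p k U (A : 'rV[R]_n -> 'M[R]_p) :
  open U -> (forall x, U x -> A x \in unitmx) ->
  Ck k U A -> Ck k U (fun x => invmx (A x)).
Proof.
move=> oU Au Ak; apply/(Ck_mxP _ _ oU) => i j.
apply: (@Ck_eq _ _ _ _ _ (fun x => (\det (A x))^-1 * ((-1) ^+ (j + i) * \det (row' j (col' i (A x)))))) => //.
  by move=> x Ux; rewrite /invmx Au // !mxE.
apply: CkM => //.
  apply: CkV => //; last exact: Ck_det.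
  by move=> x /Au; rewrite unitmxE unitfE.
apply: CkM => //; first exact: Ck_cst.
apply: Ck_det => //; apply/(Ck_mxP _ _ oU) => a b.
move/(Ck_mxP _ _ oU): Ak => /(_ (lift j a) (lift i b)) Ak.
by apply: Ck_eq Ak => // x _; rewrite !mxE.
Qed.

End CkMatrix.

(** * Positive definite matrices *)

Section PositiveDefinite.
Context {R : realType}.

Definition posdef n (B : 'M[R]_n) := forall v : 'rV[R]_n, v != 0 -> 0 < bilin B v v.

Lemma posdef_unitmx n (B : 'M[R]_n) : posdef B -> B \in unitmx.
Proof.
move=> Bpos; rewrite -row_free_unit -kermx_eq0; apply/negPn/negP => K0.
have /rowV0Pn[v vK v0] := K0.
have := Bpos v v0; rewrite /bilin; move/sub_kermxP: vK => ->.
by rewrite mul0mx mxE ltxx.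
Qed.

Lemma posdef_ge0 n (B : 'M[R]_n) v : posdef B -> 0 <= bilin B v v.
Proof.
move=> Bpos; have [->|/Bpos/ltW//] := eqVneq v 0.
by rewrite bilin0l.
Qed.

Lemma posdef_eq0 n (B : 'M[R]_n) v : posdef B -> bilin B v v = 0 -> v = 0.
Proof.
move=> Bpos B0; apply/eqP/negPn/negP => /Bpos.
by rewrite B0 ltxx.
Qed.

Lemma posdef_pullback m n (J : 'M[R]_(m, n)) (B : 'M[R]_n) :
  row_free J -> posdef B -> posdef (J *m B *m J^T).
Proof.
move=> Jf Bpos v v0; rewrite bilin_mulmx; apply: Bpos.
by apply: contra_neq v0 => vJ; apply: (row_free_inj Jf); rewrite vJ mul0mx.
Qed.

Lemma posdef_inv n (B : 'M[R]_n) : B^T = B -> posdef B -> posdef (invmx B).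
Proof.
move=> BT Bpos v v0.
have Bu := posdef_unitmx Bpos.
have -> : invmx B = invmx B *m B *m (invmx B)^T.
  by rewrite mulVmx // mul1mx trmx_inv BT.
rewrite bilin_mulmx; apply: Bpos; apply: contra_neq v0 => vB.
by rewrite -(mulmxKV Bu v) vB mul0mx.
Qed.

(* The determinant does not vanish on the segment joining [B] to the identity. *)
Lemma posdef_det_gt0 n (B : 'M[R]_n) : posdef B -> 0 < \det B.
Proof.
move=> Bpos.
pose C (t : R) := (1 - t) *: 1%:M + t *: B : 'M[R]_n.
have Cpos t : 0 <= t <= 1 -> posdef (C t).
  move=> /andP[t0 t1] v v0; rewrite /C bilinDm !bilinZm.
  have v1 : 0 < bilin 1%:M v v.
    rewrite bilinE (eq_bigr (fun i => v 0 i ^+ 2)); last first.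
      move=> i _; rewrite (bigD1 i) //= !mxE eqxx mulr1 big1 ?addr0 -?expr2 //.
      by move=> j ji; rewrite mxE eq_sym (negPf ji) mulr0.
    rewrite lt_neqAle sumr_ge0 ?andbT => [|i _]; last exact: sqr_ge0.
    rewrite eq_sym psumr_eq0 => [|i _]; last exact: sqr_ge0.
    apply: contra v0 => /allP v0; apply/eqP/rowP => i; rewrite mxE.
    by apply/eqP; rewrite -sqrf_eq0; apply: v0; rewrite mem_index_enum.
  have [->|tn0] := eqVneq t 0; first by rewrite subr0 mul1r mul0r addr0.
  have tp : 0 < t by rewrite lt_neqAle eq_sym tn0.
  by rewrite ltr_wpDl ?mulr_gt0 ?Bpos // mulr_ge0 ?subr_ge0 // ltW.
have Cdet t : 0 <= t <= 1 -> \det (C t) != 0.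
  by move=> /Cpos/posdef_unitmx; rewrite unitmxE unitfE.
have detc : continuous (fun t => \det (C t)).
  move=> t; have AD : derivable C t 1.
    apply/derivable_mxP => i j.
    under [fun x => _]eq_fun do rewrite !mxE.
    by apply: ex_derive.
  have D := is_derive_det (derivableP AD).
  by apply: differentiable_continuous; apply/derivable1_diffP; case: D.
rewrite ltNge; apply/negP => detB.
have C0 : \det (C 0) = 1 by rewrite /C subr0 scale1r scale0r addr0 det1.
have C1 : \det (C 1) = \det B by rewrite /C subrr scale0r scale1r add0r.
have [||c c01 Dc] := @IVT _ (fun t => \det (C t)) 0 1 0 ler01.
- exact: continuous_subspaceT.
- by rewrite C0 C1 ge_min le_max ler01 detB orbT.
by have := @Cdet c; rewrite Dc eqxx; move: c01; rewrite in_itv /= => -> /(_ isT).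
Qed.

End PositiveDefinite.

(** * Metrics, Christoffel symbols and Hessians in coordinates *)

Section RiemannianOn.
Context {R : realType}.

Definition riemannian_on n (V : set 'rV[R]_n) (G : 'rV[R]_n -> 'M[R]_n) :=
  [/\ open V, smooth_on V G, forall x, V x -> (G x)^T = G x &
      forall x, V x -> posdef (G x)].

(** The derivative of the metric along [v], kept as a matrix so that the Koszul formula can be
    written with [bilin]. *)
Definition dmetric n (G : 'rV[R]_n -> 'M[R]_n) (x v : 'rV[R]_n) : 'M[R]_n :=
  \sum_k v 0 k *: partial k G x.

Lemma dmetric_basis n (G : 'rV[R]_n -> 'M[R]_n) x k :
  dmetric G x (basis_vec k) = partial k G x.
Proof.
rewrite /dmetric (bigD1 k) //= coord_basis_vec eqxx scale1r big1 ?addr0 //.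
by move=> i ik; rewrite coord_basis_vec (negPf ik) scale0r.
Qed.

Lemma bilin_dmetric n (G : 'rV[R]_n -> 'M[R]_n) x u v w :
  bilin (dmetric G x u) v w =
  \sum_k \sum_i \sum_j u 0 k * (v 0 i * w 0 j * partial k G x i j).
Proof.
rewrite bilinE /dmetric.
under eq_bigr do under eq_bigr do rewrite summxE mulr_sumr.
under eq_bigr do rewrite exchange_big /=.
rewrite exchange_big /=; apply: eq_bigr => k _.
by apply: eq_bigr => i _; apply: eq_bigr => j _; rewrite mxE mulrCA.
Qed.

Section Koszul.
Context {n : nat} (V : set 'rV[R]_n) (G : 'rV[R]_n -> 'M[R]_n).
Hypothesis HG : riemannian_on V G.

Let oV : open V. Proof. by have [] := HG. Qed.

Lemma riemannian_derivable x v : V x -> derivable G x v.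
Proof.
move=> Vx; have [_ Gk _ _] := HG.
apply/derivable_mxP => i j; apply: diff_derivable.
apply: Ck1_differentiable oV Vx _.
by have /(Ck_mxP _ _ oV) := Gk 1%N; apply.
Qed.

Lemma riemannian_partial x k : V x ->
  is_derive x (basis_vec k) G (partial k G x).
Proof. by move=> Vx; apply: derivableP; exact: riemannian_derivable. Qed.

Lemma riemannian_unit x : V x -> G x \in unitmx.
Proof. by move=> Vx; have [_ _ _ Gp] := HG; apply/posdef_unitmx/Gp. Qed.

Lemma partial_metric_entry x k i j : V x ->
  partial k (fun y => G y i j) x = partial k G x i j.
Proof. by move=> Vx; rewrite partial_mx //; exact: riemannian_derivable. Qed.

(** Vectors are taken as fields with constant coefficients: their brackets vanish and only the three
    derivatives of the metric remain. Pairing with [G x] cancels the inverse metric in the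
    Christoffel symbols. *)
Lemma koszul x u v w : V x ->
  bilin (G x) (christoffel_op G x u v) w =
  2^-1 * (bilin (dmetric G x u) v w + bilin (dmetric G x v) u w
          - bilin (dmetric G x w) u v).
Proof.
move=> Vx; have [_ _ Gs _] := HG.
pose D k i j := partial k G x i j.
pose c : 'rV[R]_n := \row_l (2^-1 * \sum_i \sum_j (D i j l + D j i l - D l i j) * (u 0 i * v 0 j)).
have -> : christoffel_op G x u v = c *m (invmx (G x))^T.
  apply/rowP => k; rewrite !mxE.
  transitivity (\sum_i \sum_j \sum_l
      2^-1 * ((D i j l + D j i l - D l i j) * (u 0 i * v 0 j)) * invmx (G x) k l).
    apply: eq_bigr => i _; apply: eq_bigr => j _.
    rewrite /christoffel mulr_sumr !mulr_suml; apply: eq_bigr => l _.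
    by rewrite !partial_metric_entry // /D; ring.
  under eq_bigr do rewrite exchange_big /=.
  rewrite exchange_big /=; apply: eq_bigr => l _.
  rewrite !mxE mulr_sumr mulr_suml; apply: eq_bigr => i _.
  by rewrite mulr_sumr mulr_suml.
rewrite trmx_inv Gs // {1}/bilin mulmxKV; last exact: riemannian_unit.
rewrite mxE; under eq_bigr do rewrite !mxE -mulrA mulr_suml.
rewrite -mulr_sumr !bilin_dmetric; congr (_ * _).
have E1 : \sum_k \sum_i \sum_j u 0 k * (v 0 i * w 0 j * partial k G x i j) =
    \sum_l \sum_i \sum_j u 0 i * (v 0 j * w 0 l * D i j l).
  rewrite [RHS]exchange_big; apply: eq_bigr => i _.
  by rewrite [RHS]exchange_big.
have E2 : \sum_k \sum_i \sum_j v 0 k * (u 0 i * w 0 j * partial k G x i j) =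
    \sum_l \sum_i \sum_j v 0 j * (u 0 i * w 0 l * D j i l).
  under [RHS]eq_bigr do rewrite exchange_big.
  rewrite [RHS]exchange_big; apply: eq_bigr => i _.
  by rewrite [RHS]exchange_big.
rewrite E1 E2 -big_split -sumrB /=; apply: eq_bigr => l _.
rewrite -big_split -sumrB /=; apply: eq_bigr => i _.
rewrite mulr_suml -big_split -sumrB /=; apply: eq_bigr => j _.
by rewrite /D; ring.
Qed.

Lemma christoffel_opE x i j k :
  christoffel_op G x (basis_vec i) (basis_vec j) 0 k = christoffel G k i j x.
Proof.
rewrite mxE (bigD1 i) //= [X in _ + X]big1 => [|l li]; last first.
  by rewrite big1 // => p _; rewrite coord_basis_vec (negPf li) mulr0 mul0r.
rewrite addr0 (bigD1 j) //= big1 => [|l lj]; last first.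
  by rewrite !coord_basis_vec (negPf lj) mulr0.
by rewrite !coord_basis_vec !eqxx !mulr1 addr0.
Qed.

End Koszul.

Lemma christoffel_op_sum n (G : 'rV[R]_n -> 'M[R]_n) x u v :
  christoffel_op G x u v = \sum_i \sum_j (u 0 i * v 0 j) *:
    christoffel_op G x (basis_vec i) (basis_vec j).
Proof.
apply/rowP => k; rewrite mxE summxE; apply: eq_bigr => i _.
rewrite summxE; apply: eq_bigr => j _.
by rewrite [RHS]mxE christoffel_opE -mulrA mulrC.
Qed.

End RiemannianOn.

Section SecondOrderChain.
Context {R : realType} {m n : nat}.
Variables (U : set 'rV[R]_m) (V : set 'rV[R]_n) (F : 'rV[R]_m -> 'rV[R]_n).
Hypotheses (oU : open U) (oV : open V) (UV : forall x, U x -> V (F x)).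
Hypothesis (F2 : Ck 2 U F).

Definition grad_row (f : 'rV[R]_n -> R) y : 'rV[R]_n := \row_k partial k f y.

Definition coord_hessian (f : 'rV[R]_n -> R) y : 'M[R]_n :=
  \matrix_(i, j) partial i (partial j f) y.

(** The last sum, with the second derivatives of [F], is the non-tensorial part; Christoffel terms
    will complete it to a covariant derivative along [F]. *)
Lemma partial2_comp (f : 'rV[R]_n -> R) a b x : Ck 2 V f -> U x ->
  partial a (partial b (f \o F)) x =
  bilin (coord_hessian f (F x)) (partial a F x) (partial b F x)
  + \sum_k partial a (partial b F) x 0 k * partial k f (F x).
Proof.
move=> f2 Ux.
have F1 := CkW F2; have f1 := CkW f2.
have FD y : U y -> differentiable F y by move=> Uy; exact: Ck1_differentiable_rV F1.
have fD y : U y -> differentiable f (F y).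
  by move=> Uy; apply: Ck1_differentiable f1; [exact: oV|exact: UV].
have E : partial a (partial b (f \o F)) x =
    partial a (fun y => \sum_j partial b F y 0 j * partial j f (F y)) x.
  apply: (@partial_open _ _ _ U) => // y Uy.
  by rewrite partial_comp //; [exact: FD|exact: fD].
rewrite E.
have D j : is_derive x (basis_vec a) (fun y => partial b F y 0 j * partial j f (F y))
   (partial b F x 0 j * (\sum_i partial a F x 0 i * partial i (partial j f) (F x)) +
    partial j f (F x) * partial a (partial b F) x 0 j).
  have bF : Ck 1 U (partial b F) := Ck_partial b F2.
  have jf : Ck 1 V (partial j f) := Ck_partial j f2.
  have jfD : differentiable (partial j f) (F x).
    by apply: Ck1_differentiable jf; [exact: oV|exact: UV].
  apply: is_deriveM.
    have bFj : derivable (fun y => partial b F y 0 j) x (basis_vec a).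
      by have /(Ck_mxP _ _ oU) /(_ 0 j) H := bF; exact: Ck_derivable H Ux.
    have /derivableP := bFj.
    suff -> : 'D_(basis_vec a) (fun y => partial b F y 0 j) x = partial a (partial b F) x 0 j by [].
    by apply: partial_mx; exact: Ck_derivable bF Ux.
  have jfFD : derivable (partial j f \o F) x (basis_vec a).
    by apply: diff_derivable; apply: differentiable_comp; [exact: FD|].
  apply: (is_derive_eq (derivableP jfFD)).
  exact: (partial_comp a (FD x Ux) jfD).
have [_ D'] := is_derive_sumr D.
apply: etrans D' _.
rewrite big_split /= bilinE; congr (_ + _); last by apply: eq_bigr => j _; rewrite mulrC.
rewrite exchange_big; apply: eq_bigr => j _; rewrite mulr_sumr; apply: eq_bigr => i _.
by rewrite mxE mulrCA mulrA.
Qed.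

Lemma grad_comp (f : 'rV[R]_n -> R) x : differentiable F x ->
  differentiable f (F x) ->
  \row_a partial a (f \o F) x = grad_row f (F x) *m (jacobian F x)^T.
Proof.
move=> FD fD; apply/rowP => a; rewrite mxE partial_comp // [RHS]mxE.
by apply: eq_bigr => j _; rewrite ![in RHS]mxE -jacobianE // mulrC mxE.
Qed.

End SecondOrderChain.

(** Here [s1], [s2], [s3] stand for the products of [partial a (partial b F)],
    [partial a (partial c F)] and [partial b (partial c F)] with the remaining first derivative; the
    last two cancel in the Koszul combination. *)
Lemma pullback_koszul_algebra (K : realFieldType) (p1 p2 p3 d1 d2 d3 s1 s2 s3 : K) :
  p1 = d1 + s1 + s2 -> p2 = d2 + s1 + s3 -> p3 = d3 + s2 + s3 ->
  2^-1 * (p1 + p2 - p3) = s1 + 2^-1 * (d1 + d2 - d3).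
Proof. by move=> -> -> ->; field. Qed.

(** * The metric induced by an immersion and its connection *)

Section Pullback.
Context {R : realType} {m n : nat}.
Variables (U : set 'rV[R]_m) (V : set 'rV[R]_n).
Variables (F : 'rV[R]_m -> 'rV[R]_n) (G : 'rV[R]_n -> 'M[R]_n).
Hypotheses (HG : riemannian_on V G) (oU : open U).
Hypothesis UV : forall x, U x -> V (F x).
Hypothesis Fs : smooth_on U F.

Lemma smooth_differentiable x : U x -> differentiable F x.
Proof. by move=> Ux; exact: (Ck1_differentiable_rV oU Ux (Fs 1)). Qed.

Lemma smooth_partial_entry x a j : U x ->
  jacobian F x a j = partial a F x 0 j.
Proof. by move=> Ux; apply/jacobianE/smooth_differentiable. Qed.

Lemma smooth_partial_row x a : U x ->
  basis_vec a *m jacobian F x = partial a F x.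
Proof. by move=> Ux; rewrite partial_jacobian //; exact: smooth_differentiable. Qed.

Lemma smooth_jacobian : smooth_on U (jacobian F).
Proof.
move=> k; apply/(Ck_mxP _ _ oU) => a j.
apply: (@Ck_eq _ _ _ _ _ (fun x => partial a F x 0 j)) => //.
  by move=> x Ux; rewrite smooth_partial_entry.
by have /(Ck_mxP _ _ oU) := Ck_partial a (Fs k.+1); apply.
Qed.

Lemma smooth_metric_comp : smooth_on U (G \o F).
Proof. by move=> k; have [oV Gs _ _] := HG; exact: Ck_comp_mx (Gs k) (Fs k). Qed.

Lemma is_derive_metric_comp a x : U x ->
  is_derive x (basis_vec a) (fun y => G (F y)) (dmetric G (F x) (partial a F x)).
Proof.
move=> Ux; have [oV Gs _ _] := HG; apply/is_derive_mxP => i j.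
have Gij : Ck 1 V (fun y => G y i j) by have /(Ck_mxP _ _ oV) := Gs 1%N; apply.
have GD : differentiable (fun y => G y i j) (F x).
  by apply: Ck1_differentiable Gij; [exact: oV|exact: UV].
have D : derivable ((fun y => G y i j) \o F) x (basis_vec a).
  by apply: diff_derivable; apply: differentiable_comp => //; exact: smooth_differentiable.
apply: (is_derive_eq (derivableP D)).
apply: etrans (partial_comp a (smooth_differentiable Ux) GD) _.
rewrite /dmetric summxE; apply: eq_bigr => k _.
by rewrite (partial_metric_entry HG) ?mxE //; exact: UV.
Qed.

Lemma smooth_first_form : smooth_on U (first_form G F).
Proof.
move=> k; apply: Ck_mulmx => //; last exact: Ck_trmx (smooth_jacobian k).
apply: Ck_mulmx => //; [exact: smooth_jacobian|exact: smooth_metric_comp].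
Qed.

Lemma first_form_bilin x v w : bilin (first_form G F x) v w =
  bilin (G (F x)) (v *m jacobian F x) (w *m jacobian F x).
Proof. exact: bilin_mulmx. Qed.

Lemma first_form_entry x b c : U x -> first_form G F x b c =
  bilin (G (F x)) (partial b F x) (partial c F x).
Proof. by move=> Ux; rewrite -bilin_basis first_form_bilin !smooth_partial_row. Qed.

Lemma first_form_riemannian :
  (forall x, U x -> row_free (jacobian F x)) -> riemannian_on U (first_form G F).
Proof.
move=> Jf; have [_ _ Gs Gp] := HG; split=> // [|x Ux|x Ux].
- exact: smooth_first_form.
- by rewrite /first_form !trmx_mul trmxK Gs ?mulmxA //; exact: UV.
- by apply: posdef_pullback; [exact: Jf|apply: Gp; exact: UV].
Qed.

Lemma partial2_sym a b x : U x -> partial a (partial b F) x = partial b (partial a F) x.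
Proof.
have entry c d y j : U y -> partial c (partial d F) y 0 j =
    partial c (partial d (fun z => F z 0 j)) y.
  move=> Uy; rewrite -partial_mx; last exact: (Ck_derivable (Ck_partial d (Fs 2))).
  apply: (@partial_open _ _ _ U) => // z Uz.
  by rewrite partial_mx //; exact: (Ck_derivable (Fs 1)).
move=> Ux; apply/rowP => j.
apply: etrans (entry _ _ _ _ Ux) (etrans _ (esym (entry _ _ _ _ Ux))).
apply: schwarz oU Ux _.
by have /(Ck_mxP _ _ oU) := Fs 2; apply.
Qed.

Lemma is_derive_partial a b x : U x ->
  is_derive x (basis_vec a) (partial b F) (partial a (partial b F) x).
Proof. by move=> Ux; apply: derivableP; exact: (Ck_derivable (Ck_partial b (Fs 2))). Qed.

Lemma partial_first_form a b c x : U x ->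
  partial a (fun y => first_form G F y b c) x =
  bilin (dmetric G (F x) (partial a F x)) (partial b F x) (partial c F x)
  + bilin (G (F x)) (partial a (partial b F) x) (partial c F x)
  + bilin (G (F x)) (partial b F x) (partial a (partial c F) x).
Proof.
move=> Ux.
have D := is_derive_bilin (is_derive_metric_comp a Ux) (is_derive_partial a b Ux)
  (is_derive_partial a c Ux).
have [_ <-] := D.
by apply: (@partial_open _ _ _ U) => // y Uy; exact: first_form_entry.
Qed.

Hypothesis Jf : forall x, U x -> row_free (jacobian F x).

(* The Koszul formula for the pulled-back metric: by symmetry of second
   derivatives only the term in [partial a (partial b F)] survives. *)
Lemma pullback_christoffel a b c x : U x ->
  bilin (first_form G F x)
    (christoffel_op (first_form G F) x (basis_vec a) (basis_vec b)) (basis_vec c) =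
  bilin (G (F x)) (cov_along G F a (partial b F) x) (partial c F x).
Proof.
move=> Ux; have Hh := first_form_riemannian Jf.
have [_ _ Gs _] := HG; have GsF := Gs _ (UV Ux).
have P i j k : bilin (dmetric (first_form G F) x (basis_vec i)) (basis_vec j) (basis_vec k) =
    bilin (dmetric G (F x) (partial i F x)) (partial j F x) (partial k F x)
    + bilin (G (F x)) (partial i (partial j F) x) (partial k F x)
    + bilin (G (F x)) (partial j F x) (partial i (partial k F) x).
  rewrite dmetric_basis bilin_basis.
  by apply: etrans (esym (partial_metric_entry Hh i j k Ux)) _; exact: partial_first_form.
apply: etrans (koszul Hh (basis_vec a) (basis_vec b) (basis_vec c) Ux) _.
rewrite /cov_along bilinDl.
apply: etrans _ (congr1 (fun z => _ + z) (esym (koszul HG (partial a F x)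
  (partial b F x) (partial c F x) (UV Ux)))).
apply: pullback_koszul_algebra (P a b c) _ _.
  exact: etrans (P b a c) (congr1 (fun z => _ + bilin _ z _ + _) (partial2_sym b a Ux)).
apply: etrans (P c a b) _.
apply: etrans (congr1 (fun z => _ + bilin _ z _ + _) (partial2_sym c a Ux)) _.
apply: etrans (congr1 (fun z => _ + _ + bilin _ _ z) (partial2_sym c b Ux)) _.
exact: (congr1 (fun z => _ + z + _) (bilin_sym _ _ GsF)).
Qed.

End Pullback.

Section ChristoffelBilinear.
Context {R : realType} {n : nat}.
Implicit Types (G : 'rV[R]_n -> 'M[R]_n).

Lemma christoffel_op_bilin G x u v k : christoffel_op G x u v 0 k =
  bilin (\matrix_(i, j) christoffel G k i j x) u v.
Proof.
rewrite bilinE mxE; apply: eq_bigr => i _; apply: eq_bigr => j _.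
by rewrite [X in _ = _ * X]mxE [RHS]mulrC mulrA.
Qed.

Lemma christoffel_op_mulmx G x p (u v : 'rV[R]_p) (J : 'M[R]_(p, n)) :
  christoffel_op G x (u *m J) (v *m J) = \sum_i \sum_j (u 0 i * v 0 j) *:
    christoffel_op G x (basis_vec i *m J) (basis_vec j *m J).
Proof.
apply/rowP => k; rewrite christoffel_op_bilin -bilin_mulmx bilinE summxE.
apply: eq_bigr => i _; rewrite summxE; apply: eq_bigr => j _.
by rewrite [RHS]mxE christoffel_op_bilin -bilin_mulmx bilin_basis.
Qed.

Lemma christoffel_op_open G G' (V : set 'rV[R]_n) x u v : open V ->
  (forall y, V y -> G y = G' y) -> V x ->
  christoffel_op G x u v = christoffel_op G' x u v.
Proof.
move=> oV GG Vx.
have E p q r : partial p (fun y => G y q r) x = partial p (fun y => G' y q r) x.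
  by apply: (partial_open p oV) => // y Vy; rewrite GG.
have E' k i j : christoffel G k i j x = christoffel G' k i j x.
  rewrite /christoffel (GG x Vx); apply: (congr1 (fun z => _ * z)).
  apply: eq_bigr => l _; apply: (congr1 (fun z => _ * z)).
  by apply: (f_equal2 (fun s t => s - t)) => //; apply: (f_equal2 (fun s t => s + t)).
apply/rowP => k; rewrite !mxE.
by under eq_bigr do under eq_bigr do rewrite E'.
Qed.

(** Expressed through partial derivatives, so that it is linear in [v] without any regularity of
    [f]. *)
Definition ddir (f : 'rV[R]_n -> R) y (v : 'rV[R]_n) : R :=
  \sum_k v 0 k * partial k f y.

Lemma ddirD f y u v : ddir f y (u + v) = ddir f y u + ddir f y v.
Proof. by rewrite /ddir -big_split; apply: eq_bigr => k _; rewrite mxE mulrDl. Qed.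

Lemma ddirZ f y a v : ddir f y (a *: v) = a * ddir f y v.
Proof. by rewrite /ddir mulr_sumr; apply: eq_bigr => k _; rewrite mxE mulrA. Qed.

Lemma ddirB f y u v : ddir f y (u - v) = ddir f y u - ddir f y v.
Proof. by rewrite -scaleN1r ddirD ddirZ mulN1r. Qed.

Lemma ddir_mulmx f y u : ddir f y u = (u *m (grad_row f y)^T) 0 0.
Proof. by rewrite mxE; apply: eq_bigr => k _; rewrite !mxE. Qed.

Lemma bilin_hessian G f y u v : bilin (hessian G f y) u v =
  bilin (coord_hessian f y) u v - ddir f y (christoffel_op G y u v).
Proof.
have -> : ddir f y (christoffel_op G y u v) =
    \sum_i \sum_j u 0 i * v 0 j * (\sum_k christoffel G k i j y * partial k f y).
  rewrite /ddir; under eq_bigr do rewrite mxE mulr_suml.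
  rewrite exchange_big; apply: eq_bigr => i _.
  under eq_bigr do rewrite mulr_suml.
  rewrite exchange_big; apply: eq_bigr => j _.
  rewrite mulr_sumr; apply: eq_bigr => k _.
  by rewrite mulrA -[_ * u 0 i * _]mulrA [christoffel _ _ _ _ _ * _]mulrC.
rewrite !bilinE -sumrB; apply: eq_bigr => i _; rewrite -sumrB; apply: eq_bigr => j _.
by rewrite !mxE mulrBr.
Qed.

End ChristoffelBilinear.

Section Composition.
Context {R : realType} {m n p : nat}.
Variables (U : set 'rV[R]_m) (V : set 'rV[R]_n).
Variables (F : 'rV[R]_m -> 'rV[R]_n) (tau : 'rV[R]_n -> 'rV[R]_p).
Hypotheses (oU : open U) (oV : open V) (UV : forall x, U x -> V (F x)).
Hypotheses (Fs : smooth_on U F) (taus : smooth_on V tau).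

Lemma partial2_comp_rV a b x : U x ->
  partial a (partial b (tau \o F)) x =
  \sum_i \sum_j (partial a F x 0 i * partial b F x 0 j) *:
    partial i (partial j tau) (F x)
  + partial a (partial b F) x *m jacobian tau (F x).
Proof.
move=> Ux.
have FsD y : U y -> derivable (tau \o F) y (basis_vec b).
  move=> Uy; have C : Ck 1 U (tau \o F) := Ck_comp_mx oU oV UV (taus 1) (Fs 1).
  exact: (Ck_derivable C).
apply/rowP => l.
pose taul := fun y => tau y 0 l.
have taul2 : Ck 2 V taul by have /(Ck_mxP _ _ oV) := taus 2; apply.
have C2 : Ck 2 U (tau \o F) := Ck_comp_mx oU oV UV (taus 2) (Fs 2).
have E : partial a (partial b (tau \o F)) x 0 l = partial a (partial b (taul \o F)) x.
  rewrite -partial_mx; last exact: (Ck_derivable (Ck_partial b C2)).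
  apply: (partial_open a oU) => // y Uy.
  by apply/esym/partial_mx; exact: (Ck_derivable C2).
apply: etrans E _.
apply: etrans (partial2_comp oU oV UV (Fs 2) a b taul2 Ux) _.
rewrite [RHS]mxE summxE bilinE; congr (_ + _).
  apply: eq_bigr => i _; rewrite summxE; apply: eq_bigr => j _.
  rewrite [RHS]mxE [X in _ * X = _]mxE; congr (_ * _).
  rewrite -partial_mx; last exact: (Ck_derivable (Ck_partial j (taus 2)) (UV Ux)).
  apply: (partial_open i oV) => // [y Vy|]; last exact: UV.
  by apply: partial_mx; exact: (Ck_derivable (taus 1) Vy).
rewrite [RHS]mxE; apply: eq_bigr => k _; congr (_ * _).
rewrite (smooth_partial_entry oV taus); last exact: UV.
by apply: partial_mx; exact: (Ck_derivable (taus 1) (UV Ux)).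
Qed.

(** The composition law of second derivatives, with the connection of the last space only. The
    connection term is quadratic in first derivatives, hence expands over the partial derivatives of
    [F] like the second derivative of [tau]. *)
Lemma cov_along_comp (G : 'rV[R]_p -> 'M[R]_p) a b x : U x ->
  cov_along G (tau \o F) a (partial b (tau \o F)) x =
  \sum_i \sum_j (partial a F x 0 i * partial b F x 0 j) *:
    cov_along G tau i (partial j tau) (F x)
  + partial a (partial b F) x *m jacobian tau (F x).
Proof.
move=> Ux; rewrite /cov_along.
have FD := smooth_differentiable oU Fs Ux.
have tauD := smooth_differentiable oV taus (UV Ux).
rewrite [in christoffel_op _ _ _ _](partial_comp_rV a FD tauD).
rewrite [in christoffel_op _ _ _ _](partial_comp_rV b FD tauD).
apply: etrans (congr1 (fun z => z + _) (partial2_comp_rV a b Ux)) _.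
rewrite christoffel_op_mulmx addrAC; congr (_ + _).
rewrite -big_split; apply: eq_bigr => i _; rewrite -big_split; apply: eq_bigr => j _ /=.
rewrite scalerDr; congr (_ + _ *: christoffel_op _ _ _ _).
  by apply: (smooth_partial_row oV taus); exact: UV.
by apply: (smooth_partial_row oV taus); exact: UV.
Qed.

End Composition.

Section HessianPullback.
Context {R : realType} {m n : nat}.
Variables (U : set 'rV[R]_m) (V : set 'rV[R]_n) (F : 'rV[R]_m -> 'rV[R]_n).
Hypotheses (oU : open U) (oV : open V) (UV : forall x, U x -> V (F x)).
Hypothesis Fs : smooth_on U F.

Lemma ddir_comp (f : 'rV[R]_n -> R) x v : U x -> Ck 1 V f ->
  ddir (f \o F) x v = ddir f (F x) (v *m jacobian F x).
Proof.
move=> Ux f1.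
have FD := smooth_differentiable oU Fs Ux.
have fD : differentiable f (F x).
  by apply: Ck1_differentiable f1; [exact: oV|exact: UV].
rewrite !ddir_mulmx -[grad_row (f \o F) x]/(\row_a partial a (f \o F) x).
by rewrite grad_comp // trmx_mul trmxK mulmxA.
Qed.

(** [h] and [G] are arbitrary here. The argument of [ddir] is the second derivative of [F] corrected
    by both connections: it vanishes for a transition map and is the second fundamental form times
    the normal for an isometric immersion. *)
Lemma hessian_pullback (h : 'rV[R]_m -> 'M[R]_m) (G : 'rV[R]_n -> 'M[R]_n)
    (f : 'rV[R]_n -> R) a b x : U x -> Ck 2 V f ->
  hessian h (f \o F) x a b =
  bilin (hessian G f (F x)) (partial a F x) (partial b F x)
  + ddir f (F x) (cov_along G F a (partial b F) x
                  - christoffel_op h x (basis_vec a) (basis_vec b) *m jacobian F x).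
Proof.
move=> Ux f2; rewrite -bilin_basis !bilin_hessian bilin_basis mxE.
apply: etrans (congr1 (fun z => z - _) (partial2_comp oU oV UV (Fs 2) a b f2 Ux)) _.
rewrite (ddir_comp _ Ux (CkW f2)) ddirB /cov_along ddirD -!addrA; congr (_ + _).
by rewrite [RHS]addrCA addKr.
Qed.

End HessianPullback.

(** * Invariance under changes of coordinates in the ambient manifold *)

Section Transition.
Context {R : realType} {n : nat}.
Variables (V V' : set 'rV[R]_n) (tau : 'rV[R]_n -> 'rV[R]_n).
Variables (G G' : 'rV[R]_n -> 'M[R]_n).
Hypotheses (HG' : riemannian_on V' G') (oV : open V).
Hypotheses (VV' : forall y, V y -> V' (tau y)) (taus : smooth_on V tau).
Hypothesis Jf : forall y, V y -> row_free (jacobian tau y).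
Hypothesis GE : forall y, V y -> G y = first_form G' tau y.

(** A transition map is a local isometry, so it carries one connection to the other.
    [pullback_christoffel] gives equality after pairing with each row of the jacobian, and these
    rows form a basis. *)
Lemma transition_cov i j y : V y ->
  cov_along G' tau i (partial j tau) y =
  christoffel_op G y (basis_vec i) (basis_vec j) *m jacobian tau y.
Proof.
move=> Vy; apply/eqP; rewrite -subr_eq0; apply/eqP.
set r := _ - _.
have Ju : jacobian tau y \in unitmx by rewrite -row_free_unit; exact: Jf.
have Gu : G' (tau y) \in unitmx by apply: riemannian_unit HG' _ (VV' Vy).
have Bu : G' (tau y) *m (jacobian tau y)^T \in unitmx.
  by rewrite unitmx_mul Gu unitmx_tr.
apply: (bilin_eq0 Bu) => c.
have -> : bilin (G' (tau y) *m (jacobian tau y)^T) r (basis_vec c) =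
    bilin (G' (tau y)) r (basis_vec c *m jacobian tau y).
  by rewrite /bilin trmx_mul !mulmxA.
rewrite /r bilinBl -first_form_bilin.
rewrite (christoffel_op_open _ _ oV GE Vy).
rewrite (pullback_christoffel HG' oV VV' taus Jf i j c Vy).
by rewrite (smooth_partial_row oV taus c Vy) subrr.
Qed.

Context {m : nat} (U : set 'rV[R]_m) (F : 'rV[R]_m -> 'rV[R]_n).
Hypotheses (oU : open U) (UV : forall x, U x -> V (F x)) (Fs : smooth_on U F).

Lemma cov_along_transition a b x : U x ->
  cov_along G' (tau \o F) a (partial b (tau \o F)) x =
  cov_along G F a (partial b F) x *m jacobian tau (F x).
Proof.
move=> Ux; rewrite (cov_along_comp oU oV UV Fs taus) //.
rewrite /cov_along mulmxDl addrC christoffel_op_sum; congr (_ + _).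
rewrite mulmx_suml; apply: eq_bigr => i _; rewrite mulmx_suml; apply: eq_bigr => j _.
by rewrite -scalemxAl -transition_cov //; exact: UV.
Qed.

Lemma first_form_transition x : U x ->
  first_form G' (tau \o F) x = first_form G F x.
Proof.
move=> Ux.
have FD := smooth_differentiable oU Fs Ux.
have tauD := smooth_differentiable oV taus (UV Ux).
by rewrite /first_form (GE (UV Ux)) /first_form (jacobian_comp FD tauD) trmx_mul !mulmxA.
Qed.

Lemma second_form_transition N x : U x ->
  second_form G' (tau \o F) (N *m jacobian tau (F x)) x = second_form G F N x.
Proof.
move=> Ux; apply/matrixP => a b; rewrite [LHS]mxE [RHS]mxE.
rewrite cov_along_transition // -first_form_bilin -GE //; exact: UV.
Qed.

(** The correction term of [hessian_pullback] vanishes by [transition_cov]: the Hessian is a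
    tensor. *)
Lemma hessian_transition (f : 'rV[R]_n -> R) y : V y -> Ck 2 V' f ->
  hessian G (f \o tau) y =
  jacobian tau y *m hessian G' f (tau y) *m (jacobian tau y)^T.
Proof.
move=> Vy f2; have [oV' _ _ _] := HG'.
apply/matrixP => i j.
rewrite (hessian_pullback oV oV' VV' taus G G' i j Vy f2) transition_cov // subrr.
rewrite -[RHS]bilin_basis bilin_mulmx !(smooth_partial_row oV taus) //.
by rewrite /ddir big1 ?addr0 // => k _; rewrite mxE mul0r.
Qed.

End Transition.

(** * Traces and congruence *)

Section Congruence.
Context {R : realType}.

(** Induction on the size through the Schur complement [S] of the first entry. [S] is positive
    definite since its value at [w] is the minimum over [s] of the form [B'] at [(s, w)], reached at
    the [s] used below. *)
Lemma posdef_cholesky n (B : 'M[R]_n) : B^T = B -> posdef B ->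
  exists2 C : 'M[R]_n, C \in unitmx & B = C *m C^T.
Proof.
move=> BT Bpos; suff [C BC] : exists C : 'M[R]_n, B = C *m C^T.
  exists C => //; have := posdef_unitmx Bpos.
  by rewrite BC unitmx_mul => /andP[].
elim: n B BT Bpos => [|n IH] B BT Bpos; first by exists 0; apply/matrixP => -[].
pose B' : 'M[R]_(1 + n) := B.
have B'T : B'^T = B' := BT.
set a := ulsubmx B'; set u := ursubmx B'; set D := drsubmx B'.
have dlE : dlsubmx B' = u^T by rewrite /u trmx_ursub B'T.
have DT : D^T = D by rewrite /D trmx_drsub B'T.
have aE : a = (a 0 0)%:M by exact: mx11_scalar.
have B'E : B' = block_mx a u u^T D by rewrite -dlE submxK.
have bilE (s : 'M[R]_1) (w : 'rV[R]_n) : bilin B' (row_mx s w) (row_mx s w) =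
    a 0 0 * s 0 0 ^+ 2 + 2 * s 0 0 * (w *m u^T) 0 0 + bilin D w w.
  rewrite /bilin B'E tr_row_mx mul_row_block mul_row_col !mulmxDl.
  rewrite [s](mx11_scalar) aE tr_scalar_mx -!mulmxA !mul_scalar_mx !mul_mx_scalar.
  have -> : u *m w^T = (w *m u^T)^T by rewrite trmx_mul trmxK.
  rewrite -?scalemxAr; set t := w *m u^T; set d := w *m (D *m w^T).
  by rewrite !mxE /= !mulr1n expr2; ring.
have a0 : 0 < a 0 0.
  have := Bpos (row_mx 1%:M 0 : 'rV[R]_(1 + n)).
  rewrite -/B' bilE bilin0l mul0mx !mxE eqxx mulr0 !addr0 expr1n mulr1; apply.
  apply/eqP => /(congr1 (fun v : 'rV[R]_(1 + n) => lsubmx v 0 0)).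
  by rewrite row_mxKl !mxE => /eqP; rewrite oner_eq0.
pose S := D - (a 0 0)^-1 *: (u^T *m u).
have [||C SC] := IH S.
- by rewrite /S linearB /= DT linearZ /= trmx_mul trmxK.
- move=> w w0.
  have -> : bilin S w w = bilin B' (row_mx ((- (a 0 0)^-1) *: (w *m u^T)) w)
                                   (row_mx ((- (a 0 0)^-1) *: (w *m u^T)) w).
    rewrite bilE /S bilinBm bilinZm.
    have -> : bilin (u^T *m u) w w = (w *m u^T) 0 0 ^+ 2.
      have -> : u^T *m u = u^T *m 1%:M *m (u^T)^T by rewrite mulmx1 trmxK.
      by rewrite bilin_mulmx /bilin mulmx1 mxE big_ord1 [(_^T) _ _]mxE expr2.
    have -> : ((- (a 0 0)^-1) *: (w *m u^T)) 0 0 = - (a 0 0)^-1 * (w *m u^T) 0 0 by rewrite mxE.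
    set t := (w *m u^T) 0 0.
    by field; rewrite gt_eqF.
  apply: Bpos; apply: contra_neq w0 => /(congr1 (fun v : 'rV[R]_(1 + n) => rsubmx v)).
  by rewrite row_mxKr linear0.
have sa : Num.sqrt (a 0 0) * Num.sqrt (a 0 0) = a 0 0 by rewrite -expr2 sqr_sqrtr // ltW.
have sa0 : Num.sqrt (a 0 0) != 0 by rewrite gt_eqF // sqrtr_gt0.
pose C0 : 'M[R]_(1 + n) :=
  block_mx (Num.sqrt (a 0 0))%:M 0 ((Num.sqrt (a 0 0))^-1 *: u^T) C.
suff B'C0 : B' = C0 *m C0^T by exists C0.
rewrite B'E /C0 tr_block_mx mulmx_block trmx0 !mul0mx !mulmx0 !addr0 tr_scalar_mx.
rewrite linearZ /= trmxK -!scalemxAl -!scalemxAr mul_scalar_mx mul_mx_scalar !scalerA -SC.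
rewrite scale_scalar_mx sa -aE mul_scalar_mx scalerA mulVf // !scale1r.
by rewrite -invfM sa /S addrC subrK.
Qed.

(** With [P = C *m C^T] the trace is the sum of the squared entries of [C^T *m A *m C]. For [P] the
    inverse induced metric this is the squared norm of [A]. *)
Lemma trace_congruence_ge0 n (P A : 'M[R]_n) : P^T = P -> posdef P ->
  0 <= \tr (P *m A *m P *m A^T) /\
  (\tr (P *m A *m P *m A^T) = 0 -> A = 0).
Proof.
move=> PT Ppos; have [C Cu PC] := posdef_cholesky PT Ppos.
pose E := C^T *m A *m C.
have -> : \tr (P *m A *m P *m A^T) = \sum_i \sum_j E i j ^+ 2.
  have -> : \tr (P *m A *m P *m A^T) = \tr (E *m E^T).
    by rewrite PC /E !trmx_mul trmxK -!mulmxA mxtrace_mulC !mulmxA.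
  apply: eq_bigr => i _; rewrite mxE; apply: eq_bigr => j _.
  by rewrite [E^T _ _]mxE expr2.
have sq0 i : 0 <= \sum_j E i j ^+ 2 by apply: sumr_ge0 => j _; exact: sqr_ge0.
split; first exact: sumr_ge0.
move=> /eqP; rewrite psumr_eq0 // => /allP E0.
have {}E0 : E = 0.
  apply/matrixP => i j; rewrite [RHS]mxE.
  have := E0 i (mem_index_enum _); rewrite /= psumr_eq0 => [/allP Ei|k _]; last exact: sqr_ge0.
  by apply/eqP; rewrite -sqrf_eq0; exact: Ei (mem_index_enum _).
have CTu : C^T \in unitmx by rewrite unitmx_tr.
by rewrite -(mulKmx CTu A) -(mulmxK Cu (C^T *m A)) -/E E0 mul0mx mulmx0.
Qed.

Lemma invmx_congruence n (J B : 'M[R]_n) : J \in unitmx -> B \in unitmx ->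
  invmx (J *m B *m J^T) = (invmx J)^T *m invmx B *m invmx J.
Proof.
move=> Ju Bu; have JTu : J^T \in unitmx by rewrite unitmx_tr.
have JBJu : J *m B *m J^T \in unitmx by rewrite !unitmx_mul Ju Bu JTu.
apply: (can_inj (mulKmx JBJu)); rewrite mulmxV // trmx_inv !mulmxA mulmxK //.
by rewrite mulmxK // mulmxV.
Qed.

(** Chart invariance of the pairing of two gradients: covectors change by [J^T] when the metric
    becomes [J *m B *m J^T]. *)
Lemma bilin_invmx_congruence n (J B : 'M[R]_n) v w : J \in unitmx -> B \in unitmx ->
  bilin (invmx (J *m B *m J^T)) (v *m J^T) (w *m J^T) = bilin (invmx B) v w.
Proof.
move=> Ju Bu; rewrite invmx_congruence // -{2}(trmxK (invmx J)) bilin_mulmx.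
by rewrite trmx_inv !mulmxK // unitmx_tr.
Qed.

(** Chart invariance of the squared norm of a bilinear form, used for the second fundamental
    form. *)
Lemma trace_congruence n (J B A : 'M[R]_n) : J \in unitmx -> B \in unitmx ->
  let B' := invmx (J *m B *m J^T) in let A' := J *m A *m J^T in
  \tr (B' *m A' *m B' *m A'^T) = \tr (invmx B *m A *m invmx B *m A^T).
Proof.
move=> Ju Bu B' A'; have JTu : J^T \in unitmx by rewrite unitmx_tr.
have BA (X : 'M[R]_n) : B' *m (J *m X *m J^T) = (invmx J)^T *m (invmx B *m X *m J^T).
  by rewrite /B' invmx_congruence // !mulmxA mulmxKV.
have -> : A'^T = J *m A^T *m J^T by rewrite /A' !trmx_mul trmxK mulmxA.
rewrite -[B' *m A' *m B' *m _]mulmxA /A' !BA -mulmxA mxtrace_mulC.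
by rewrite trmx_inv !mulmxA !(mulmxK JTu).
Qed.

End Congruence.

(** * Hypersurfaces in coordinates *)

Section Reparametrization.
Context {R : realType} {m n : nat}.
Variables (W U : set 'rV[R]_m) (sigma : 'rV[R]_m -> 'rV[R]_m).
Variables (F : 'rV[R]_m -> 'rV[R]_n) (G : 'rV[R]_n -> 'M[R]_n).
Hypotheses (oW : open W) (oU : open U) (WU : forall x, W x -> U (sigma x)).
Hypotheses (sigmas : smooth_on W sigma) (Fs : smooth_on U F).

Lemma first_form_reparam x : W x -> first_form G (F \o sigma) x =
  jacobian sigma x *m first_form G F (sigma x) *m (jacobian sigma x)^T.
Proof.
move=> Wx.
have sD := smooth_differentiable oW sigmas Wx.
have FD := smooth_differentiable oU Fs (WU Wx).
by rewrite /first_form (jacobian_comp sD FD) trmx_mul !mulmxA.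
Qed.

(** The second derivatives of [sigma] enter only through a vector tangent to the image of [F], which
    is orthogonal to [N]. *)
Lemma second_form_reparam N x : W x ->
  (forall k, bilin (G (F (sigma x))) (partial k F (sigma x)) N = 0) ->
  second_form G (F \o sigma) N x =
  jacobian sigma x *m second_form G F N (sigma x) *m (jacobian sigma x)^T.
Proof.
move=> Wx FN; apply/matrixP => a b; rewrite [LHS]mxE.
rewrite (cov_along_comp oW oU WU sigmas Fs) // bilinDl.
have -> : bilin (G ((F \o sigma) x))
    (partial a (partial b sigma) x *m jacobian F (sigma x)) N = 0.
  rewrite (row_basis (partial a (partial b sigma) x)) mulmx_suml bilin_suml big1 // => k _.
  rewrite -scalemxAl bilinZl (smooth_partial_row oU Fs) ?FN ?mulr0 //; exact: WU.
rewrite addr0 -[RHS]bilin_basis bilin_mulmx !(smooth_partial_row oW sigmas) //.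
rewrite [in RHS]bilinE bilin_suml; apply: eq_bigr => i _.
rewrite bilin_suml; apply: eq_bigr => j _.
by rewrite bilinZl [in RHS]mxE.
Qed.

End Reparametrization.

(** * Linear algebra of a hyperplane and its unit normal *)

Section AdaptedFrame.
Context {R : realType} {m : nat}.
Variables (G : 'M[R]_m.+1) (J : 'M[R]_(m, m.+1)) (N : 'rV[R]_m.+1).
Hypotheses (NN : bilin G N N = 1) (JN : forall a, bilin G (row a J) N = 0).
Hypotheses (GT : G^T = G) (hu : J *m G *m J^T \in unitmx).

(** Stacking [N] on the rows of [J] gives a square matrix [E] in which the metric is block diagonal
    with blocks 1 and [h]. Inverting this identity shows at once that [G] is invertible and what its
    inverse is. *)
Lemma frame_inverse : G \in unitmx /\
  invmx G = N^T *m N + J^T *m invmx (J *m G *m J^T) *m J.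
Proof.
set h := J *m G *m J^T; have hu' : h \in unitmx := hu.
pose E : 'M[R]_(1 + m, m.+1) := col_mx N J.
have JGN : J *m G *m N^T = 0.
  apply/matrixP => a i; rewrite ord1 [RHS]mxE -(JN a) /bilin -row_mul.
  by rewrite -row_mul [RHS]mxE.
have NGJ : N *m G *m J^T = 0.
  by apply: trmx_inj; rewrite !trmx_mul trmxK GT mulmxA JGN trmx0.
have NGN : N *m G *m N^T = 1%:M.
  by apply/matrixP => i j; rewrite !ord1 [RHS]mxE eqxx mulr1n -NN.
have EE : E *m G *m E^T = block_mx 1%:M 0 0 h.
  rewrite /E mul_col_mx tr_col_mx mul_col_row.
  by rewrite NGN NGJ JGN.
have BB : block_mx (1%:M : 'M[R]_1) 0 0 h *m block_mx (1%:M : 'M[R]_1) 0 0 (invmx h) = 1%:M.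
  rewrite mulmx_block !mul0mx !mulmx0 !addr0 !add0r mulmxV // mulmx1.
  by rewrite -scalar_mx_block.
have E1 : E *m (G *m E^T *m block_mx (1%:M : 'M[R]_1) 0 0 (invmx h)) = 1%:M.
  by rewrite !mulmxA EE BB.
have E2 := mulmx1C E1.
have G1 : G *m (E^T *m block_mx (1%:M : 'M[R]_1) 0 0 (invmx h) *m E) = 1%:M.
  by rewrite !mulmxA.
have [Gu _] := mulmx1_unit G1; split=> //.
rewrite -[LHS]mulmx1 -G1 mulKmx //.
by rewrite /E tr_col_mx mul_row_block !mulmx0 addr0 add0r mulmx1 mul_row_col.
Qed.

(** The tangential trace is the full trace minus the normal entry, by the splitting of [invmx G]. *)
Lemma frame_trace (B : 'M[R]_m.+1) :
  \tr (invmx (J *m G *m J^T) *m (J *m B *m J^T)) = \tr (invmx G *m B) - bilin B N N.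
Proof.
rewrite frame_inverse.2 mulmxDl linearD /=.
have -> : \tr (N^T *m N *m B) = bilin B N N.
  by rewrite -mulmxA mxtrace_mulC /mxtrace big_ord1.
rewrite addrAC subrr add0r -!mulmxA [in RHS]mxtrace_mulC.
by rewrite !mulmxA.
Qed.

Lemma frame_decomp (v w : 'rV[R]_m.+1) :
  (forall a, bilin G v (row a J) = bilin G w (row a J)) ->
  v = w + (bilin G v N - bilin G w N) *: N.
Proof.
move=> vw; have [Gu Gi] := frame_inverse.
apply/eqP; rewrite -subr_eq0 opprD addrA subr_eq0 -bilinBl; apply/eqP.
set r := v - w.
have rJ : r *m G *m J^T = 0.
  apply/matrixP => i a; rewrite ord1 [RHS]mxE.
  rewrite -[RHS](subrr (bilin G w (row a J))) -{1}vw -bilinBl -/r.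
  by rewrite /bilin tr_row colE mulmxA -colE [RHS]mxE.
rewrite -[LHS](mulmxK Gu) Gi mulmxDr !mulmxA rJ !mul0mx addr0.
by apply/rowP => j; rewrite mxE big_ord1 [RHS]mxE.
Qed.

End AdaptedFrame.

Section Hypersurface.
Context {R : realType} {m : nat}.
Variables (U : set 'rV[R]_m) (V : set 'rV[R]_m.+1).
Variables (F : 'rV[R]_m -> 'rV[R]_m.+1) (G : 'rV[R]_m.+1 -> 'M[R]_m.+1).
Hypotheses (HG : riemannian_on V G) (oU : open U).
Hypothesis UV : forall x, U x -> V (F x).
Hypotheses (Fs : smooth_on U F) (Jf : forall x, U x -> row_free (jacobian F x)).
Variables (N : 'rV[R]_m.+1) (x : 'rV[R]_m).
Hypotheses (Ux : U x) (NN : bilin (G (F x)) N N = 1).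
Hypothesis FN : forall a, bilin (G (F x)) (partial a F x) N = 0.

Let h := first_form G F.

Let partial_row a : partial a F x = row a (jacobian F x).
Proof. by rewrite rowE -(smooth_partial_row oU Fs). Qed.

Let JN a : bilin (G (F x)) (row a (jacobian F x)) N = 0.
Proof. by rewrite -partial_row. Qed.

Let GT : (G (F x))^T = G (F x).
Proof. by have [_ _ Gs _] := HG; apply/Gs/UV. Qed.

Let hu : jacobian F x *m G (F x) *m (jacobian F x)^T \in unitmx.
Proof. exact: (riemannian_unit (first_form_riemannian HG oU UV Fs Jf) Ux). Qed.

(** By [pullback_christoffel] both sides have the same products with tangent vectors, and
    [frame_decomp] leaves only the normal component, which is the second fundamental form. *)
Lemma gauss_formula a b : cov_along G F a (partial b F) x =
  christoffel_op h x (basis_vec a) (basis_vec b) *m jacobian F x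
  + second_form G F N x a b *: N.
Proof.
have E c : bilin (G (F x)) (cov_along G F a (partial b F) x) (row c (jacobian F x)) =
  bilin (G (F x)) (christoffel_op h x (basis_vec a) (basis_vec b) *m jacobian F x)
    (row c (jacobian F x)).
  rewrite -[in LHS]partial_row -(pullback_christoffel HG oU UV Fs Jf a b c Ux).
  by rewrite first_form_bilin rowE.
rewrite {1}(frame_decomp NN JN GT hu E) [second_form _ _ _ _ _ _]mxE.
set v := christoffel_op _ _ _ _.
have -> : bilin (G (F x)) (v *m jacobian F x) N = 0; last by rewrite subr0.
rewrite (row_basis v) mulmx_suml bilin_suml big1 // => c _.
by rewrite -scalemxAl bilinZl (smooth_partial_row oU Fs) // FN mulr0.
Qed.

(** By [gauss_formula] the correction term in [hessian_pullback] is [ddir f (F x) N] times the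
    second fundamental form, whose trace is the mean curvature; [frame_trace] handles the rest. *)
Lemma hypersurface_laplacian f : Ck 2 V f ->
  \tr (invmx (h x) *m hessian h (f \o F) x) =
  \tr (invmx (G (F x)) *m hessian G f (F x)) - bilin (hessian G f (F x)) N N
  + ddir f (F x) N * mean_curv G F N x.
Proof.
move=> f2; have [oV _ _ _] := HG.
have -> : hessian h (f \o F) x =
    jacobian F x *m hessian G f (F x) *m (jacobian F x)^T
    + ddir f (F x) N *: second_form G F N x.
  apply/matrixP => a b; rewrite (hessian_pullback oU oV UV Fs h G a b Ux f2).
  rewrite gauss_formula addrAC subrr add0r ddirZ [RHS]mxE [X in _ = _ + X]mxE.
  rewrite -[X in _ = X + _]bilin_basis bilin_mulmx !(smooth_partial_row oU Fs) //.
  by rewrite [X in _ + X]mulrC.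
rewrite mulmxDr linearD /= -scalemxAr linearZ /=; congr (_ + _).
exact: (frame_trace NN JN GT hu).
Qed.

End Hypersurface.

Lemma trace_sum_algebra (K : realFieldType) n (H P Q : 'I_n -> 'I_n -> K) :
  (forall a b, H a b = H b a) ->
  \sum_a \sum_b H a b * (2^-1 * (P b a + P a b - Q b a)) =
  \sum_a \sum_b H a b * P a b - 2^-1 * \sum_a \sum_b H a b * Q a b.
Proof.
move=> Hs.
have swap X : \sum_a \sum_b H a b * X b a = \sum_a \sum_b H a b * X a b.
  rewrite exchange_big; apply: eq_bigr => a _; apply: eq_bigr => b _.
  by rewrite Hs.
transitivity (2^-1 * (\sum_a \sum_b H a b * P b a + \sum_a \sum_b H a b * P a b
    - \sum_a \sum_b H a b * Q b a)); last by rewrite (swap P) (swap Q); field.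
rewrite -big_split -sumrB mulr_sumr; apply: eq_bigr => a _.
rewrite -big_split -sumrB mulr_sumr; apply: eq_bigr => b _ /=.
by ring.
Qed.

(** * The divergence of a weighted gradient in coordinates *)

Section Divergence.
Context {R : realType} {m : nat} (U : set 'rV[R]_m) (h : 'rV[R]_m -> 'M[R]_m).
Hypothesis Hh : riemannian_on U h.

Let oU : open U. Proof. by have [] := Hh. Qed.

(** A component of the field [w grad phi] times the volume density, which turns the Riemannian
    divergence into a plain sum of partial derivatives. *)
Definition density_field (w phi : 'rV[R]_m -> R) (a : 'I_m) (x : 'rV[R]_m) : R :=
  w x * Num.sqrt (\det (h x)) * (grad_row phi x *m invmx (h x)) 0 a.

Lemma Ck_grad_row k phi : Ck k.+1 U phi -> Ck k U (grad_row phi).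
Proof.
move=> phik; apply/(Ck_mxP _ _ oU) => i a.
by apply: Ck_eq (Ck_partial a phik) => // x _; rewrite mxE.
Qed.

Lemma Ck_sqrt_det k : Ck k U (fun x => Num.sqrt (\det (h x))).
Proof.
have [_ hs _ hp] := Hh; apply: Ck_sqrt => // [x /hp|]; first exact: posdef_det_gt0.
exact: Ck_det.
Qed.

Lemma Ck_inv_metric k : Ck k U (fun x => invmx (h x)).
Proof.
have [_ hs _ _] := Hh; apply: Ck_invmx => // x; exact: (riemannian_unit Hh).
Qed.

Lemma Ck_density_field k w phi a : Ck k U w -> Ck k.+1 U phi ->
  Ck k U (density_field w phi a).
Proof.
move=> wk phik; apply: CkM => //; first by apply: CkM => //; exact: Ck_sqrt_det.
have := Ck_mulmx oU (Ck_grad_row phik) (Ck_inv_metric k).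
by move=> /(Ck_mxP _ _ oU); apply.
Qed.

Section DivergencePointwise.
Variables (w phi : 'rV[R]_m -> R) (x : 'rV[R]_m).
Hypotheses (Ux : U x) (w1 : Ck 1 U w) (phi2 : Ck 2 U phi).

Let Hi := invmx (h x).
Let s := Num.sqrt (\det (h x)).
Let psi := grad_row phi x *m Hi.

Let hsym : (h x)^T = h x. Proof. by have [_ _ hs _] := Hh; exact: hs. Qed.
Let hu : h x \in unitmx. Proof. exact: riemannian_unit Hh _ Ux. Qed.
Let Hisym : Hi^T = Hi. Proof. by rewrite /Hi trmx_inv hsym. Qed.
Let det0 : 0 < \det (h x).
Proof. by have [_ _ _ hp] := Hh; exact/posdef_det_gt0/hp. Qed.
Let s0 : s != 0. Proof. by rewrite gt_eqF // sqrtr_gt0. Qed.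

Let dhsym a : (partial a h x)^T = partial a h x.
Proof.
have [_ _ hs _] := Hh.
apply/matrixP => i j; rewrite [LHS]mxE -!(partial_metric_entry Hh) //.
apply: (partial_open a oU) => // y Uy.
by rewrite -{1}(hs y Uy) mxE.
Qed.

Let is_derive_sqrt_det a : is_derive x (basis_vec a)
  (fun y => Num.sqrt (\det (h y))) (2^-1 * s * \tr (Hi *m partial a h x)).
Proof.
have D := is_derive_det (riemannian_partial Hh a Ux).
have [D1 D2] := D.
apply: (is_derive_eq (is_derive_sqrt D1 det0)); rewrite D2.
have -> : \adj (h x) = \det (h x) *: Hi.
  by rewrite /Hi /invmx hu scalerA divff ?scale1r // gt_eqF.
rewrite -scalemxAr mxtraceZ mxtrace_mulC mulrA; congr (_ * _).
have sE : \det (h x) = s * s by rewrite /s -expr2 sqr_sqrtr // ltW.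
by rewrite [X in _ * X]sE -/s; field.
Qed.

Let is_derive_inv a : is_derive x (basis_vec a) (fun y => invmx (h y))
  (- (Hi *m partial a h x *m Hi)).
Proof.
have iD : derivable (fun y => invmx (h y)) x (basis_vec a).
  exact: (Ck_derivable (Ck_inv_metric 1)).
apply: (is_derive_eq (derivableP iD)).
apply: is_derive_invmx (riemannian_partial Hh a Ux) (derivableP iD).
apply: filterS (open_nbhs_nbhs (conj oU Ux)) => y; exact: riemannian_unit Hh y.
Qed.

Let is_derive_grad a : is_derive x (basis_vec a) (grad_row phi)
  (row a (coord_hessian phi x)).
Proof.
apply/is_derive_mxP => i j; rewrite !mxE.
have D := derivableP (Ck_derivable (Ck_partial j phi2) Ux : derivable _ _ (basis_vec a)).
by under [fun y => _]eq_fun do rewrite mxE.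
Qed.

(** [psi] is the gradient with its index raised. Contracting the Koszul formula leaves the
    derivative of the inverse metric and half the logarithmic derivative of the determinant, exactly
    the terms that arise in differentiating [density_field]. *)
Let trace_christoffel :
  \tr (Hi *m (\matrix_(a, b) ddir phi x (christoffel_op h x (basis_vec a) (basis_vec b)))) =
  \sum_a ((psi *m partial a h x *m Hi) 0 a
          - 2^-1 * (psi 0 a * \tr (Hi *m partial a h x))).
Proof.
have psiE : psi *m h x = grad_row phi x by rewrite /psi mulmxKV.
have G a b : ddir phi x (christoffel_op h x (basis_vec a) (basis_vec b)) =
   2^-1 * ((psi *m partial a h x) 0 b + (psi *m partial b h x) 0 a - dmetric h x psi a b).
  rewrite ddir_mulmx -psiE trmx_mul hsym mulmxA -/(bilin _ _ _) (koszul Hh) //.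
  have row_entry c d : bilin (partial c h x) (basis_vec d) psi = (psi *m partial c h x) 0 d.
    by rewrite bilin_sym // /bilin trmx_delta -colE mxE.
  apply: (congr1 (fun z => _ * z)).
  have row_basis_entry c d : bilin (dmetric h x (basis_vec c)) (basis_vec d) psi
      = (psi *m partial c h x) 0 d.
    exact: etrans (congr1 (fun B => bilin B _ _) (dmetric_basis h x c)) (row_entry c d).
  exact: (f_equal2 (fun s t => s - t)
    (f_equal2 (fun s t => s + t) (row_basis_entry a b) (row_basis_entry b a))
    (bilin_basis (dmetric h x psi) a b)).
have Hij a b : Hi a b = Hi b a by rewrite -{1}Hisym mxE.
transitivity (\sum_a \sum_b Hi a b * (2^-1 * ((psi *m partial b h x) 0 a
    + (psi *m partial a h x) 0 b - dmetric h x psi b a))).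
  by apply: eq_bigr => a _; rewrite mxE; apply: eq_bigr => b _; rewrite [X in _ * X]mxE G.
apply: etrans (trace_sum_algebra (fun a b => (psi *m partial a h x) 0 b)
  (fun a b => dmetric h x psi a b) Hij) _.
rewrite sumrB -mulr_sumr; congr (_ - _ * _).
  apply: eq_bigr => a _; rewrite [RHS]mxE; apply: eq_bigr => b _.
  by rewrite Hij mulrC.
have -> : \sum_a psi 0 a * \tr (Hi *m partial a h x) = \tr (Hi *m dmetric h x psi).
  rewrite /dmetric mulmx_sumr raddf_sum; apply: eq_bigr => a _.
  by rewrite -scalemxAr /= linearZ.
apply: eq_bigr => a _; rewrite [RHS]mxE; apply: eq_bigr => b _.
congr (_ * _); rewrite /dmetric !summxE; apply: eq_bigr => c _.
by rewrite [LHS]mxE [RHS]mxE -{1}dhsym [X in _ * X = _]mxE.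
Qed.

(** After the product rule, the derivatives of the inverse metric and of the density recombine
    through [trace_christoffel] into the Christoffel part of the Hessian. *)
Lemma divergence :
  \sum_a partial a (density_field w phi a) x =
  Num.sqrt (\det (h x)) *
    (w x * \tr (invmx (h x) *m hessian h phi x)
     + bilin (invmx (h x)) (grad_row w x) (grad_row phi x)).
Proof.
have D a : partial a (density_field w phi a) x =
    w x * s * ((row a (coord_hessian phi x) *m Hi) 0 a - (psi *m partial a h x *m Hi) 0 a)
    + psi 0 a * (w x * (2^-1 * s * \tr (Hi *m partial a h x)) + s * partial a w x).
  have /is_derive_mxP/(_ 0 a) D1 := is_derive_mulmx (is_derive_grad a) (is_derive_inv a).
  have wD : is_derive x (basis_vec a) w (partial a w x).
    by apply: derivableP; exact: (Ck_derivable w1).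
  have D2 := is_deriveM (is_deriveM wD (is_derive_sqrt_det a)) D1.
  have [_ E] := D2; apply: etrans E _.
  apply: (f_equal2 (fun s t => s + t)) => //; apply: (congr1 (fun z => _ * z)).
  by rewrite mxE mulmxN [X in _ + X]mxE !mulmxA.
have hessE : hessian h phi x = coord_hessian phi x -
   \matrix_(a, b) ddir phi x (christoffel_op h x (basis_vec a) (basis_vec b)).
  apply/matrixP => a b.
  by rewrite -[LHS]bilin_basis bilin_hessian bilin_basis !mxE.
rewrite hessE mulmxBr linearB /= trace_christoffel.
have T1 : \tr (Hi *m coord_hessian phi x) = \sum_a (row a (coord_hessian phi x) *m Hi) 0 a.
  by rewrite mxtrace_mulC; apply: eq_bigr => a _; rewrite -row_mul [RHS]mxE.
have T2 : bilin Hi (grad_row w x) (grad_row phi x) = \sum_a psi 0 a * partial a w x.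
  rewrite bilin_sym // /bilin -/psi mxE; apply: eq_bigr => a _; by rewrite !mxE.
rewrite T1 T2 -sumrB mulr_sumr -big_split mulr_sumr /=; apply: eq_bigr => a _.
rewrite D -/s; ring.
Qed.

End DivergencePointwise.

End Divergence.

(** For row vectors the norm is the sup norm, so the support lies in a cube and slices keep the same
    [r]. *)
Definition Cc (R : realType) (V : normedModType R) (r : R) (f : V -> R) :=
  continuous f /\ forall x, r < `|x| -> f x = 0.

(** * Iterated integrals of compactly supported functions *)

Section CcTheory.
Context {R : realType} {V : normedModType R}.
Implicit Types (f g : V -> R) (r s : R).

Lemma Cc_le r s f : r <= s -> Cc r f -> Cc s f.
Proof. by move=> rs [fc f0]; split=> // x sx; apply/f0/(le_lt_trans rs). Qed.

Lemma CcD r f g : Cc r f -> Cc r g -> Cc r (fun x => f x + g x).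
Proof.
move=> [fc f0] [gc g0]; split=> [x|x rx]; last by rewrite f0 // g0 // addr0.
by apply: continuousD; [exact: fc|exact: gc].
Qed.

Lemma CcZ r f a : Cc r f -> Cc r (fun x => a * f x).
Proof.
move=> [fc f0]; split=> [x|x rx]; last by rewrite f0 // mulr0.
by apply: continuousM; [exact: cst_continuous|exact: fc].
Qed.

Lemma CcB r f g : Cc r f -> Cc r g -> Cc r (fun x => f x - g x).
Proof.
move=> [fc f0] [gc g0]; split=> [x|x rx]; last by rewrite f0 // g0 // subr0.
by apply: continuousB; [exact: fc|exact: gc].
Qed.

Lemma Cc0 r : @Cc R V r (fun=> 0).
Proof. by split=> // x; exact: cst_continuous. Qed.

End CcTheory.

Section OneVariable.
Context {R : realType}.
Implicit Types (f g : R -> R) (r s : R).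
Local Notation mu := (@lebesgue_measure R).

Lemma Cc_segment_integrable r f : Cc r f -> mu.-integrable `[- r, r] (EFin \o f).
Proof.
move=> [fc _]; apply: continuous_compact_integrable; first exact: segment_compact.
exact: continuous_subspaceT.
Qed.

Lemma Cc_restrict r f : Cc r f -> f \_ `[- r, r] = f.
Proof.
move=> [_ f0]; apply/funext => t; rewrite patchE; case: ifPn => // /negP tr.
apply/esym/f0; rewrite ltNge; apply/negP => tr'; apply: tr.
by rewrite inE /= in_itv /= -ler_norml.
Qed.

(** On the compact segment continuity alone gives integrability. *)
Lemma Cc_Rintegral r f : Cc r f ->
  Rintegral mu setT f = Rintegral mu `[- r, r] f.
Proof. by move=> fC; rewrite [RHS]Rintegral_mkcond Cc_restrict. Qed.

Lemma Rintegral_CcD r f g : Cc r f -> Cc r g ->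
  Rintegral mu setT (fun t => f t + g t) = Rintegral mu setT f + Rintegral mu setT g.
Proof.
move=> fC gC; rewrite (Cc_Rintegral (CcD fC gC)) (Cc_Rintegral fC) (Cc_Rintegral gC).
by rewrite RintegralD //; exact: Cc_segment_integrable.
Qed.

Lemma Rintegral_CcZ r f a : Cc r f ->
  Rintegral mu setT (fun t => a * f t) = a * Rintegral mu setT f.
Proof.
move=> fC; rewrite (Cc_Rintegral (CcZ a fC)) (Cc_Rintegral fC).
by rewrite RintegralZl //; exact: Cc_segment_integrable.
Qed.

Lemma Rintegral_segment_cst (a b c : R) : a <= b ->
  Rintegral mu `[a, b] (fun=> c) = (b - a) * c.
Proof.
move=> ab; rewrite Rintegral_cst // mulrC; congr (_ * _).
rewrite -[LHS]/(fine (@lebesgue_measure R `[a, b])) lebesgue_measure_itv /= lte_fin.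
by case: ltP => [_|ba]; [rewrite -EFinB|rewrite (le_anti (introT andP (conj ab ba))) subrr].
Qed.

Lemma Rintegral_Cc_le r f (B : R) : 0 <= r -> Cc r f -> (forall t, `|f t| <= B) ->
  `|Rintegral mu setT f| <= 2 * r * B.
Proof.
move=> r0 fC fB; rewrite (Cc_Rintegral fC).
have fi := Cc_segment_integrable fC.
apply: le_trans (le_normr_Rintegral _ fi) _ => //.
have -> : 2 * r * B = Rintegral mu `[- r, r] (fun=> B).
  rewrite Rintegral_segment_cst; first by rewrite opprK mulr_natl mulr2n.
  by apply: (le_trans _ r0); rewrite oppr_le0.
apply: le_Rintegral => //.
  exact: (integrable_abse fi).
apply: continuous_compact_integrable; first exact: segment_compact.
by apply: continuous_subspaceT => t; exact: cst_continuous.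
Qed.

(** [f] dominates the function [g] equal to [f t0 / 2] on a segment around [t0] and to 0
    elsewhere. *)
Lemma Rintegral_Cc_gt0 r f t0 : Cc r f -> (forall t, 0 <= f t) -> 0 < f t0 ->
  0 < Rintegral mu setT f.
Proof.
move=> fC f0 ft0; have [fc fr] := fC.
have ft2 : 0 < f t0 / 2 by rewrite divr_gt0.
have : \forall t \near t0, f t0 / 2 <= f t.
  move/cvgrPdist_le: (fc t0) => /(_ _ ft2); apply: filterS => t.
  by rewrite ler_norml => /andP[_]; rewrite lerBlDr -lerBlDl {1}[f t0]splitr addrK.
move=> /nbhs_ballP[d /= d0 df].
pose e := d / 2.
have e0 : 0 < e by rewrite divr_gt0.
(* Large enough for [[- s, s]] to contain both the support of [f] and the segment around [t0]. *)
pose s := Num.max r (`|t0| + e).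
have fCs : Cc s f by apply: Cc_le fC; rewrite le_max lexx.
have sub : [set` (`[t0 - e, t0 + e] : interval R)] `<=` [set` (`[- s, s] : interval R)].
  move=> t /=; rewrite !in_itv /= -ler_distlC -ler_norml => te.
  rewrite le_max -(subrKC t0 t); apply/orP; right.
  by rewrite (le_trans (ler_normD _ _)) // lerD2l distrC.
pose g := (fun=> f t0 / 2) \_ `[t0 - e, t0 + e] : R -> R.
have gi : mu.-integrable `[- s, s] (EFin \o g).
  rewrite /g -restrict_EFin; apply/integrable_restrict => //=.
  rewrite (setIidr sub); apply: continuous_compact_integrable; first exact: segment_compact.
  by apply: continuous_subspaceT => t; exact: cst_continuous.
have gE : Rintegral mu `[- s, s] g = Rintegral mu `[t0 - e, t0 + e] (fun=> f t0 / 2).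
  by rewrite -[in RHS](setIidr sub) Rintegral_mkcondr.
rewrite (Cc_Rintegral fCs).
suff gf : Rintegral mu `[- s, s] g <= Rintegral mu `[- s, s] f.
  apply: lt_le_trans gf; rewrite gE Rintegral_segment_cst.
    have -> : t0 + e - (t0 - e) = e + e by ring.
    by rewrite mulr_gt0 // addr_gt0.
  by rewrite lerD2l (le_trans _ (ltW e0)) // oppr_le0 ltW.
apply: le_Rintegral => //; first exact: Cc_segment_integrable.
move=> t _; rewrite /g /patch; case: ifPn => [/set_mem /=|_]; last exact: f0.
rewrite in_itv /= -ler_distlC => te; apply: df; rewrite -ball_normE /=.
by rewrite (le_lt_trans te) // /e ltr_pdivrMr // ltr_pMr // ltr1n.
Qed.

(** The fundamental theorem of calculus is applied on the segment of radius [r + 1], because [Cc]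
    states vanishing only strictly beyond [r]. *)
Lemma Rintegral_derive_Cc r f g : 0 < r -> Cc r f -> Cc r g ->
  (forall t : R, is_derive t 1 f (g t)) -> Rintegral mu setT g = 0.
Proof.
move=> r0 fC gC fD; have r1 : r < r + 1 by rewrite ltrDl.
have gC' := Cc_le (ltW r1) gC; have [fc f0] := fC; have [gc _] := gC.
rewrite (Cc_Rintegral gC') /Rintegral.
rewrite (@continuous_FTC2 _ g f) //=.
- by rewrite !f0 ?subrr // ?normrN gtr0_norm // (lt_trans r0).
- by rewrite -subr_gt0 opprK addr_gt0 // (lt_trans r0).
- exact: continuous_subspaceT.
- split=> [t _||].
  + by have [] := fD t.
  + by apply: cvg_at_right_filter; exact: fc.
  + by apply: cvg_at_left_filter; exact: fc.
- by move=> t _; rewrite derive1E; have [] := fD t.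
Qed.

End OneVariable.

Section ConsVec.
Context {R : realType} {n : nat}.
Implicit Types (t : R) (y : 'rV[R]_n).

Definition cons_vec t y : 'rV[R]_n.+1 := row_mx (t%:M : 'rV[R]_1) y.

Lemma cons_vec_ord0 t y : cons_vec t y 0 ord0 = t.
Proof.
have -> : ord0 = lshift n (ord0 : 'I_1) :> 'I_n.+1 by exact/val_inj.
apply: etrans (row_mxEl (t%:M : 'rV[R]_1) y 0 ord0) _.
by rewrite mxE eqxx mulr1n.
Qed.

Lemma cons_vec_lift t y i : cons_vec t y 0 (lift ord0 i) = y 0 i.
Proof.
have -> : lift ord0 i = rshift 1 i :> 'I_n.+1 by exact/val_inj.
exact: (row_mxEr (t%:M : 'rV[R]_1) y 0 i).
Qed.

Lemma cons_vec_eta (x : 'rV[R]_n.+1) :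
  x = cons_vec (x 0 ord0) (\row_i x 0 (lift ord0 i)).
Proof.
apply/rowP => i; case: (unliftP ord0 i) => [j|] ->.
  by rewrite cons_vec_lift mxE.
by rewrite cons_vec_ord0.
Qed.

Lemma cons_vec_add0 t t' y :
  cons_vec t y + t' *: basis_vec ord0 = cons_vec (t + t') y.
Proof.
apply/rowP => i; rewrite [LHS]mxE [X in _ + X]mxE coord_basis_vec.
case: (unliftP ord0 i) => [j|] ->.
  by rewrite !cons_vec_lift -(inj_eq val_inj) mulr0 addr0.
by rewrite !cons_vec_ord0 eqxx mulr1.
Qed.

Lemma cons_vec_addl t y j s :
  cons_vec t y + s *: basis_vec (lift ord0 j) = cons_vec t (y + s *: basis_vec j).
Proof.
apply/rowP => i; rewrite [LHS]mxE [X in _ + X]mxE coord_basis_vec.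
case: (unliftP ord0 i) => [k|] ->.
  by rewrite !cons_vec_lift (inj_eq lift_inj) [RHS]mxE [X in _ = _ + X]mxE coord_basis_vec.
by rewrite !cons_vec_ord0 -(inj_eq val_inj) mulr0 addr0.
Qed.

Lemma norm_cons_vec_head t y : `|t| <= `|cons_vec t y|.
Proof. by rewrite -{1}(cons_vec_ord0 t y); exact: normr_coord. Qed.

Lemma norm_cons_vec_tail t y : `|y| <= `|cons_vec t y|.
Proof.
apply: mx_norm_le => // i j; rewrite ord1 -(cons_vec_lift t y j).
exact: normr_coord.
Qed.

Lemma cons_vec_continuous t : continuous (cons_vec t).
Proof.
move=> y; apply: (continuous_at_mxP (cons_vec t) y).2 => i j.
rewrite ord1; case: (unliftP ord0 j) => [k|] ->.
  have -> : (fun y => cons_vec t y 0 (lift ord0 k)) = (fun y : 'rV[R]_n => y 0 k).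
    by apply/funext => z; rewrite cons_vec_lift.
  exact: coord_continuous.
have -> : (fun y => cons_vec t y 0 ord0) = (fun=> t).
  by apply/funext => z; rewrite cons_vec_ord0.
exact: cst_continuous.
Qed.

End ConsVec.

Section UniformContinuity.
Context {R : realType} {n : nat}.

Lemma compact_norm_ball (r : R) : compact [set x : 'rV[R]_n | `|x| <= r].
Proof.
apply: bounded_closed_compact.
  exists r; split; first exact: num_real.
  by move=> s rs x /= /le_trans; apply; exact: ltW.
apply: (@closed_comp _ _ (fun x : 'rV[R]_n => `|x|) [set s | s <= r]) => [x _|].
  exact: norm_continuous.
exact: closed_le.
Qed.

(** Compactness gives uniformity on the ball of radius [r + 1]; outside it, a shift shorter than 1
    stays in the region where [f] is 0. *)
Lemma Cc_uniform r (f : 'rV[R]_n -> R) (e : R) : Cc r f -> 0 < e ->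
  \forall h \near (0 : 'rV[R]_n), forall x, `|f (x + h) - f x| < e.
Proof.
move=> [fc f0] e0.
pose K : set 'rV[R]_n := [set x | `|x| <= r + 1].
have nK : \forall h \near (0 : 'rV[R]_n), K `<=` (fun x => `|f (x + h) - f x| < e).
  have /compact_near_coveringP cK : compact K := @compact_norm_ball (r + 1).
  apply: (cK _ (nbhs (0 : 'rV[R]_n)) (fun h x => `|f (x + h) - f x| < e) _) => x Kx.
  have e2 : 0 < e / 2 by rewrite divr_gt0.
  have /nbhs_ballP[d /= d0 fd] : \forall y \near x, `|f x - f y| < e / 2.
    by move/cvgrPdist_lt: (fc x); apply.
  have d2 : 0 < d / 2 by rewrite divr_gt0.
  exists (ball x (d / 2), ball 0 (d / 2)) => /=.
    by split; exact: nbhsx_ballx.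
  move=> [x' h] /= [x'x h0].
  have x'hx : ball x d (x' + h).
    move: x'x h0; rewrite -!ball_normE /= sub0r normrN => x'x h0.
    by rewrite opprD addrA (splitr d) (le_lt_trans (ler_normB _ _)) // ltrD.
  have x'x' : ball x d x' by apply: le_ball x'x; rewrite [leRHS]splitr lerDl ltW.
  have := fd _ x'hx; have := fd _ x'x' => H1 H2.
  rewrite (splitr e) -(subrKA (f x)) (le_lt_trans (ler_normD _ _)) // ltrD //.
  by rewrite distrC.
apply: filterS2 nK (@nbhs0_lt _ 'rV[R]_n _ ltr01) => h nK h1 x.
have [Kx|] := leP `|x| (r + 1); first exact: nK.
move=> rx; rewrite !f0 ?subrr ?normr0 //.
  by rewrite (lt_trans _ rx) // ltrDl.
have := ler_normB (x + h) h; rewrite addrK => xh.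
by rewrite -(ltrD2r 1) (lt_le_trans rx) // (le_trans xh) // lerD2l ltW.
Qed.

End UniformContinuity.

Section IteratedIntegral.
Context {R : realType}.
Local Notation mu := (@lebesgue_measure R).

Lemma integral_RnS n (f : 'rV[R]_n.+1 -> R) :
  integral_Rn f = Rintegral mu setT (fun t => integral_Rn (fun y => f (cons_vec t y))).
Proof. by []. Qed.

Lemma eq_integral_Rn n (f g : 'rV[R]_n -> R) : f =1 g ->
  integral_Rn f = integral_Rn g.
Proof. by move=> /funext ->. Qed.

Lemma Cc_slice n (r t : R) (f : 'rV[R]_n.+1 -> R) : Cc r f ->
  Cc r (fun y => f (cons_vec t y)).
Proof.
move=> [fc f0]; split=> [y|y ry].
  by apply: continuous_comp; [exact: cons_vec_continuous|exact: fc].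
by apply: f0; rewrite (lt_le_trans ry) // norm_cons_vec_tail.
Qed.

(** The claims are proved together: continuity of the slice integrals uses linearity and the bound
    in dimension [n], and linearity and the bound in dimension [n.+1] use that continuity. *)
Lemma integral_Rn_Cc n :
  [/\ forall (r : R) (f g : 'rV[R]_n -> R), Cc r f -> Cc r g ->
        integral_Rn (fun x => f x + g x) = integral_Rn f + integral_Rn g,
      forall (r a : R) (f : 'rV[R]_n -> R), Cc r f ->
        integral_Rn (fun x => a * f x) = a * integral_Rn f &
      forall (r B : R) (f : 'rV[R]_n -> R), 0 <= r -> Cc r f ->
        (forall x, `|f x| <= B) -> `|integral_Rn f| <= (2 * r) ^+ n * B] /\
  (forall (r : R) (f : 'rV[R]_n.+1 -> R), 0 <= r -> Cc r f ->
     Cc r (fun t => integral_Rn (fun y => f (cons_vec t y)))).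
Proof.
have slice_Cc k : [/\ forall (r : R) (f g : 'rV[R]_k -> R), Cc r f -> Cc r g ->
        integral_Rn (fun x => f x + g x) = integral_Rn f + integral_Rn g,
      forall (r a : R) (f : 'rV[R]_k -> R), Cc r f ->
        integral_Rn (fun x => a * f x) = a * integral_Rn f &
      forall (r B : R) (f : 'rV[R]_k -> R), 0 <= r -> Cc r f ->
        (forall x, `|f x| <= B) -> `|integral_Rn f| <= (2 * r) ^+ k * B] ->
   forall (r : R) (f : 'rV[R]_k.+1 -> R), 0 <= r -> Cc r f ->
     Cc r (fun t => integral_Rn (fun y => f (cons_vec t y))).
  move=> [addI scaleI boundI] r f r0 fC; have [fc f0] := fC; split=> [t|t rt].
    apply/cvgrPdist_le => e e0.
    (* The added 1 keeps the divisor positive when [r = 0]; the volume factor times the chosen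
       tolerance still stays below [e]. *)
    have M0 : 0 < (2 * r) ^+ k + 1 :> R by rewrite ltr_wpDl // exprn_ge0 // mulr_ge0.
    have e'0 : 0 < e / ((2 * r) ^+ k + 1) by rewrite divr_gt0.
    have /nbhs_ballP[d /= d0 fd] := Cc_uniform fC e'0.
    apply: filterS (nbhsx_ballx t d d0) => t'; rewrite -ball_normE /= => tt'.
    have -> : integral_Rn (fun y => f (cons_vec t y)) - integral_Rn (fun y => f (cons_vec t' y))
       = integral_Rn (fun y => f (cons_vec t y) + - 1 * f (cons_vec t' y)).
      rewrite (addI r) //; [|exact: Cc_slice|exact/CcZ/Cc_slice].
      by rewrite (scaleI r) ?mulN1r //; exact: Cc_slice.
    apply: le_trans (boundI r (e / ((2 * r) ^+ k + 1)) _ r0 _ _) _.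
    - by apply: CcD; [exact: Cc_slice|exact/CcZ/Cc_slice].
    - move=> y; rewrite mulN1r.
      have -> : cons_vec t y = cons_vec t' y + (t - t') *: basis_vec ord0.
        by rewrite cons_vec_add0 subrKC.
      apply: ltW; apply: fd; rewrite -ball_normE /= sub0r normrN.
      exact: le_lt_trans (norm_basis_vec _ _) tt'.
    - rewrite mulrCA ler_piMr ?(ltW e0) // ler_pdivrMr // mul1r lerDl //.
  have : `|integral_Rn (fun y => f (cons_vec t y))| <= (2 * r) ^+ k * 0.
    apply: boundI r0 _ _; first exact: Cc_slice.
    by move=> y; rewrite f0 ?normr0 // (lt_le_trans rt) // norm_cons_vec_head.
  by rewrite mulr0 normr_le0 => /eqP.
suff H : [/\ forall (r : R) (f g : 'rV[R]_n -> R), Cc r f -> Cc r g ->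
        integral_Rn (fun x => f x + g x) = integral_Rn f + integral_Rn g,
      forall (r a : R) (f : 'rV[R]_n -> R), Cc r f ->
        integral_Rn (fun x => a * f x) = a * integral_Rn f &
      forall (r B : R) (f : 'rV[R]_n -> R), 0 <= r -> Cc r f ->
        (forall x, `|f x| <= B) -> `|integral_Rn f| <= (2 * r) ^+ n * B].
  by split=> //; exact: slice_Cc.
elim: n => [|n IH]; first by split=> [r f g _ _|r a f _|r B f _ _ fB] //;
  rewrite expr0 mul1r; exact: fB.
have [addI scaleI boundI] := IH; have sliceI := slice_Cc n IH.
(* Linearity is claimed for every [r], while slice integrals are controlled for nonnegative radii
   only. *)
have absC r (f : 'rV[R]_n.+1 -> R) : Cc r f -> Cc `|r| f.
  by apply: Cc_le; exact: ler_norm.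
split=> [r f g /absC fC /absC gC|r a f /absC fC|r B f r0 fC fB]; rewrite !integral_RnS.
- rewrite -(@Rintegral_CcD _ `|r|); [|exact: sliceI|exact: sliceI].
  by congr Rintegral; apply/funext => t; apply: (addI `|r|); exact: Cc_slice.
- rewrite -(@Rintegral_CcZ _ `|r|); [|exact: sliceI].
  by congr Rintegral; apply/funext => t; apply: (scaleI `|r|); exact: Cc_slice.
- rewrite exprS -mulrA; apply: Rintegral_Cc_le => // [|t]; first exact: sliceI.
  by apply: boundI => //; exact: Cc_slice.
Qed.

Lemma integral_RnD n (r : R) (f g : 'rV[R]_n -> R) : Cc r f -> Cc r g ->
  integral_Rn (fun x => f x + g x) = integral_Rn f + integral_Rn g.
Proof. by have [[H _ _] _] := integral_Rn_Cc n; exact: H. Qed.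

Lemma integral_RnZ n (r a : R) (f : 'rV[R]_n -> R) : Cc r f ->
  integral_Rn (fun x => a * f x) = a * integral_Rn f.
Proof. by have [[_ H _] _] := integral_Rn_Cc n; exact: H. Qed.

Lemma integral_Rn_le n (r B : R) (f : 'rV[R]_n -> R) : 0 <= r -> Cc r f ->
  (forall x, `|f x| <= B) -> `|integral_Rn f| <= (2 * r) ^+ n * B.
Proof. by have [[_ _ H] _] := integral_Rn_Cc n; exact: H. Qed.

Lemma Cc_integral_slice n (r : R) (f : 'rV[R]_n.+1 -> R) : 0 <= r -> Cc r f ->
  Cc r (fun t => integral_Rn (fun y => f (cons_vec t y))).
Proof. by have [_ H] := integral_Rn_Cc n; exact: H. Qed.

Lemma integral_RnB n (r : R) (f g : 'rV[R]_n -> R) : Cc r f -> Cc r g ->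
  integral_Rn (fun x => f x - g x) = integral_Rn f - integral_Rn g.
Proof.
move=> fC gC; rewrite -[in RHS]mulN1r -(integral_RnZ _ gC) -(integral_RnD fC (CcZ _ gC)).
by apply: eq_integral_Rn => x; rewrite mulN1r.
Qed.

Lemma integral_Rn0 n : @integral_Rn R n (fun=> 0) = 0.
Proof.
have := @integral_RnZ n 1 0 (fun=> 0) (@Cc0 _ _ 1).
by rewrite !mul0r.
Qed.

Lemma Cc_sum n (r : R) (I : Type) (s : seq I) (f : I -> 'rV[R]_n -> R) :
  (forall i, Cc r (f i)) -> Cc r (fun x => \sum_(i <- s) f i x).
Proof.
move=> fC; elim: s => [|i s IH].
  by under [fun x => _]eq_fun do rewrite big_nil; exact: Cc0.
by under [fun x => _]eq_fun do rewrite big_cons; exact: CcD.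
Qed.

Lemma integral_Rn_sum n (r : R) (I : Type) (s : seq I) (f : I -> 'rV[R]_n -> R) :
  (forall i, Cc r (f i)) ->
  integral_Rn (fun x => \sum_(i <- s) f i x) = \sum_(i <- s) integral_Rn (f i).
Proof.
move=> fC; elim: s => [|i s IH].
  rewrite big_nil; under eq_integral_Rn do rewrite big_nil.
  exact: integral_Rn0.
rewrite big_cons -IH -(integral_RnD (fC i) (Cc_sum s fC)).
by apply: eq_integral_Rn => x; rewrite big_cons.
Qed.

Lemma integral_Rn_ge0 n (f : 'rV[R]_n -> R) : (forall x, 0 <= f x) ->
  0 <= integral_Rn f.
Proof.
elim: n f => [|n IH] f f0; first exact: f0.
by apply: Rintegral_ge0 => t _; exact: IH.
Qed.

Lemma integral_Rn_gt0 n (r : R) (f : 'rV[R]_n -> R) x0 : 0 <= r -> Cc r f ->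
  (forall x, 0 <= f x) -> 0 < f x0 -> 0 < integral_Rn f.
Proof.
move=> r0; elim: n f x0 => [|n IH] f x0 fC f0 fx0.
  by rewrite /= (_ : 0 = x0) //; apply/rowP => -[].
apply: (@Rintegral_Cc_gt0 _ r _ (x0 0 ord0)).
- exact: Cc_integral_slice.
- by move=> t; exact: integral_Rn_ge0.
apply: (IH _ (\row_i x0 0 (lift ord0 i))) => //; first exact: Cc_slice.
by move: fx0; rewrite {1}(cons_vec_eta x0).
Qed.

Lemma Cc_partial0 n (r : R) (f : 'rV[R]_n -> R) a x : Cc r f -> r < `|x| ->
  partial a f x = 0.
Proof.
move=> [_ f0] rx.
have oU : open [set y : 'rV[R]_n | r < `|y|].
  apply: (@open_comp _ _ (fun y : 'rV[R]_n => `|y|) [set s | r < s]) => [y _|].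
    exact: norm_continuous.
  exact: open_gt.
rewrite (@partial_open _ _ _ _ f (fun=> 0) a x oU) //.
exact: derive_cst.
Qed.

(** Differentiation under the integral sign without dominated convergence: by [partial_mvt] the
    difference quotient is a value of the partial derivative nearby, and [Cc_uniform] makes the
    error uniform in [y]. *)
Lemma is_derive_integral_slice n (r : R) (f : 'rV[R]_n.+1 -> R) (t : R) : 0 <= r ->
  Cc r f -> (forall x, derivable f x (basis_vec ord0)) ->
  Cc r (partial ord0 f) ->
  is_derive t 1 (fun s => integral_Rn (fun y => f (cons_vec s y)))
    (integral_Rn (fun y => partial ord0 f (cons_vec t y))).
Proof.
move=> r0 fC fD dfC.
set Phi := fun s : R => _; set l := integral_Rn _.
suff H : h^-1 *: (Phi (h *: 1 + t) - Phi t) @[h --> 0^'] --> l.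
  by split; [apply/cvg_ex; exists l|exact: cvg_lim H].
apply/cvgrPdist_le => /= e e0.
have M0 : 0 < (2 * r) ^+ n + 1 :> R by rewrite ltr_wpDl // exprn_ge0 // mulr_ge0.
have e'0 : 0 < e / ((2 * r) ^+ n + 1) by rewrite divr_gt0.
have /nbhs_ballP[d /= d0 fd] := Cc_uniform dfC e'0.
near=> h.
have h0 : h != 0 by near: h; exact: nbhs_dnbhs_neq.
have hd : `|h| < d by near: h; exact: dnbhs0_lt.
have -> : h *: 1 + t = t + h by rewrite -[h *: 1]/(h * 1) mulr1 addrC.
have C1 := Cc_slice (t + h) fC; have C2 := Cc_slice t fC; have C3 := Cc_slice t dfC.
have -> : l - h^-1 *: (Phi (t + h) - Phi t) = integral_Rn (fun y =>
    partial ord0 f (cons_vec t y) - h^-1 * (f (cons_vec (t + h) y) - f (cons_vec t y))).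
  by rewrite (integral_RnB C3 (CcZ h^-1 (CcB C1 C2))) (integral_RnZ _ (CcB C1 C2))
    (integral_RnB C1 C2).
apply: le_trans (@integral_Rn_le _ r (e / ((2 * r) ^+ n + 1)) _ r0 _ _) _.
- exact: CcB C3 (CcZ h^-1 (CcB C1 C2)).
- move=> y.
  have [c _|c ch] := @partial_mvt _ _ f (cons_vec t y) ord0 h; first exact: fD.
  rewrite cons_vec_add0 => ->; rewrite mulKf // distrC; apply: ltW; apply: fd.
  rewrite -ball_normE /= sub0r normrN.
  exact: le_lt_trans (norm_basis_vec _ _) (le_lt_trans ch hd).
- by rewrite mulrCA ler_piMr ?(ltW e0) // ler_pdivrMr // mul1r lerDl.
Unshelve. all: by end_near. Qed.

(** No exchange of integrals is needed. For a direction other than the first, each slice integral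
    vanishes by induction; for the first, the slice integral of the derivative is the derivative of
    a compactly supported function of one variable. *)
Lemma integral_Rn_partial n (r : R) (f : 'rV[R]_n -> R) a : 0 < r ->
  Cc r f -> (forall x, derivable f x (basis_vec a)) -> continuous (partial a f) ->
  integral_Rn (partial a f) = 0.
Proof.
move=> r0; elim: n f a => [|n IH] f a fC fD dfc; first by case: a fD dfc.
have dfC : Cc r (partial a f) by split=> // x; exact: Cc_partial0.
rewrite integral_RnS; case: (unliftP ord0 a) fD dfc dfC => [j|] -> fD dfc dfC.
  have E (t : R) (y : 'rV[R]_n) : (fun s : R => f (cons_vec t y + s *: basis_vec (lift ord0 j)))
      = (fun s : R => f (cons_vec t (y + s *: basis_vec j))).
    by apply/funext => s; rewrite cons_vec_addl.
  have D (t : R) y : is_derive y (basis_vec j) (fun y => f (cons_vec t y))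
      (partial (lift ord0 j) f (cons_vec t y)).
    apply/is_derive_line0; rewrite -E; apply/is_derive_line0.
    exact: derivableP.
  have -> : (fun t => integral_Rn (fun y => partial (lift ord0 j) f (cons_vec t y))) = fun=> 0.
    apply/funext => t.
    have E' : partial j (fun y => f (cons_vec t y)) =
        (fun y => partial (lift ord0 j) f (cons_vec t y)).
      by apply/funext => y; have [_ <-] := D t y.
    rewrite -E'; apply: IH; first exact: Cc_slice.
      by move=> y; have [] := D t y.
    by rewrite E'; have [] := Cc_slice t dfC.
  by rewrite Rintegral_cst // mul0r.
apply: (@Rintegral_derive_Cc _ r (fun t => integral_Rn (fun y => f (cons_vec t y)))) => //.
- exact: Cc_integral_slice (ltW r0) fC.
- exact: Cc_integral_slice (ltW r0) dfC.
- by move=> t; apply: is_derive_integral_slice (ltW r0) fC fD dfC.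
Qed.

End IteratedIntegral.

(** * Changes of charts *)

Section OpenCongruence.
Context {R : realType} {m n : nat}.

(** Local expressions in different charts agree only on the overlap of the charts, so congruence on
    an open set is the form that is used. *)
Lemma jacobian_open (U : set 'rV[R]_m) (F F' : 'rV[R]_m -> 'rV[R]_n) x :
  open U -> (forall y, U y -> F y = F' y) -> smooth_on U F -> U x ->
  jacobian F x = jacobian F' x.
Proof.
move=> oU FF Fs Ux; have F's : smooth_on U F' by move=> k; exact: Ck_eq FF (Fs k).
apply/matrixP => i j.
apply: etrans (smooth_partial_entry oU Fs i j Ux) _.
apply: etrans _ (esym (smooth_partial_entry oU F's i j Ux)).
by rewrite (partial_open i oU FF Ux).
Qed.

Lemma first_form_open (U : set 'rV[R]_m) (F F' : 'rV[R]_m -> 'rV[R]_n) G x :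
  open U -> (forall y, U y -> F y = F' y) -> smooth_on U F -> U x ->
  first_form G F x = first_form G F' x.
Proof.
by move=> oU FF Fs Ux; rewrite /first_form (jacobian_open oU FF Fs Ux) (FF x Ux).
Qed.

Lemma second_form_open (U : set 'rV[R]_m) (F F' : 'rV[R]_m -> 'rV[R]_n) G N x :
  open U -> (forall y, U y -> F y = F' y) -> U x ->
  second_form G F N x = second_form G F' N x.
Proof.
move=> oU FF Ux; apply/matrixP => a b; rewrite [LHS]mxE [RHS]mxE /cov_along.
have E i y : U y -> partial i F y = partial i F' y.
  by move=> Uy; exact: partial_open oU FF Uy.
have E2 : partial a (partial b F) x = partial a (partial b F') x.
  by apply: (partial_open a oU) => // y Uy; exact: E.
by rewrite (FF x Ux) (E a x Ux) (E b x Ux) E2.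
Qed.

Lemma hessian_open (U : set 'rV[R]_m) (h h' : 'rV[R]_m -> 'M[R]_m) (f f' : 'rV[R]_m -> R) x :
  open U -> (forall y, U y -> h y = h' y) -> (forall y, U y -> f y = f' y) -> U x ->
  hessian h f x = hessian h' f' x.
Proof.
move=> oU hh ff Ux; apply/matrixP => a b.
have E i y : U y -> partial i f y = partial i f' y.
  by move=> Uy; exact: partial_open oU ff Uy.
rewrite [LHS]mxE [RHS]mxE.
have -> : partial a (partial b f) x = partial a (partial b f') x.
  by apply: (partial_open a oU) => // y Uy; exact: E.
congr (_ - _); apply: eq_bigr => k _; rewrite (E k x Ux) -!christoffel_opE.
by rewrite (christoffel_op_open _ _ oU hh Ux).
Qed.

Lemma hessian_cstB (U : set 'rV[R]_m) (h : 'rV[R]_m -> 'M[R]_m) (f : 'rV[R]_m -> R) C x :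
  open U -> Ck 2 U f -> U x -> hessian h (fun y => C - f y) x = - hessian h f x.
Proof.
move=> oU f2 Ux.
have E1 i y : U y -> is_derive y (basis_vec i) (fun z => C - f z) (- partial i f y).
  move=> Uy; have D := derivableP (Ck_derivable (CkW f2) Uy : derivable _ _ (basis_vec i)).
  have D' := is_deriveB (is_derive_cst C y (basis_vec i)) D.
  by apply: (is_derive_eq D'); rewrite sub0r.
have E i y : U y -> partial i (fun z => C - f z) y = - partial i f y.
  by move=> Uy; have [_ H] := E1 i y Uy; exact: H.
apply/matrixP => a b; rewrite [LHS]mxE [RHS]mxE [X in _ = - X]mxE opprB addrC.
have -> : partial a (partial b (fun z => C - f z)) x = - partial a (partial b f) x.
  have D := derivableP (Ck_derivable (Ck_partial b f2) Ux : derivable _ _ (basis_vec a)).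
  have [_ H] := is_deriveN D; apply: etrans _ H.
  by apply: (partial_open a oU) => // y Uy; exact: E.
congr (_ + _); rewrite -sumrN; apply: eq_bigr => k _.
by rewrite (E k x Ux) mulrN opprK.
Qed.

End OpenCongruence.

Section LocalDomain.
Context {R : realType} {m n : nat} {S M : topologicalType}.
Variables (F : S -> M) (u : chart R m S) (c : chart R n M).

Lemma local_dom_open : continuous F -> open (local_dom F u c).
Proof.
move=> Fc; rewrite openE => x [ux cx]; rewrite /interior.
have nu : nbhs x (cimg u) by apply: open_nbhs_nbhs; split=> //; exact: cimg_open.
have nc : nbhs x [set y | cdom c (F (cinv u y))].
  have Fuc : {for x, continuous (F \o cinv u)}.
    by apply: continuous_comp; [exact: cinv_cont|exact: Fc].
  by apply: Fuc; apply: open_nbhs_nbhs; split=> //; exact: cdom_open.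
exact: filterI.
Qed.

Lemma local_rep_img x : local_dom F u c x -> cimg c (local_rep F u c x).
Proof. by move=> [_ cx]; exact: cmap_img. Qed.

Lemma local_dom_chart p : cdom u p -> cdom c (F p) -> local_dom F u c (u p).
Proof. by move=> up cp; split; [exact: cmap_img|rewrite cmapK]. Qed.

Lemma local_rep_chart p : cdom u p -> local_rep F u c (u p) = c (F p).
Proof. by move=> up; rewrite /local_rep cmapK. Qed.

End LocalDomain.

Section AmbientCharts.
Context {R : realType} {n : nat} {M : manifold R n}.
Variable g : metric M.

Lemma metric_riemannian c : atlas M c -> riemannian_on (cimg c) (g c).
Proof.
move=> Mc; split; first exact: cimg_open.
- exact: gmx_smooth.
- by move=> x; exact: gmx_sym.
- by move=> x cx v v0; exact: gmx_pos.
Qed.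

Context (c d : chart R n M).
Hypotheses (Mc : atlas M c) (Md : atlas M d).
Let V := local_dom idfun c d.
Let tau := local_rep idfun c d.

Lemma transition_open : open V.
Proof. by apply: local_dom_open => x; exact: cvg_id. Qed.

Lemma transition_smooth : smooth_on V tau.
Proof. exact: atlas_compat. Qed.

Lemma transition_img y : V y -> cimg d (tau y).
Proof. exact: local_rep_img. Qed.

Lemma transition_metric y : V y -> g c y = first_form (g d) tau y.
Proof. by move=> Vy; exact: gmx_compat. Qed.

(** Read off the transformation law of the metric: its left-hand side is invertible, hence so is the
    jacobian factor. *)
Lemma transition_free y : V y -> row_free (jacobian tau y).
Proof.
move=> Vy; have [cy _] := Vy.
have := riemannian_unit (metric_riemannian Mc) cy.
by rewrite transition_metric // row_free_unit /first_form !unitmx_mul => /andP[/andP[]].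
Qed.

Lemma hessian_chart_transition (f : M -> R) y : smooth_fun f -> V y ->
  hessian (g c) (f \o cinv c) y =
  jacobian tau y *m hessian (g d) (f \o cinv d) (tau y) *m (jacobian tau y)^T.
Proof.
move=> fs Vy.
rewrite -(hessian_transition (metric_riemannian Md) transition_open transition_img
  transition_smooth transition_free transition_metric Vy (fs d Md 2)).
apply: (hessian_open transition_open) => // z [cz dz] /=.
by rewrite /tau /local_rep cmapK.
Qed.

End AmbientCharts.

Section ImmersionCharts.
Context {R : realType} {m n : nat} {S : manifold R m} {M : manifold R n}.
Variables (g : metric M) (F : immersion S M).
Implicit Types (u v : chart R m S) (c d : chart R n M).

Lemma imm_continuous : continuous F.
Proof. by have [] := imm_smooth F. Qed.

Lemma rep_open u c : open (local_dom F u c).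
Proof. exact/local_dom_open/imm_continuous. Qed.

Lemma rep_smooth u c : atlas S u -> atlas M c ->
  smooth_on (local_dom F u c) (local_rep F u c).
Proof. by have [_ Fs] := imm_smooth F; exact: Fs. Qed.

(** With one fixed ambient chart this is smooth by construction, whereas [induced_metric] picks an
    ambient chart at each point. *)
Definition chart_metric u c : 'rV[R]_m -> 'M[R]_m := first_form (g c) (local_rep F u c).

Lemma chart_metric_riemannian u c : atlas S u -> atlas M c ->
  riemannian_on (local_dom F u c) (chart_metric u c).
Proof.
move=> Su Mc.
have Jf x : local_dom F u c x -> row_free (jacobian (local_rep F u c) x).
  by move=> Lx; exact: imm_free.
exact: (first_form_riemannian (metric_riemannian g Mc) (@rep_open u c)
  (@local_rep_img _ _ _ _ _ F u c) (rep_smooth Su Mc) Jf).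
Qed.

Section AmbientChange.
Context (u : chart R m S) (c d : chart R n M).
Hypotheses (Su : atlas S u) (Mc : atlas M c) (Md : atlas M d).
Let U := local_dom F u c `&` local_dom F u d.
Let tau := local_rep idfun c d.

Let oU : open U. Proof. by apply: openI; exact: rep_open. Qed.

Let rep_transition y : U y -> local_rep F u d y = (tau \o local_rep F u c) y.
Proof. by move=> [[uy cy] _]; rewrite /tau /local_rep /= cmapK. Qed.

Let rep_dom y : U y -> local_dom idfun c d (local_rep F u c y).
Proof.
move=> [[uy cy] [_ dy]]; split; first exact: cmap_img.
by rewrite /local_rep cmapK.
Qed.

Let Us : smooth_on U (local_rep F u c).
Proof. by move=> k; apply: Ck_sub (rep_smooth Su Mc k) => y []. Qed.

Let Us' : smooth_on U (local_rep F u d).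
Proof. by move=> k; apply: Ck_sub (rep_smooth Su Md k) => y []. Qed.

Lemma chart_metric_change x : local_dom F u c x -> local_dom F u d x ->
  chart_metric u d x = chart_metric u c x.
Proof.
move=> cx dx; have Ux : U x by split.
rewrite /chart_metric (first_form_open _ oU rep_transition Us' Ux).
exact: (first_form_transition (@transition_open _ _ M c d) (transition_smooth Mc Md)
  (@transition_metric _ _ _ g _ _ Mc Md) oU rep_dom Us Ux).
Qed.

Lemma second_form_change N x : local_dom F u c x -> local_dom F u d x ->
  second_form (g d) (local_rep F u d) (N *m jacobian tau (local_rep F u c x)) x
  = second_form (g c) (local_rep F u c) N x.
Proof.
move=> cx dx; have Ux : U x by split.
rewrite (second_form_open _ _ oU rep_transition Ux).
exact: (second_form_transition (metric_riemannian g Md) (@transition_open _ _ M c d)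
  (@transition_img _ _ M c d) (transition_smooth Mc Md)
  (transition_free g Mc Md) (@transition_metric _ _ _ g _ _ Mc Md) oU rep_dom Us N Ux).
Qed.

End AmbientChange.

Section SourceChange.
Context (u v : chart R m S) (c : chart R n M).
Hypotheses (Su : atlas S u) (Sv : atlas S v) (Mc : atlas M c).
Let W := local_dom idfun u v `&` local_dom F u c.
Let sigma := local_rep idfun u v.

Let oW : open W.
Proof. by apply: openI; [exact: transition_open|exact: rep_open]. Qed.

Let rep_reparam y : W y -> local_rep F u c y = (local_rep F v c \o sigma) y.
Proof. by move=> [[uy vy] _]; rewrite /sigma /local_rep /= cmapK. Qed.

Let sigma_dom y : W y -> local_dom F v c (sigma y).
Proof.
move=> [[uy vy] [_ cy]]; split; first exact: cmap_img.
by rewrite /sigma /local_rep /= cmapK.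
Qed.

Let sigmas : smooth_on W sigma.
Proof. by move=> k; apply: Ck_sub (transition_smooth Su Sv k) => y []. Qed.

Let reps : smooth_on W (local_rep F u c).
Proof. by move=> k; apply: Ck_sub (rep_smooth Su Mc k) => y []. Qed.

Lemma chart_metric_reparam x : local_dom idfun u v x -> local_dom F u c x ->
  chart_metric u c x =
  jacobian sigma x *m chart_metric v c (sigma x) *m (jacobian sigma x)^T.
Proof.
move=> vx cx; have Wx : W x by split.
rewrite /chart_metric (first_form_open _ oW rep_reparam reps Wx).
exact: (first_form_reparam _ oW (@rep_open v c) sigma_dom sigmas (rep_smooth Sv Mc) Wx).
Qed.

Lemma source_jacobian_unit x : local_dom idfun u v x -> local_dom F u c x ->
  jacobian sigma x \in unitmx.
Proof.
move=> vx cx; have := riemannian_unit (chart_metric_riemannian Su Mc) cx.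
by rewrite chart_metric_reparam // !unitmx_mul => /andP[/andP[]].
Qed.

Lemma second_form_source_change N x : local_dom idfun u v x -> local_dom F u c x ->
  (forall k, bilin (g c (local_rep F u c x)) (partial k (local_rep F v c) (sigma x)) N = 0) ->
  second_form (g c) (local_rep F u c) N x =
  jacobian sigma x *m second_form (g c) (local_rep F v c) N (sigma x)
  *m (jacobian sigma x)^T.
Proof.
move=> vx cx FN; have Wx : W x by split.
rewrite (second_form_open _ _ oW rep_reparam Wx).
apply: (second_form_reparam oW (@rep_open v c) sigma_dom sigmas (rep_smooth Sv Mc) Wx).
by move=> k; rewrite -[local_rep F v c (sigma x)]/((local_rep F v c \o sigma) x) -rep_reparam.
Qed.

Lemma grad_row_source_change (chi : S -> R) x : Ck 1 (cimg v) (chi \o cinv v) ->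
  local_dom idfun u v x -> 
  grad_row (chi \o cinv u) x = grad_row (chi \o cinv v) (sigma x) *m (jacobian sigma x)^T.
Proof.
move=> chi1 vx; have oV : open (local_dom idfun u v) by exact: transition_open.
have sD := smooth_differentiable oV (transition_smooth Su Sv) vx.
have vs : cimg v (sigma x) by exact: local_rep_img.
have cD : differentiable (chi \o cinv v) (sigma x).
  by apply: Ck1_differentiable chi1; [exact: cimg_open|].
rewrite -(grad_comp sD cD); apply/rowP => a; rewrite [LHS]mxE [RHS]mxE.
by apply: (partial_open a oV) => // y [uy vy] /=; rewrite /sigma /local_rep cmapK.
Qed.

End SourceChange.
End ImmersionCharts.

(** * Regularity of Hessians and second fundamental forms *)

Section CkCurvature.
Context {R : realType}.

Lemma Ck_trace n m k (U : set 'rV[R]_n) (A : 'rV[R]_n -> 'M[R]_m) :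
  open U -> Ck k U A -> Ck k U (fun x => \tr (A x)).
Proof.
by move=> oU /(Ck_mxP _ _ oU) Ak; apply: Ck_sum => // i _.
Qed.

Context {n : nat} (V : set 'rV[R]_n) (G : 'rV[R]_n -> 'M[R]_n).
Hypothesis HG : riemannian_on V G.

Lemma Ck_christoffel k a i j : Ck k V (christoffel G a i j).
Proof.
have [oV Gs _ _] := HG.
have dG p q r : Ck k V (partial p (fun y => G y q r)).
  by have /(Ck_mxP _ _ oV) /(_ q r) H := Gs k.+1; exact: Ck_partial.
have iG p q : Ck k V (fun x => invmx (G x) p q).
  by have /(Ck_mxP _ _ oV) := Ck_inv_metric HG k; apply.
apply: CkM => //; first exact: Ck_cst.
apply: Ck_sum => // l _; apply: CkM => //.
by apply: CkB => //; apply: CkD.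
Qed.

Lemma Ck_hessian k (f : 'rV[R]_n -> R) : Ck k.+2 V f -> Ck k V (hessian G f).
Proof.
have [oV _ _ _] := HG; move=> fk; apply/(Ck_mxP _ _ oV) => i j.
apply: (@Ck_eq _ _ _ _ _ (fun x => partial i (partial j f) x
    - \sum_k christoffel G k i j x * partial k f x)) => //.
  by move=> x _; rewrite mxE.
apply: CkB => //; first exact: Ck_partial (Ck_partial j fk).
apply: Ck_sum => // l _; apply: CkM => //; first exact: Ck_christoffel.
exact: CkW (Ck_partial l fk).
Qed.

Context {m : nat} (U : set 'rV[R]_m) (F : 'rV[R]_m -> 'rV[R]_n).
Hypotheses (oU : open U) (UV : forall x, U x -> V (F x)) (Fs : smooth_on U F).

Lemma Ck_second_form k (N : 'rV[R]_m -> 'rV[R]_n) : Ck k U N ->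
  Ck k U (fun x => second_form G F (N x) x).
Proof.
have [oV _ _ _] := HG; move=> Nk; apply/(Ck_mxP _ _ oU) => a b.
apply: (@Ck_eq _ _ _ _ _ (fun x => bilin (G (F x)) (cov_along G F a (partial b F) x) (N x))) => //.
  by move=> x _; rewrite mxE.
apply: Ck_bilin => //; first exact: (smooth_metric_comp HG oU UV Fs k).
apply: CkD => //; first exact: Ck_partial (Ck_partial b (Fs k.+2)).
apply/(Ck_mxP _ _ oU) => i l.
apply: (@Ck_eq _ _ _ _ _ (fun x => \sum_p \sum_q christoffel G l p q (F x)
    * partial a F x 0 p * partial b F x 0 q)) => //.
  by move=> x _; rewrite mxE.
have dF c p : Ck k U (fun x => partial c F x 0 p).
  by have /(Ck_mxP _ _ oU) := Ck_partial c (Fs k.+1); apply.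
apply: Ck_sum => // p _; apply: Ck_sum => // q _; apply: CkM => //; apply: CkM => //.
exact: Ck_comp oU oV UV (Ck_christoffel k l p q) (Fs k).
Qed.

End CkCurvature.

Section PointwiseQuantities.
Context {R : realType} {m : nat} {M : manifold R m.+1} {S : manifold R m}.
Variables (g : metric M) (F : immersion S M) (nu : unit_normal g F).
Implicit Types (u v : chart R m S) (c d : chart R m.+1 M) (chi psi : S -> R).

Definition C1_fun chi := forall u, atlas S u -> Ck 1 (cimg u) (chi \o cinv u).

Definition grad_pair u c chi psi (x : 'rV[R]_m) : R :=
  bilin (invmx (chart_metric g F u c x)) (grad_row (chi \o cinv u) x)
    (grad_row (psi \o cinv u) x).

Definition second_form_sq u c (x : 'rV[R]_m) : R :=
  second_form_sqnorm (g c) (local_rep F u c) (nu c (cinv u x)) x.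

(** Changing the ambient chart does not alter the induced metric; changing the source chart acts on
    it by a congruence, which [bilin_invmx_congruence] absorbs. *)
Lemma grad_pair_change u v c d chi psi p : C1_fun chi -> C1_fun psi ->
  atlas S u -> atlas S v -> atlas M c -> atlas M d ->
  cdom u p -> cdom v p -> cdom c (F p) -> cdom d (F p) ->
  grad_pair u c chi psi (u p) = grad_pair v d chi psi (v p).
Proof.
move=> chi1 psi1 Su Sv Mc Md up vp cp dp.
have Lc : local_dom F u c (u p) := local_dom_chart up cp.
have Lvc : local_dom F v c (v p) := local_dom_chart vp cp.
have Lvd : local_dom F v d (v p) := local_dom_chart vp dp.
have Vp : local_dom idfun u v (u p) := @local_dom_chart _ _ _ _ _ idfun u v p up vp.
have sp : local_rep idfun u v (u p) = v p := @local_rep_chart _ _ _ _ _ idfun u v p up.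
rewrite /grad_pair (chart_metric_change g Sv Mc Md Lvc Lvd).
rewrite (chart_metric_reparam g Su Sv Mc Vp Lc).
rewrite (grad_row_source_change Su Sv (chi1 v Sv) Vp).
rewrite (grad_row_source_change Su Sv (psi1 v Sv) Vp) sp.
apply: bilin_invmx_congruence; first exact: (source_jacobian_unit g Su Sv Mc Vp Lc).
exact: (riemannian_unit (chart_metric_riemannian g F Sv Mc) Lvc).
Qed.

Lemma second_form_sq_change u v c d p :
  atlas S u -> atlas S v -> atlas M c -> atlas M d ->
  cdom u p -> cdom v p -> cdom c (F p) -> cdom d (F p) ->
  second_form_sq u c (u p) = second_form_sq v d (v p).
Proof.
move=> Su Sv Mc Md up vp cp dp.
have Lc : local_dom F u c (u p) := local_dom_chart up cp.
have Lvc : local_dom F v c (v p) := local_dom_chart vp cp.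
have Lvd : local_dom F v d (v p) := local_dom_chart vp dp.
have Vp : local_dom idfun u v (u p) := @local_dom_chart _ _ _ _ _ idfun u v p up vp.
have sp : local_rep idfun u v (u p) = v p := @local_rep_chart _ _ _ _ _ idfun u v p up.
rewrite /second_form_sq !cmapK // (nvec_compat nu Mc Md cp dp).
have E := second_form_change g Sv Mc Md (nu c p) Lvc Lvd.
rewrite local_rep_chart // in E.
rewrite /second_form_sqnorm E -!/(chart_metric _ _ _ _ _).
rewrite (chart_metric_change g Sv Mc Md Lvc Lvd).
have FN k : bilin (g c (local_rep F u c (u p)))
    (partial k (local_rep F v c) (local_rep idfun u v (u p))) (nu c p) = 0.
  have := nvec_normal nu k Sv Mc Lvc.
  by rewrite sp !local_rep_chart // cmapK.
rewrite (second_form_source_change Su Sv Mc Vp Lc FN).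
rewrite (chart_metric_reparam g Su Sv Mc Vp Lc) sp.
apply: trace_congruence; first exact: (source_jacobian_unit g Su Sv Mc Vp Lc).
exact: (riemannian_unit (chart_metric_riemannian g F Sv Mc) Lvc).
Qed.

End PointwiseQuantities.

Lemma trace_inv_congruence (R : realType) n (J B A : 'M[R]_n) :
  J \in unitmx -> B \in unitmx ->
  \tr (invmx (J *m B *m J^T) *m (J *m A *m J^T)) = \tr (invmx B *m A).
Proof.
move=> Ju Bu; rewrite invmx_congruence // !mulmxA mulmxKV //.
by rewrite trmx_inv -!mulmxA mxtrace_mulC !mulmxA mulmxK // unitmx_tr.
Qed.

Section SourceFunctions.
Context {R : realType} {m : nat} {M : manifold R m.+1} {S : manifold R m}.
Variables (g : metric M) (F : immersion S M) (nu : unit_normal g F).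
Implicit Types (u v : chart R m S) (c d : chart R m.+1 M) (chi psi : S -> R).

(** A function on the whole of S. The charts used jump with [p]; [gradSE] recovers a fixed smooth
    expression near each point. The next three definitions follow the same scheme. *)
Definition gradS chi psi p := let u := chart_at S p in
  grad_pair g F u (chart_at M (F p)) chi psi (u p).

Definition second_form_sqS p := let u := chart_at S p in
  second_form_sq nu u (chart_at M (F p)) (u p).

Definition ricS p := ric_normal nu (chart_at M (F p)) p.

Definition scalS (p : S) := let c := chart_at M (F p) in
  scalar_curv (g c) (c (F p)).

Let Sat p : atlas S (chart_at S p). Proof. exact: chart_at_atlas. Qed.
Let Mat p : atlas M (chart_at M p). Proof. exact: chart_at_atlas. Qed.
Let Sdom p : cdom (chart_at S p) p. Proof. exact: chart_at_dom. Qed.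
Let Mdom p : cdom (chart_at M p) p. Proof. exact: chart_at_dom. Qed.

Lemma gradSE u c chi psi x : C1_fun chi -> C1_fun psi -> atlas S u -> atlas M c ->
  local_dom F u c x -> gradS chi psi (cinv u x) = grad_pair g F u c chi psi x.
Proof.
move=> chi1 psi1 Su Mc [ux cx]; rewrite -[in RHS](cinvK ux) /gradS.
by apply: grad_pair_change => //; exact: cinv_dom.
Qed.

Lemma second_form_sqSE u c x : atlas S u -> atlas M c ->
  local_dom F u c x -> second_form_sqS (cinv u x) = second_form_sq nu u c x.
Proof.
move=> Su Mc [ux cx]; rewrite -[in RHS](cinvK ux) /second_form_sqS.
by apply: second_form_sq_change => //; exact: cinv_dom.
Qed.

(** Continuity is tested where a chart of S and a chart of M are both available, since the local
    formulas involve both. *)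
Lemma continuous_charts (q : S -> R) :
  (forall u c, atlas S u -> atlas M c -> Ck 0 (local_dom F u c) (q \o cinv u)) ->
  continuous q.
Proof.
move=> qc p; pose u := chart_at S p; pose c := chart_at M (F p).
have Lp : local_dom F u c (u p) := local_dom_chart (Sdom p) (Mdom (F p)).
have qup : {for u p, continuous (q \o cinv u)}.
  exact: Ck_cont (qc u c (Sat p) (Mat _)) Lp.
have quc : {for p, continuous ((q \o cinv u) \o u)}.
  apply: (@continuous_comp _ _ _ u (q \o cinv u) p); last exact: qup.
  by apply: cmap_cont; exact: Sdom.
apply: (@continuous_open _ _ (cdom u) ((q \o cinv u) \o u)) => //.
- exact: cdom_open.
- by move=> y uy /=; rewrite cmapK.
- exact: Sdom.
Qed.

Lemma gradS_continuous chi psi : C1_fun chi -> C1_fun psi -> continuous (gradS chi psi).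
Proof.
move=> chi1 psi1; apply: continuous_charts => u c Su Mc.
have oL := @rep_open R m m.+1 S M F u c.
have LU : local_dom F u c `<=` cimg u by move=> x [].
have E x : local_dom F u c x ->
    grad_pair g F u c chi psi x = (gradS chi psi \o cinv u) x.
  by move=> Lx /=; rewrite (gradSE chi1 psi1 Su Mc Lx).
have Hh := chart_metric_riemannian g F Su Mc.
have K : Ck 0 (local_dom F u c) (grad_pair g F u c chi psi) :=
  Ck_bilin oL (Ck_inv_metric Hh 0) (Ck_grad_row Hh (Ck_sub LU (chi1 u Su)))
    (Ck_grad_row Hh (Ck_sub LU (psi1 u Su))).
exact: (Ck_eq oL E K).
Qed.

Lemma second_form_sqS_continuous : continuous second_form_sqS.
Proof.
apply: continuous_charts => u c Su Mc.
have oL := @rep_open R m m.+1 S M F u c.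
have E x : local_dom F u c x ->
    second_form_sq nu u c x = (second_form_sqS \o cinv u) x.
  by move=> Lx /=; rewrite (second_form_sqSE Su Mc Lx).
have Hh := chart_metric_riemannian g F Su Mc.
have A0 : Ck 0 (local_dom F u c)
    (fun x => second_form (g c) (local_rep F u c) (nu c (cinv u x)) x).
  apply: (Ck_second_form (metric_riemannian g Mc) oL _ (rep_smooth F Su Mc)).
    exact: local_rep_img.
  exact: (nvec_smooth nu Su Mc).
have i0 := Ck_inv_metric Hh 0.
have K : Ck 0 (local_dom F u c) (second_form_sq nu u c) :=
  Ck_trace oL (Ck_mulmx oL (Ck_mulmx oL (Ck_mulmx oL i0 A0) i0) (Ck_trmx oL A0)).
exact: (Ck_eq oL E K).
Qed.

(** * Consequences of the soliton equation along the hypersurface *)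

Variables (f : M -> R) (lambda : R).
Hypothesis fs : smooth_fun f.
Hypothesis soliton : forall c x, atlas M c -> cimg c x ->
  ricci (g c) x + hessian (g c) (f \o cinv c) x = lambda *: g c x.

Lemma ricci_soliton c y : atlas M c -> cimg c y ->
  ricci (g c) y = lambda *: g c y - hessian (g c) (f \o cinv c) y.
Proof. by move=> Mc cy; rewrite -soliton // addrK. Qed.

Lemma ric_normalE c p : atlas M c -> cdom c (F p) -> ric_normal nu c p =
  lambda - bilin (hessian (g c) (f \o cinv c) (c (F p))) (nu c p) (nu c p).
Proof.
move=> Mc cp; rewrite /ric_normal ricci_soliton //; last exact: cmap_img.
by rewrite bilinBm bilinZm nvec_unit // mulr1.
Qed.

Lemma scalar_curvE c y : atlas M c -> cimg c y -> scalar_curv (g c) y =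
  m.+1%:R * lambda - \tr (invmx (g c y) *m hessian (g c) (f \o cinv c) y).
Proof.
move=> Mc cy; rewrite /scalar_curv ricci_soliton // mulmxBr linearB /=.
rewrite -scalemxAr mulVmx; last exact: (riemannian_unit (metric_riemannian g Mc) cy).
by rewrite mxtraceZ mxtrace1 mulrC.
Qed.

Lemma ric_normal_change c d p : atlas M c -> atlas M d -> cdom c (F p) -> cdom d (F p) ->
  ric_normal nu c p = ric_normal nu d p.
Proof.
move=> Mc Md cp dp; rewrite !ric_normalE //; congr (_ - _).
have Vp : local_dom idfun c d (c (F p)) := @local_dom_chart _ _ _ _ _ idfun c d _ cp dp.
have sp : local_rep idfun c d (c (F p)) = d (F p) := @local_rep_chart _ _ _ _ _ idfun c d _ cp.
rewrite (hessian_chart_transition g Mc Md fs Vp) bilin_mulmx sp.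
by rewrite (nvec_compat nu Mc Md cp dp).
Qed.

Lemma scalar_curv_change c d q : atlas M c -> atlas M d -> cdom c q -> cdom d q ->
  scalar_curv (g c) (c q) = scalar_curv (g d) (d q).
Proof.
move=> Mc Md cp dp; rewrite (scalar_curvE Mc (cmap_img cp)) (scalar_curvE Md (cmap_img dp)).
apply: (congr1 (fun z => _ - z)).
have Vp : local_dom idfun c d (c q) := @local_dom_chart _ _ _ _ _ idfun c d _ cp dp.
have sp : local_rep idfun c d (c q) = d q := @local_rep_chart _ _ _ _ _ idfun c d _ cp.
have Ju : jacobian (local_rep idfun c d) (c q) \in unitmx.
  by rewrite -row_free_unit; exact: (transition_free g Mc Md Vp).
have Gu : g d (d q) \in unitmx.
  by apply: (riemannian_unit (metric_riemannian g Md)); exact: cmap_img.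
rewrite (hessian_chart_transition g Mc Md fs Vp) (transition_metric g Mc Md Vp).
by rewrite /first_form sp; exact: trace_inv_congruence.
Qed.

Lemma ricSE u c x : atlas S u -> atlas M c -> local_dom F u c x ->
  ricS (cinv u x) = ric_normal nu c (cinv u x).
Proof. by move=> Su Mc [ux cx]; apply: ric_normal_change. Qed.

Lemma scalSE u c x : atlas S u -> atlas M c -> local_dom F u c x ->
  scalS (cinv u x) = scalar_curv (g c) (local_rep F u c x).
Proof. by move=> Su Mc [ux cx]; apply: scalar_curv_change. Qed.

Lemma scalS_continuous : continuous scalS.
Proof.
apply: continuous_charts => u c Su Mc.
have oL := @rep_open R m m.+1 S M F u c.
have HG := metric_riemannian g Mc; have [oV _ _ _] := HG.
have LV : forall x, local_dom F u c x -> cimg c (local_rep F u c x) by exact: local_rep_img.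
pose q y := m.+1%:R * lambda - \tr (invmx (g c y) *m hessian (g c) (f \o cinv c) y).
have E x : local_dom F u c x -> (q \o local_rep F u c) x = (scalS \o cinv u) x.
  by move=> Lx /=; rewrite (scalSE Su Mc Lx) (scalar_curvE Mc (LV x Lx)).
have k1 := Ck_trace oV (Ck_mulmx oV (Ck_inv_metric HG 0) (Ck_hessian HG (fs Mc 2))).
have k2 := CkB oV (@Ck_cst R m.+1 R 0 (cimg c) (m.+1%:R * lambda)) k1.
exact: (Ck_eq oL E (Ck_comp oL oV LV k2 (rep_smooth F Su Mc 0))).
Qed.

Variable C : R.

Definition test_fun (p : S) := C - f (F p).

Lemma test_fun_rep u c x : local_dom F u c x ->
  (test_fun \o cinv u) x = ((fun y => C - (f \o cinv c) y) \o local_rep F u c) x.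
Proof. by move=> [ux cx]; rewrite /test_fun /local_rep /= cmapK. Qed.

Lemma test_fun_smooth : smooth_fun test_fun.
Proof.
move=> u Su k; apply: Ck_local => x ux; pose c := chart_at M (F (cinv u x)).
have Mc : atlas M c by exact: Mat.
have oL := @rep_open R m m.+1 S M F u c.
have Lx : local_dom F u c x by split=> //; exact: Mdom.
exists (local_dom F u c); split=> //.
apply: (Ck_eq oL (fun y Ly => esym (test_fun_rep Ly))).
have oV : open (cimg c) by exact: cimg_open.
apply: (Ck_comp oL oV (@local_rep_img _ _ _ _ _ F u c) _ (rep_smooth F Su Mc k)).
exact: (CkB oV (@Ck_cst R m.+1 R k (cimg c) C) (fs Mc k)).
Qed.

Lemma test_fun_C1 : C1_fun test_fun.
Proof. by move=> u Su; exact: test_fun_smooth. Qed.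

Hypothesis hmin : minimal nu.

(** By minimality the Laplacian of [f] along S is its ambient Laplacian minus [Hess f (nu, nu)]. The
    soliton equation gives n lambda - R for the former and lambda - Ric(nu, nu) for the latter, with
    n = [m.+1]; the sign changes because the test function is [C - f]. *)
Lemma test_fun_laplacian u c x : atlas S u -> atlas M c -> local_dom F u c x ->
  \tr (invmx (chart_metric g F u c x) *m
    hessian (chart_metric g F u c) (test_fun \o cinv u) x) =
  scalS (cinv u x) - (m.+1%:R - 1) * lambda - ricS (cinv u x).
Proof.
move=> Su Mc Lx.
have oL := @rep_open R m m.+1 S M F u c.
have HG := metric_riemannian g Mc.
have Lv y : local_dom F u c y -> cimg c (local_rep F u c y) by exact: local_rep_img.
have Lf : forall y, local_dom F u c y -> row_free (jacobian (local_rep F u c) y).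
  by move=> y Ly; exact: imm_free.
have cp : cdom c (F (cinv u x)) by case: Lx.
have NN : bilin (g c (local_rep F u c x)) (nu c (cinv u x)) (nu c (cinv u x)) = 1.
  exact: nvec_unit.
have FN a : bilin (g c (local_rep F u c x)) (partial a (local_rep F u c) x)
    (nu c (cinv u x)) = 0 by exact: (nvec_normal nu a Su Mc Lx).
have f2 : Ck 2 (cimg c) (f \o cinv c) by exact: fs.
have oV : open (cimg c) by exact: cimg_open.
have Cf2 : Ck 2 (cimg c) (fun y => C - (f \o cinv c) y).
  exact: (CkB oV (@Ck_cst R m.+1 R 2 (cimg c) C) f2).
apply: etrans (congr1 (fun H => \tr (_ *m H))
  (hessian_open oL (fun=> fun=> erefl) (@test_fun_rep u c) Lx)) _.
apply: etrans (hypersurface_laplacian HG oL Lv (rep_smooth F Su Mc) Lf Lx NN FN Cf2) _.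
rewrite hmin // mulr0 addr0 (hessian_cstB _ C oV f2 (Lv x Lx)).
rewrite (scalSE Su Mc Lx) (ricSE Su Mc Lx) (scalar_curvE Mc (Lv x Lx)) (ric_normalE Mc cp).
rewrite -[c (F (cinv u x))]/(local_rep F u c x) mulmxN linearN /=.
have -> : bilin (- hessian (g c) (f \o cinv c) (local_rep F u c x))
    (nu c (cinv u x)) (nu c (cinv u x)) =
    - bilin (hessian (g c) (f \o cinv c) (local_rep F u c x))
    (nu c (cinv u x)) (nu c (cinv u x)) by rewrite -scaleN1r bilinZm mulN1r.
by ring.
Qed.

End SourceFunctions.

(** * Volume measures and the divergence theorem *)

Section BorelContinuous.
Context {R : realType} {S : ptopologicalType}.

Lemma continuous_borel_measurable (q : S -> R) : continuous q ->
  measurable_fun [set: borel S] (q : borel S -> R).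
Proof.
move=> qc; apply: (measurability _ (RGenOInfty.measurableE R)) => _ [_ [a ->] <-].
rewrite setTI; apply: sub_sigma_algebra.
by move/continuousP: qc; apply; rewrite set_itvE; exact: open_gt.
Qed.

End BorelContinuous.

Section CompactChart.
Context {R : realType} {m : nat} {S : topologicalType}.
Variables (u : chart R m S) (K : set S).
Hypotheses (cK : compact K) (Ku : K `<=` cdom u).

Definition chart_image : set 'rV[R]_m := [set x | cimg u x /\ K (cinv u x)].

Lemma chart_image_compact : compact chart_image.
Proof.
have -> : chart_image = u @` K.
  apply/seteqP; split=> x /=.
    by move=> [ux Kx]; exists (cinv u x) => //; rewrite cinvK.
  by move=> [p Kp <-]; split; [exact/cmap_img/Ku|rewrite cmapK //; exact: Ku].
apply: continuous_compact => //; apply: continuous_in_subspaceT => p /set_mem Kp.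
by apply: cmap_cont; exact: Ku.
Qed.

Lemma chart_image_closed : closed chart_image.
Proof. by apply: compact_closed => //; exact: chart_image_compact. Qed.

Lemma chart_image_bounded : exists2 r : R, 0 < r & forall x, chart_image x -> `|x| <= r.
Proof.
have [r [_ rb]] := compact_bounded chart_image_compact.
exists (`|r| + 1); first by rewrite ltr_wpDl.
by move=> x Ax; apply: rb => //; rewrite (le_lt_trans (ler_norm r)) // ltrDl.
Qed.

(** Extension by zero is continuous: a compact image is closed in the whole coordinate space, so a
    point outside [cimg u] has a neighbourhood where [q] vanishes. *)
Lemma chart_image_Cc (r : R) (q : 'rV[R]_m -> R) :
  (forall x, chart_image x -> `|x| <= r) ->
  (forall x, cimg u x -> {for x, continuous q}) ->
  (forall x, ~ chart_image x -> q x = 0) -> Cc r q.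
Proof.
move=> rb qc q0; split=> [x|x rx]; last first.
  by apply: q0 => /rb; rewrite leNgt rx.
have [ux|nux] := pselect (cimg u x); first exact: qc.
have oA : open (~` chart_image) by apply: closed_openC; exact: chart_image_closed.
apply: (@continuous_open _ _ (~` chart_image) (fun=> 0) q) => //.
- by move=> y nA; rewrite q0.
- by move=> [].
- exact: cst_continuous.
Qed.

End CompactChart.

Lemma chart_image_open (R : realType) (m : nat) (S : topologicalType)
    (v : chart R m S) (A : set S) : open A -> open (chart_image v A).
Proof.
move=> oA; rewrite openE => y [vy Ay]; rewrite /interior.
have nv : nbhs y (cimg v) by apply: open_nbhs_nbhs; split=> //; exact: cimg_open.
have nk : nbhs y [set z | A (cinv v z)].
  by apply: (cinv_cont vy); exact: open_nbhs_nbhs.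
exact: filterI.
Qed.

Section InducedMetric.
Context {R : realType} {m : nat} {M : manifold R m.+1} {S : manifold R m}.
Variables (g : metric M) (F : immersion S M).
Implicit Types (u : chart R m S) (c : chart R m.+1 M).

(** Transfers smoothness and positivity from [chart_metric], where the ambient chart is fixed, to
    [induced_metric]. *)
Lemma induced_metricE u c x : atlas S u -> atlas M c -> local_dom F u c x ->
  induced_metric g F u x = chart_metric g F u c x.
Proof.
move=> Su Mc Lx; have [ux cx] := Lx.
have Md : atlas M (chart_at M (F (cinv u x))) by exact: chart_at_atlas.
apply: (chart_metric_change g Su Mc Md Lx).
by split=> //; exact: chart_at_dom.
Qed.

Lemma local_dom_chart_at u x : cimg u x -> local_dom F u (chart_at M (F (cinv u x))) x.
Proof. by move=> ux; split=> //; exact: chart_at_dom. Qed.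

Lemma induced_metric_riemannian u : atlas S u ->
  riemannian_on (cimg u) (induced_metric g F u).
Proof.
move=> Su; split; first exact: cimg_open.
- move=> k; apply: Ck_local => x ux; pose c := chart_at M (F (cinv u x)).
  have Mc : atlas M c by exact: chart_at_atlas.
  exists (local_dom F u c); split; first exact: local_dom_chart_at.
  have [oL hs _ _] := chart_metric_riemannian g F Su Mc.
  by apply: Ck_eq oL _ (hs k) => y Ly; rewrite (induced_metricE Su Mc Ly).
- move=> x ux; have Lx := local_dom_chart_at ux.
  have [_ _ hT _] := chart_metric_riemannian g F Su (chart_at_atlas (F (cinv u x))).
  exact: hT Lx.
- move=> x ux; have Lx := local_dom_chart_at ux.
  have [_ _ _ hp] := chart_metric_riemannian g F Su (chart_at_atlas (F (cinv u x))).
  exact: hp Lx.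
Qed.

End InducedMetric.

Section VolumeIntegral.
Context {R : realType} {m : nat} {M : manifold R m.+1} {S : manifold R m}.
Variables (g : metric M) (F : immersion S M).
Variable mu : {measure set (borel S) -> \bar R}.
Hypothesis hmu : volume_measure (induced_metric g F) mu.
Context (u : chart R m S) (K : set S).
Hypotheses (Su : atlas S u) (cK : compact K) (Ku : K `<=` cdom u).

Definition chart_density (psi : S -> R) : 'rV[R]_m -> R :=
  (fun x => psi (cinv u x) * Num.sqrt (\det (induced_metric g F u x))) \_ (cimg u).

Lemma chart_densityE psi x : cimg u x ->
  chart_density psi x = psi (cinv u x) * Num.sqrt (\det (induced_metric g F u x)).
Proof. by move=> ux; rewrite /chart_density /patch mem_set. Qed.

Lemma chart_density_out psi x : (forall p, ~ K p -> psi p = 0) ->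
  ~ chart_image u K x -> chart_density psi x = 0.
Proof.
move=> psi0 nA; rewrite /chart_density /patch; case: ifPn => // /set_mem ux.
by rewrite psi0 ?mul0r // => Kx; apply: nA.
Qed.

Lemma chart_density_Cc (r : R) psi : (forall x, chart_image u K x -> `|x| <= r) ->
  continuous psi -> (forall p, ~ K p -> psi p = 0) -> Cc r (chart_density psi).
Proof.
move=> rb psic psi0; apply: (chart_image_Cc cK Ku rb) => [x ux|x].
  have Hh := induced_metric_riemannian g F Su; have [oU _ _ _] := Hh.
  have E y : cimg u y -> psi (cinv u y) * Num.sqrt (\det (induced_metric g F u y))
      = chart_density psi y by move=> uy; rewrite chart_densityE.
  apply: (continuous_open oU E ux).
  have D := Ck_cont (Ck_sqrt_det Hh 0) ux.
  have P : {for x, continuous (psi \o cinv u)}.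
    by apply: continuous_comp; [exact: cinv_cont|exact: psic].
  exact: (continuousM P D).
exact: chart_density_out.
Qed.

Lemma volume_integral psi : continuous psi -> (forall p, ~ K p -> psi p = 0) ->
  (\int[mu]_p (psi p)%:E)%E = (integral_Rn (chart_density psi))%:E.
Proof. by move=> psic psi0; exact: (hmu Su psic cK Ku psi0). Qed.

(** The absolute value of [psi] is again an admissible test function for [hmu], hence has a finite
    integral. *)
Lemma volume_integrable psi : continuous psi -> (forall p, ~ K p -> psi p = 0) ->
  mu.-integrable setT (EFin \o (psi : borel S -> R)).
Proof.
move=> psic psi0; apply/integrableP; split.
  by apply/measurable_EFinP; exact: (continuous_borel_measurable psic).
have normc : continuous (fun p => `|psi p|).
  by move=> p; apply: (@continuous_comp _ _ _ psi); [exact: psic|exact: norm_continuous].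
have := volume_integral normc _ => /= -> //; first exact: ltry.
by move=> p nK; rewrite psi0 // normr0.
Qed.

End VolumeIntegral.

Section DivergenceTheorem.
Context {R : realType} {m : nat} {M : manifold R m.+1} {S : manifold R m}.
Variables (g : metric M) (F : immersion S M) (nu : unit_normal g F).
Variables (f : M -> R) (lambda : R).
Hypothesis fs : smooth_fun f.
Hypothesis soliton : forall c x, atlas M c -> cimg c x ->
  ricci (g c) x + hessian (g c) (f \o cinv c) x = lambda *: g c x.
Hypothesis hmin : minimal nu.
Variable C : R.
Let phi : S -> R := test_fun F f C.

Let phi1 : C1_fun phi. Proof. exact: test_fun_C1. Qed.

Lemma C1_continuous (chi : S -> R) : C1_fun chi -> continuous chi.
Proof.
move=> chi1; apply: (continuous_charts (F := F)) => u c Su Mc.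
by apply: Ck_sub (CkW (chi1 u Su)) => x [].
Qed.

(* By [test_fun_laplacian] this is the Laplacian of [phi] on the hypersurface. *)
Definition lapS (p : S) : R := scalS g F p - (m.+1%:R - 1) * lambda - ricS nu p.

(** Continuity is read off the Laplacian of [phi], so none has to be established for [ricS]
    itself. *)
Lemma lapS_continuous : continuous lapS.
Proof.
apply: (continuous_charts (F := F)) => u c Su Mc.
have oL := @rep_open R m m.+1 S M F u c.
have Hh := chart_metric_riemannian g F Su Mc.
have E x : local_dom F u c x -> \tr (invmx (chart_metric g F u c x) *m
    hessian (chart_metric g F u c) (phi \o cinv u) x) = (lapS \o cinv u) x.
  by move=> Lx; exact: (test_fun_laplacian fs soliton C hmin Su Mc Lx).
have p2 : Ck 2 (local_dom F u c) (phi \o cinv u).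
  by apply: Ck_sub (test_fun_smooth F fs C Su 2) => x [].
exact: (Ck_eq oL E (Ck_trace oL (Ck_mulmx oL (Ck_inv_metric Hh 0) (Ck_hessian Hh p2)))).
Qed.

(* The divergence of [phi ^ 2 grad phi]. *)
Definition divS (p : S) : R :=
  phi p ^+ 2 * lapS p + 2 * phi p * gradS g F phi phi p.

Lemma divS_continuous : continuous divS.
Proof.
have phic := C1_continuous phi1.
move=> p; apply: (@continuousD R R S (fun p => phi p ^+ 2 * lapS p)
  (fun p => 2 * phi p * gradS g F phi phi p)).
  apply: (@continuousM R S (fun p => phi p ^+ 2) lapS); last exact: lapS_continuous.
  by apply: (@continuousM R S phi phi); exact: phic.
apply: (@continuousM R S (fun p => 2 * phi p) (gradS g F phi phi)).
  by apply: (@continuousM R S (fun=> 2) phi); [exact: cst_continuous|exact: phic].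
exact: (gradS_continuous phi1 phi1).
Qed.

Variable mu : {measure set (borel S) -> \bar R}.
Hypothesis hmu : volume_measure (induced_metric g F) mu.
Context (u : chart R m S) (K : set S) (chi : S -> R).
Hypotheses (Su : atlas S u) (cK : compact K) (Ku : K `<=` cdom u).
Hypotheses (chi1 : C1_fun chi) (chi0 : forall p, ~ K p -> chi p = 0).

(** By the product rule, the divergence of [chi * phi ^ 2] times the gradient of [phi]. *)
Let psi p := chi p * divS p + phi p ^+ 2 * gradS g F chi phi p.

Lemma localized_divergence_continuous : continuous psi.
Proof.
have phic := C1_continuous phi1.
move=> p; apply: (@continuousD R R S (fun p => chi p * divS p)
  (fun p => phi p ^+ 2 * gradS g F chi phi p)).
  apply: (@continuousM R S chi divS); last exact: divS_continuous.
  exact: (C1_continuous chi1).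
apply: (@continuousM R S (fun p => phi p ^+ 2) (gradS g F chi phi)).
  by apply: (@continuousM R S phi phi); exact: phic.
exact: (gradS_continuous chi1 phi1).
Qed.

(** The complement of the compact set [K] is open, S being Hausdorff, so the gradient of [chi]
    vanishes there along with [chi]. *)
Lemma localized_divergence_support p : ~ K p -> psi p = 0.
Proof.
move=> nK; rewrite /psi chi0 // mul0r add0r.
suff -> : gradS g F chi phi p = 0 by rewrite mulr0.
rewrite /gradS /grad_pair; set v := chart_at S p; set x := v p.
have vp : cdom v p by exact: chart_at_dom.
have -> : grad_row (chi \o cinv v) x = 0; last by rewrite bilin0l.
have cl : closed K by apply: compact_closed => //; exact: mspace_hausdorff.
have oV : open (chart_image v (~` K)).
  by apply: chart_image_open; exact: closed_openC.
have Vx : chart_image v (~` K) x.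
  by split; [exact: cmap_img|rewrite /x cmapK].
apply/rowP => a; rewrite [LHS]mxE [RHS]mxE.
have E y : chart_image v (~` K) y -> (chi \o cinv v) y = (fun=> 0) y.
  by move=> [vy nKy] /=; rewrite chi0.
by apply: etrans (partial_open a oV E Vx) _; exact: derive_cst.
Qed.

Let h := induced_metric g F u.
Let phiu := phi \o cinv u.
Let chiu := chi \o cinv u.
Let w x := chiu x * phiu x ^+ 2.
Let field a := (density_field h w phiu a) \_ (cimg u).

Let oU : open (cimg u). Proof. exact: cimg_open. Qed.
Let Hh : riemannian_on (cimg u) h. Proof. exact: induced_metric_riemannian. Qed.

Let w1 : Ck 1 (cimg u) w.
Proof. exact: (CkM oU (chi1 Su) (CkM oU (phi1 Su) (phi1 Su))). Qed.

Let phi2 : Ck 2 (cimg u) phiu.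
Proof. exact: test_fun_smooth. Qed.

Let field_in a x : cimg u x -> density_field h w phiu a x = field a x.
Proof. by move=> ux; rewrite /field /patch mem_set. Qed.

Let field_out a x : ~ chart_image u K x -> field a x = 0.
Proof.
move=> nA; rewrite /field /patch; case: ifPn => // /set_mem ux.
rewrite /density_field /w /chiu /= chi0 ?mul0r // => Kx.
by apply: nA.
Qed.

Let oA : open (~` chart_image u K).
Proof. by apply: closed_openC; exact: (chart_image_closed cK Ku). Qed.

(** The chart image and the complement of the compact image of [K] are open and cover the coordinate
    space; the field is a C^1 expression on the first and 0 on the second. *)
Let field1 a : Ck 1 setT (field a).
Proof.
apply: Ck_local => x _; have [ux|nux] := pselect (cimg u x).
  exists (cimg u); split; first exact: ux.
  exact: (Ck_eq oU (field_in a) (Ck_density_field Hh a w1 phi2)).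
exists (~` chart_image u K); split; first by move=> [].
apply: (Ck_eq oA _ (@Ck_cst R m R 1 (~` chart_image u K) 0)) => y nA.
by rewrite field_out.
Qed.

Let grad_w x : cimg u x -> grad_row w x =
  phiu x ^+ 2 *: grad_row chiu x + (2 * chiu x * phiu x) *: grad_row phiu x.
Proof.
move=> ux; apply/rowP => a; rewrite [LHS]mxE [RHS]mxE.
rewrite [X in _ = X + _]mxE [X in _ = _ + X]mxE [grad_row chiu x 0 a]mxE [grad_row phiu x 0 a]mxE.
have Dc : is_derive x (basis_vec a) chiu (partial a chiu x).
  by apply: derivableP; exact: (Ck_derivable (chi1 Su)).
have Dp : is_derive x (basis_vec a) phiu (partial a phiu x).
  by apply: derivableP; exact: (Ck_derivable (phi1 Su)).
have [_ D] := is_deriveM Dc (is_deriveM Dp Dp).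
apply: etrans D _.
rewrite -[LHS]/(chiu x * (phiu x * _ + phiu x * _) + phiu x * phiu x * _).
by ring.
Qed.

Let sum_partial_field x :
  \sum_a partial a (field a) x = chart_density g F u psi x.
Proof.
have [ux|nux] := pselect (cimg u x); last first.
  have nA : ~ chart_image u K x by move=> [].
  rewrite (chart_density_out _ _ localized_divergence_support nA) big1 // => a _.
  have E y : (~` chart_image u K) y -> field a y = (fun=> 0) y by exact: field_out.
  by apply: etrans (partial_open a oA E nA) _; exact: derive_cst.
pose c := chart_at M (F (cinv u x)).
have Mc : atlas M c by exact: chart_at_atlas.
have Lx : local_dom F u c x by exact: local_dom_chart_at.
have oL := @rep_open R m m.+1 S M F u c.
rewrite chart_densityE //.
transitivity (\sum_a partial a (density_field h w phiu a) x).
  apply: eq_bigr => a _; apply/esym; exact: (partial_open a oU (field_in a) ux).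
apply: etrans (divergence Hh ux w1 phi2) _.
rewrite mulrC; apply: (congr1 (fun z => z * _)).
have lapE : \tr (invmx (h x) *m hessian h phiu x) = lapS (cinv u x).
  rewrite /lapS -(test_fun_laplacian fs soliton C hmin Su Mc Lx).
  have hE y : local_dom F u c y -> h y = chart_metric g F u c y.
    by move=> Ly; exact: induced_metricE.
  exact: (f_equal2 (fun A B => \tr (invmx A *m B)) (hE x Lx)
    (hessian_open oL hE (fun=> fun=> erefl) Lx)).
have gradE (q : S -> R) : C1_fun q -> gradS g F q phi (cinv u x) =
    bilin (invmx (h x)) (grad_row (q \o cinv u) x) (grad_row phiu x).
  move=> q1; rewrite (gradSE g q1 phi1 Su Mc Lx) /grad_pair.
  by rewrite /h (induced_metricE g Su Mc Lx).
rewrite lapE grad_w // bilinDl !bilinZl /psi /divS (gradE _ chi1) (gradE _ phi1).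
rewrite /w /chiu /phiu /=.
set A := bilin _ _ _; set B := bilin _ _ _.
by ring.
Qed.

Lemma localized_divergence : (\int[mu]_p (psi p)%:E)%E = 0%E.
Proof.
rewrite (volume_integral hmu Su cK Ku localized_divergence_continuous
  localized_divergence_support).
have [r r0 rb] := chart_image_bounded cK Ku.
have fC a : Cc r (field a).
  apply: (chart_image_Cc cK Ku rb) => x; last exact: field_out.
  by move=> _; exact: (Ck_cont (field1 a)).
have -> : chart_density g F u psi = fun x => \sum_a partial a (field a) x.
  by apply/funext => x; rewrite sum_partial_field.
have pc a : continuous (partial a (field a)).
  by move=> x; exact: (Ck_cont (Ck_partial a (field1 a)) I).
rewrite (@integral_Rn_sum _ _ r) => [|a]; last first.
  by split=> // x; exact: Cc_partial0.
rewrite big1 // => a _; apply: (integral_Rn_partial r0 (fC a)) => // x.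
exact: (Ck_derivable (field1 a)).
Qed.

End DivergenceTheorem.

(** * Partitions of unity *)

Section SquaredPositivePart.
Context {R : realType}.

Definition pos_part (t : R) := (t + `|t|) / 2.

Definition sq_pos_part (t : R) := pos_part t ^+ 2.

Lemma pos_part_pos t : 0 <= t -> pos_part t = t.
Proof. by move=> t0; rewrite /pos_part ger0_norm // mulrDl -splitr. Qed.

Lemma pos_part_neg t : t <= 0 -> pos_part t = 0.
Proof. by move=> t0; rewrite /pos_part ler0_norm // subrr mul0r. Qed.

Lemma pos_part_continuous : continuous pos_part.
Proof.
move=> t; apply: (@continuousM R R^o (fun t : R => t + `|t|) (fun=> 2^-1)).
  by apply: continuousD; [exact: cvg_id|exact: norm_continuous].
exact: cst_continuous.
Qed.

(** The only delicate point is 0, where the difference quotient at [h] is bounded by [h] in absolute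
    value. *)
Lemma is_derive_sq_pos_part (t : R) : is_derive t 1 sq_pos_part (2 * pos_part t).
Proof.
have [t0|t0|->] := ltgtP t 0.
- rewrite pos_part_neg ?ltW // mulr0.
  apply: (@near_eq_is_derive _ _ _ (fun=> 0)).
  have : \forall s \near t, s < 0 by apply: open_nbhs_nbhs; split=> //; exact: open_lt.
  by apply: filterS => s s0; rewrite /sq_pos_part pos_part_neg ?ltW // expr2 mulr0.
- rewrite pos_part_pos ?ltW //.
  apply: (@near_eq_is_derive _ _ _ (fun s : R => s ^+ 2)).
    have : \forall s \near t, 0 < s by apply: open_nbhs_nbhs; split=> //; exact: open_gt.
    by apply: filterS => s s0; rewrite /sq_pos_part pos_part_pos ?ltW.
  have D := @is_deriveX R R^o id 2 t 1 1 (is_derive_id _ _).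
  by apply: (is_derive_eq D); rewrite expr1 /= -[LHS]/(_ * _) mulr1.
rewrite pos_part_pos // mulr0.
have H : h^-1 *: (sq_pos_part (h *: 1 + 0) - sq_pos_part 0) @[h --> (0 : R)^'] --> (0 : R).
  apply/cvgrPdist_le => /= e e0; near=> h.
  have h0 : h != 0 by near: h; exact: nbhs_dnbhs_neq.
  have he : `|h| <= e by apply: ltW; near: h; exact: dnbhs0_lt.
  rewrite sub0r normrN addr0 -[h *: 1]/(h * 1) mulr1 /sq_pos_part (@pos_part_pos 0) //.
  rewrite [0 ^+ 2]expr2 mulr0 subr0 -[_ *: _]/(_ * _) normrM normfV normrX.
  have ph : `|pos_part h| <= `|h|.
    have [h1|h1] := leP 0 h; first by rewrite pos_part_pos.
    by rewrite pos_part_neg ?normr0 // ltW.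
  rewrite ler_pdivrMl ?normr_gt0 // expr2.
  by rewrite ler_pM // (le_trans ph).
by split; [apply/cvg_ex; exists 0|exact: cvg_lim H].
Unshelve. all: by end_near. Qed.

Lemma sq_pos_part_ge0 t : 0 <= sq_pos_part t.
Proof. exact: sqr_ge0. Qed.

Lemma sq_pos_part_gt0 t : 0 < t -> 0 < sq_pos_part t.
Proof. by move=> t0; rewrite /sq_pos_part pos_part_pos ?ltW // exprn_gt0. Qed.

Lemma sq_pos_part_eq0 t : t <= 0 -> sq_pos_part t = 0.
Proof. by move=> t0; rewrite /sq_pos_part pos_part_neg // expr2 mulr0. Qed.

Lemma Ck1_sq_pos_part n (U : set 'rV[R]_n) (q : 'rV[R]_n -> R) : open U ->
  Ck 1 U q -> Ck 1 U (sq_pos_part \o q).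
Proof.
move=> oU q1.
have D x a : U x -> is_derive x (basis_vec a) (sq_pos_part \o q)
    (2 * pos_part (q x) * partial a q x).
  move=> Ux; apply: is_derive_comp1 (is_derive_sq_pos_part _).
  by apply: derivableP; exact: (Ck_derivable q1).
have qc x : U x -> {for x, continuous (pos_part \o q)}.
  move=> Ux; apply: continuous_comp; first exact: (Ck_cont q1).
  exact: pos_part_continuous.
have q0 : Ck 0 U (pos_part \o q) by split.
have c0 : Ck 0 U (sq_pos_part \o q) := CkM oU q0 q0.
split=> [x Ux|a]; first exact: (Ck_cont c0).
split=> [x Ux|]; first by have [] := D x a Ux.
have K : Ck 0 U (fun x => 2 * pos_part (q x) * partial a q x).
  apply: CkM => //; last exact: Ck_partial.
  by apply: CkM => //; exact: Ck_cst.
by apply: (Ck_eq oU _ K) => x Ux; have [_ <-] := D x a Ux.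
Qed.

End SquaredPositivePart.

Section Bump.
Context {R : realType} {m : nat} {S : manifold R m}.

(** The squared Euclidean distance is used because it is a polynomial, unlike the ambient sup norm;
    the Euclidean ball lies in the sup ball of the same radius. *)
Definition radial_bump (x0 : 'rV[R]_m) (e : R) (x : 'rV[R]_m) : R :=
  e ^+ 2 - \sum_i (x 0 i - x0 0 i) ^+ 2.

Lemma radial_bump_center x0 e : radial_bump x0 e x0 = e ^+ 2.
Proof.
by rewrite /radial_bump big1 ?subr0 // => i _; rewrite subrr expr2 mulr0.
Qed.

Lemma radial_bump_norm x0 e x : 0 <= e -> 0 < radial_bump x0 e x -> `|x - x0| <= e.
Proof.
rewrite subr_gt0 => e0 xe; apply: mx_norm_le => // i j; rewrite ord1 !mxE.
rewrite -(ler_pXn2r (n := 2)) ?nnegrE // real_normK ?num_real //.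
apply/ltW/(le_lt_trans _ xe); rewrite (bigD1 j) //= lerDl sumr_ge0 // => k _.
exact: sqr_ge0.
Qed.

Lemma Ck_radial_bump x0 e k (U : set 'rV[R]_m) : open U -> Ck k U (radial_bump x0 e).
Proof.
move=> oU.
have K i : Ck k U (fun x : 'rV[R]_m => x 0 i - x0 0 i).
  exact: (CkB oU (Ck_coord k i oU) (@Ck_cst R m R k U (x0 0 i))).
have K2 : Ck k U (fun x : 'rV[R]_m => \sum_i (x 0 i - x0 0 i) ^+ 2).
  apply: (@Ck_sum R m R k U _ _ xpredT
    (fun i (x : 'rV[R]_m) => (x 0 i - x0 0 i) ^+ 2) oU) => i _.
  exact: (CkM oU (K i) (K i)).
exact: (CkB oU (@Ck_cst R m R k U (e ^+ 2)) K2).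
Qed.

Lemma C1_bump (p : S) : exists (u : chart R m S) (K : set S) (b : S -> R),
  [/\ [/\ atlas S u, compact K & K `<=` cdom u], C1_fun b, forall q, 0 <= b q,
      forall q, ~ K q -> b q = 0 & 0 < b p].
Proof.
pose u := chart_at S p; pose x0 := u p.
have Su : atlas S u by exact: chart_at_atlas.
have up : cdom u p by exact: chart_at_dom.
have oU : open (cimg u) by exact: cimg_open.
have /nbhs_ballP[r /= r0 rU] : nbhs x0 (cimg u).
  by apply: open_nbhs_nbhs; split=> //; exact: cmap_img.
(* Half the radius keeps the closed ball [K'], which has to be compact, inside the chart image. *)
pose e := r / 2; have e0 : 0 < e by rewrite divr_gt0.
have er : e < r by rewrite /e ltr_pdivrMr // ltr_pMr // ltr1n.
pose K' : set 'rV[R]_m := [set x | `|x - x0| <= e].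
have K'U : K' `<=` cimg u.
  move=> x xe; apply: rU; rewrite -ball_normE /= distrC; exact: le_lt_trans xe er.
have cK' : compact K'.
  apply: bounded_closed_compact.
    exists (`|x0| + e); split; first exact: num_real.
    move=> s xs x /= xe; rewrite (le_trans _ (ltW xs)) //.
    by rewrite -{1}(subrK x0 x) addrC (le_trans (ler_normD _ _)) // lerD2l.
  apply: (@closed_comp _ _ (fun x : 'rV[R]_m => `|x - x0|) [set s | s <= e]) => [x _|].
    apply: (@continuous_comp _ _ _ (fun x : 'rV[R]_m => x - x0)); last exact: norm_continuous.
    by apply: continuousB; [exact: cvg_id|exact: cst_continuous].
  exact: closed_le.
pose K := cinv u @` K'.
have cK : compact K.
  apply: continuous_compact => //; apply: continuous_in_subspaceT => x /set_mem xK.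
  exact/cinv_cont/K'U.
have Ku : K `<=` cdom u by move=> _ [x xK <-]; exact/cinv_dom/K'U.
pose beta := sq_pos_part \o radial_bump x0 e.
pose b : S -> R := (beta \o u) \_ (cdom u).
have b_in q : cdom u q -> b q = beta (u q) by move=> uq; rewrite /b /patch mem_set.
have b_out q : ~ K q -> b q = 0.
  move=> nK; rewrite /b /patch; case: ifPn => // /set_mem uq /=.
  apply: sq_pos_part_eq0; rewrite leNgt; apply/negP => /(radial_bump_norm (ltW e0)) xe.
  by apply: nK; exists (u q) => //; rewrite cmapK.
exists u, K, b; split=> //; last 2 first.
- by move=> q; rewrite /b /patch; case: ifPn => // _; exact: sq_pos_part_ge0.
- by rewrite b_in // /beta /= radial_bump_center sq_pos_part_gt0 // exprn_gt0.
(* In another chart [v], either the point lies in the domain of [u] and the transition map applies,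
   or it lies in the open complement of [K], where [b] is 0. *)
move=> v Sv; apply: Ck_local => x vx; have [ux|nux] := pselect (cdom u (cinv v x)).
  exists (local_dom idfun v u); split; first by split.
  have oL : open (local_dom idfun v u) by exact: transition_open.
  have b1 : Ck 1 setT beta.
    exact: (Ck1_sq_pos_part openT (Ck_radial_bump _ _ _ openT)).
  have bs := Ck_comp oL openT (fun x _ => I) b1 (transition_smooth Sv Su 1).
  by apply: (Ck_eq oL _ bs) => y [vy uy] /=; rewrite b_in.
exists (chart_image v (~` K)); split; first by split=> // /Ku.
have oA : open (chart_image v (~` K)).
  have cl : closed K by apply: compact_closed => //; exact: (@mspace_hausdorff R m S).
  by apply: chart_image_open; exact: closed_openC.
apply: (Ck_eq oA _ (@Ck_cst R m R 1 (chart_image v (~` K)) 0)) => y [vy nKy] /=.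
by rewrite b_out.
Qed.

(** Finitely many bumps cover S by compactness; their sum is positive everywhere, and dividing by it
    preserves C^1, signs and supports. *)
Lemma C1_partition_of_unity : compact [set: S] ->
  exists (s : seq S) (u : S -> chart R m S) (K : S -> set S) (chi : S -> S -> R),
    (forall p, [/\ [/\ atlas S (u p), compact (K p) & K p `<=` cdom (u p)],
        C1_fun (chi p), forall q, 0 <= chi p q & forall q, ~ K p q -> chi p q = 0]) /\
    forall q, \sum_(p <- s) chi p q = 1.
Proof.
move=> cS.
have [u uP] := choice C1_bump.
have [K KP] := choice uP; have [b bP] := choice KP.
have bc p : continuous (b p).
  have [_ b1 _ _ _] := bP p => q; pose v := chart_at S q.
  have Sv : atlas S v by exact: chart_at_atlas.
  have vq : cdom v q by exact: chart_at_dom.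
  have ov : open (cdom v) by exact: cdom_open.
  have C : {for q, continuous ((b p \o cinv v) \o v)}.
    apply: (@continuous_comp _ _ _ v (b p \o cinv v)); first exact: cmap_cont.
    by apply: (Ck_cont (b1 v Sv)); exact: cmap_img.
  by apply: (continuous_open ov _ vq C) => y vy /=; rewrite cmapK.
have cS' : cover_compact [set: S] by rewrite -compact_cover.
have [p _|q _|D _ DS] := cS' S setT (fun p => [set q | 0 < b p q]).
- by apply: (@open_comp _ _ (b p) [set t | 0 < t]) => [q _|]; [exact: bc|exact: open_gt].
- by exists q => //; have [_ _ _ _] := bP q.
pose s : seq S := finmap.enum_fset D.
pose t q := \sum_(p <- s) b p q.
have t0 q : 0 < t q.
  have [p /= pD bq] := DS q I.
  rewrite /t (big_rem p) //= ltr_wpDr // sumr_ge0 // => i _.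
  by have [_ _ b0 _ _] := bP i; exact: b0.
exists s, u, K, (fun p q => b p q / t q); split=> [p|q]; last first.
  by rewrite -mulr_suml -/(t q) divff //; exact: lt0r_neq0.
have [uK b1 b0 bout _] := bP p; split; first exact: uK.
- move=> v Sv; have ov : open (cimg v) by exact: cimg_open.
  have t1 : Ck 1 (cimg v) (t \o cinv v).
    apply: (@Ck_sum R m R 1 (cimg v) S s xpredT (fun i => b i \o cinv v) ov) => i _.
    by have [_ bi1 _ _ _] := bP i; exact: bi1.
  have tV : Ck 1 (cimg v) (fun x => ((t \o cinv v) x)^-1).
    by apply: (CkV ov _ t1) => x _ /=; exact: lt0r_neq0.
  exact: (CkM ov (b1 v Sv) tV).
- by move=> q; rewrite divr_ge0 ?(ltW (t0 q)) //; exact: b0.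
- by move=> q nK; rewrite bout // mul0r.
Qed.

End Bump.

(** * Stable hypersurfaces *)

Section FiniteSums.
Context {d : measure_display} {T : measurableType d} {R : realType}.
Variable mu : {measure set T -> \bar R}.

Lemma integral_sumr (I : Type) (s : seq I) (q : I -> T -> R) :
  (forall i, mu.-integrable setT (EFin \o q i)) ->
  mu.-integrable setT (EFin \o (fun x => \sum_(i <- s) q i x)) /\
  (\int[mu]_x (\sum_(i <- s) q i x)%R%:E = \sum_(i <- s) \int[mu]_x (q i x)%:E)%E.
Proof.
move=> qi; elim: s => [|i s [IH1 IH2]].
  split.
    have -> : EFin \o (fun x => \sum_(i <- [::]) q i x) = (cst 0%E : T -> \bar R).
      by apply/funext => x /=; rewrite big_nil.
    exact: integrable0.
  by rewrite big_nil; under eq_integral do rewrite big_nil; exact: integral0.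
have E x : (\sum_(j <- i :: s) q j x)%:E = ((q i x)%:E + (\sum_(j <- s) q j x)%R%:E)%E.
  by rewrite big_cons EFinD.
split.
  have -> : EFin \o (fun x => \sum_(j <- i :: s) q j x) =
      ((EFin \o q i) \+ (EFin \o (fun x => (\sum_(j <- s) q j x)%R)))%E.
    by apply/funext => x; exact: E.
  exact: integrableD.
rewrite big_cons -IH2; apply: etrans _ (integralD measurableT (qi i) IH1).
by apply: eq_integral => x _; exact: E.
Qed.

End FiniteSums.

Lemma double_sub1_gt0 (K : realFieldType) (t : K) : 1 <= t -> 0 < 2 * t - 1.
Proof. lra. Qed.

Section Rigidity.
Context {R : realType} {m : nat} {M : manifold R m.+1} {S : manifold R m}.
Variables (g : metric M) (F : immersion S M) (nu : unit_normal g F).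
Variables (f : M -> R) (lambda : R).
Hypothesis fs : smooth_fun f.
Hypothesis soliton : forall c x, atlas M c -> cimg c x ->
  ricci (g c) x + hessian (g c) (f \o cinv c) x = lambda *: g c x.
Hypothesis hscal : scalar_curv_ge g ((m.+1%:R - 1) * lambda).
Hypothesis hcompact : compact [set: S].
Hypothesis hmin : minimal nu.
Variable mu : {measure set (borel S) -> \bar R}.
Hypothesis hmu : volume_measure (induced_metric g F) mu.
Hypothesis hstable : stable nu mu.

Lemma grad_pair_ge0 u c (psi : S -> R) x : atlas S u -> atlas M c -> local_dom F u c x ->
  0 <= grad_pair g F u c psi psi x /\
  (grad_pair g F u c psi psi x = 0 -> grad_row (psi \o cinv u) x = 0).
Proof.
move=> Su Mc Lx; have [_ _ hT hp] := chart_metric_riemannian g F Su Mc.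
have ip := posdef_inv (hT x Lx) (hp x Lx).
by split; [exact: posdef_ge0|exact: posdef_eq0].
Qed.

Lemma second_form_sq_ge0 u c x : atlas S u -> atlas M c -> local_dom F u c x ->
  0 <= second_form_sq nu u c x /\
  (second_form_sq nu u c x = 0 -> A_form nu u c x = 0).
Proof.
move=> Su Mc Lx; have [_ _ hT hp] := chart_metric_riemannian g F Su Mc.
have ip := posdef_inv (hT x Lx) (hp x Lx).
have iT : (invmx (chart_metric g F u c x))^T = invmx (chart_metric g F u c x).
  by rewrite trmx_inv hT.
exact: (trace_congruence_ge0 (A_form nu u c x) iT ip).
Qed.

Let chart_point (p : S) : let u := chart_at S p in let c := chart_at M (F p) in
  [/\ atlas S u, atlas M c, local_dom F u c (u p) & cinv u (u p) = p].
Proof.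
split; [exact: chart_at_atlas|exact: chart_at_atlas| |].
  by apply: local_dom_chart; exact: chart_at_dom.
by apply: cmapK; exact: chart_at_dom.
Qed.

Lemma gradS_ge0 (psi : S -> R) p : 0 <= gradS g F psi psi p.
Proof. by have [Su Mc Lx _] := chart_point p; exact: (grad_pair_ge0 psi Su Mc Lx).1. Qed.

Lemma second_form_sqS_ge0 p : 0 <= second_form_sqS nu p.
Proof. by have [Su Mc Lx _] := chart_point p; exact: (second_form_sq_ge0 Su Mc Lx).1. Qed.

Lemma scalS_ge p : (m.+1%:R - 1) * lambda <= scalS g F p.
Proof.
apply: hscal; first exact: chart_at_atlas.
by apply: cmap_img; exact: chart_at_dom.
Qed.

(** A maximum exists because S is compact and, being pointed, nonempty. The margin 1 makes the test
    function at least 1. *)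
Lemma potential_bounded : exists C : R, forall p, f (F p) + 1 <= C.
Proof.
have fc : continuous (fun p : S => f (F p)).
  have := C1_continuous F (test_fun_C1 F fs 0) => tc p.
  have E q : [set: S] q -> - test_fun F f 0 q = f (F q) by rewrite /test_fun sub0r opprK.
  apply: (continuous_open openT E I).
  by apply: (@continuousN R R S); exact: tc.
have [||c _ cmax] := @compact_EVT_max S R (fun p => f (F p)) setT _ hcompact.
- by exists point.
- exact: continuous_subspaceT.
- exists (f (F c) + 1) => p; rewrite lerD2r; apply: cmax.
  by rewrite inE.
Qed.

(** Differentiates the constant sum 1 in the single chart attached to [p]. It removes the gradients
    of the cutoffs when the localized divergences are added up. *)
Lemma gradS_sum_eq0 (s : seq S) (chi : S -> S -> R) (psi : S -> R) p :
  (forall i, C1_fun (chi i)) -> (forall q, \sum_(i <- s) chi i q = 1) ->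
  \sum_(i <- s) gradS g F (chi i) psi p = 0.
Proof.
move=> chi1 sum1; have [Su Mc [ux _] _] := chart_point p.
set u := chart_at S p in Su ux *.
rewrite /gradS /grad_pair -bilin_suml -/u.
suff -> : \sum_(i <- s) grad_row (chi i \o cinv u) (u p) = 0 by rewrite bilin0l.
apply/rowP => a; rewrite summxE [RHS]mxE.
under eq_bigr do rewrite mxE.
have D i : is_derive (u p) (basis_vec a) (chi i \o cinv u) (partial a (chi i \o cinv u) (u p)).
  by apply: derivableP; exact: (Ck_derivable (chi1 i u Su)).
have H : is_derive (u p) (basis_vec a) (fun x => \sum_(i <- s) (chi i \o cinv u) x)
    (\sum_(i <- s) partial a (chi i \o cinv u) (u p)).
  elim: (s) => [|i r IH].
    under [fun x => _]eq_fun do rewrite big_nil.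
    by rewrite big_nil; exact: is_derive_cst.
  under [fun x => _]eq_fun do rewrite big_cons.
  by rewrite big_cons; exact: is_deriveD.
have [_ <-] := H.
have -> : (fun x => \sum_(i <- s) (chi i \o cinv u) x) = fun=> 1.
  by apply/funext => x; exact: sum1.
exact: derive_cst.
Qed.

Lemma stable_rigidity : exists C : R, forall p,
  [/\ gradS g F (test_fun F f C) (test_fun F f C) p = 0,
      scalS g F p = (m.+1%:R - 1) * lambda & second_form_sqS nu p = 0].
Proof.
have [C fC] := potential_bounded; exists C.
set phi := test_fun F f C.
have phi_ge1 p : 1 <= phi p by rewrite /phi /test_fun lerBrDr addrC.
have phi1 : C1_fun phi by exact: test_fun_C1.
have phic := C1_continuous F phi1.
have [s [u [K [chi [chiP sum1]]]]] := C1_partition_of_unity hcompact.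
have chi1 i : C1_fun (chi i) by have [] := chiP i.
pose D := divS nu f lambda C.
pose P p := (2 * phi p - 1) * gradS g F phi phi p
  + (scalS g F p - (m.+1%:R - 1) * lambda + second_form_sqS nu p) * phi p ^+ 2.
have P_terms p : [/\ 0 <= (2 * phi p - 1) * gradS g F phi phi p,
    0 <= scalS g F p - (m.+1%:R - 1) * lambda & 0 <= second_form_sqS nu p].
  split; [|by rewrite subr_ge0 scalS_ge|exact: second_form_sqS_ge0].
  by rewrite mulr_ge0 ?gradS_ge0 // ltW // double_sub1_gt0.
have P_ge0 p : 0 <= P p.
  have [A B E] := P_terms p; apply: addr_ge0; first exact: A.
  by apply: mulr_ge0; [exact: addr_ge0|exact: sqr_ge0].
have Pc : continuous P.
  move=> p; apply: (@continuousD R R S (fun p => (2 * phi p - 1) * gradS g F phi phi p)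
    (fun p => (scalS g F p - (m.+1%:R - 1) * lambda + second_form_sqS nu p) * phi p ^+ 2)).
    apply: (@continuousM R S (fun p => 2 * phi p - 1)); last exact: (gradS_continuous phi1 phi1).
    apply: (@continuousB R R S (fun p => 2 * phi p) (fun=> 1)); last exact: cst_continuous.
    by apply: (@continuousM R S (fun=> 2) phi); [exact: cst_continuous|exact: phic].
  apply: (@continuousM R S _ (fun p => phi p ^+ 2)); last first.
    by apply: (@continuousM R S phi phi); exact: phic.
  apply: (@continuousD R R S _ (second_form_sqS nu)); last exact: second_form_sqS_continuous.
  apply: (@continuousB R R S (scalS g F) (fun=> (m.+1%:R - 1) * lambda)); last exact: cst_continuous.
  exact: (scalS_continuous fs soliton).
have stabE p : stability_integrand nu phi p = D p - P p.
  have [_ _ _ up] := chart_point p.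
  have -> : stability_integrand nu phi p =
      gradS g F phi phi p - (ricS nu p + second_form_sqS nu p) * phi p ^+ 2.
    by rewrite /second_form_sqS /second_form_sq up.
  rewrite /D /divS /P /lapS -/phi; ring.
pose psi i p := chi i p * D p + phi p ^+ 2 * gradS g F (chi i) phi p.
(* In the sum over the partition the functions add up to 1 and their gradients to 0. *)
have DE p : D p = \sum_(i <- s) psi i p.
  by rewrite big_split /= -mulr_suml sum1 mul1r -mulr_sumr gradS_sum_eq0 // mulr0 addr0.
have psi_int i : mu.-integrable setT (EFin \o (psi i : borel S -> R)) /\
    (\int[mu]_p (psi i p)%:E = 0)%E.
  have [[Su cK Ku] _ _ chi0] := chiP i; split.
    apply: (volume_integrable hmu Su cK Ku).
      exact: (localized_divergence_continuous fs soliton hmin (chi1 i)).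
    exact: (localized_divergence_support nu f lambda C cK chi0).
  exact: (localized_divergence fs soliton hmin C hmu Su cK Ku (chi1 i) chi0).
have [D_int intD] : mu.-integrable setT (EFin \o (D : borel S -> R)) /\
    (\int[mu]_p (D p)%:E = 0)%E.
  have [A B] := integral_sumr s (fun i => (psi_int i).1).
  have DE' : D = fun p => \sum_(i <- s) psi i p by apply/funext.
  rewrite DE'; split; first exact: A.
  by rewrite B big1 // => i _; have [] := psi_int i.
(* The volume measure is only given on functions supported in a chart, so [P] is cut up as well,
   both for integrability and for positivity. *)
pose Q i p := chi i p * P p.
have PE p : P p = \sum_(i <- s) Q i p by rewrite -mulr_suml sum1 mul1r.
have Qc i : continuous (Q i).
  move=> p; apply: (@continuousM R S (chi i) P); last exact: Pc.
  exact: (C1_continuous F (chi1 i)).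
have Q0 i p : ~ K i p -> Q i p = 0.
  by have [_ _ _ chi0] := chiP i => nK; rewrite /Q chi0 // mul0r.
have Q_ge0 i p : 0 <= Q i p by have [_ _ c0 _] := chiP i; rewrite mulr_ge0.
have Q_int i : mu.-integrable setT (EFin \o (Q i : borel S -> R)).
  have [[Su cK Ku] _ _ _] := chiP i.
  exact: (volume_integrable hmu Su cK Ku (Qc i) (Q0 i)).
have [P_int intP] : mu.-integrable setT (EFin \o (P : borel S -> R)) /\
    (\int[mu]_p (P p)%:E = \sum_(i <- s) \int[mu]_p (Q i p)%:E)%E.
  have [A B] := integral_sumr s Q_int.
  have PE' : P = fun p => \sum_(i <- s) Q i p by apply/funext.
  by rewrite {1 2}PE'; split; [exact: A|exact: B].
have intP_le0 : (\int[mu]_p (P p)%:E <= 0)%E.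
  have := hstable (test_fun_smooth F fs C).
  have -> : (\int[mu]_p (stability_integrand nu phi p)%:E =
      \int[mu]_p ((D p)%:E - (P p)%:E))%E.
    by apply: eq_integral => p _; rewrite stabE EFinB.
  rewrite integralB // intD sub0e oppe_ge0 //.
(* If [P p] were positive, some [chi i p] would be too; the chart integral of the continuous
   nonnegative function [Q i] would be positive, the other pieces nonnegative, and so the integral
   of [P] positive. *)
have P0 p : P p = 0.
  apply/eqP/negPn/negP => Pn0.
  have Pp : 0 < P p by rewrite lt_neqAle eq_sym Pn0 P_ge0.
  have [i si chip] : exists2 i, i \in s & 0 < chi i p.
    apply: contrapT => nex; have := sum1 p.
    rewrite big1_seq => [/eqP|i /andP[_ si]]; first by rewrite eq_sym oner_eq0.
    apply/eqP/negPn/negP => ci0; apply: nex; exists i => //.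
    by have [_ _ c0 _] := chiP i; rewrite lt_neqAle eq_sym ci0 c0.
  have [[Su cK Ku] _ _ _] := chiP i.
  have [r r0 rb] := chart_image_bounded cK Ku.
  have Kp : K i p.
    apply: contrapT => nK; have [_ _ _ chi0] := chiP i.
    by move: chip; rewrite chi0 // ltxx.
  have Iq : (0 < \int[mu]_p (Q i p)%:E)%E.
    rewrite (volume_integral hmu Su cK Ku (Qc i) (Q0 i)) lte_fin.
    have up := Ku _ Kp.
    have ux : cimg (u i) (u i p) by exact: cmap_img.
    have [_ _ _ hp] := induced_metric_riemannian g F Su.
    apply: (integral_Rn_gt0 (x0 := u i p) (ltW r0)
      (chart_density_Cc g F Su cK Ku rb (Qc i) (Q0 i))).
    - move=> x; rewrite /chart_density /patch; case: ifPn => // _.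
      by rewrite mulr_ge0 ?sqrtr_ge0.
    - rewrite chart_densityE // cmapK // mulr_gt0 ?mulr_gt0 // sqrtr_gt0.
      exact/posdef_det_gt0/hp.
  have : (0 < \int[mu]_p (P p)%:E)%E.
    rewrite intP (big_rem i) //=; apply: (lt_le_trans Iq).
    rewrite leeDl // sume_ge0 // => j _; apply: integral_ge0 => q _.
    by rewrite lee_fin.
  by rewrite ltNge intP_le0.
move=> p; have [A B E] := P_terms p.
have phi2 : 0 < phi p ^+ 2 by rewrite exprn_gt0 // (lt_le_trans ltr01).
have phi3 : 0 < 2 * phi p - 1 by exact: double_sub1_gt0.
(* A vanishing sum of nonnegative terms: the factors [2 * phi p - 1] and [phi p ^+ 2] are positive,
   so each of the three quantities is 0. *)
have := P0 p; rewrite /P => /eqP; rewrite paddr_eq0 //; last exact: (mulr_ge0 (addr_ge0 B E) (ltW phi2)).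
rewrite mulf_eq0 gt_eqF //= mulf_eq0 [phi p ^+ 2 == 0]gt_eqF // orbF paddr_eq0 // subr_eq0.
by move=> /andP[/eqP -> /andP[/eqP -> /eqP ->]].
Qed.

Lemma stable_totally_geodesic : totally_geodesic nu /\ vanishing_normal_ricci nu.
Proof.
have [C H] := stable_rigidity.
split=> [u c x Su Mc Lx|c p Mc cp].
  apply: (second_form_sq_ge0 Su Mc Lx).2.
  by rewrite -(second_form_sqSE nu Su Mc Lx); have [] := H (cinv u x).
have [Su Md Lx up] := chart_point p.
set u := chart_at S p in Su Lx up; set d := chart_at M (F p) in Md Lx.
have dp : cdom d (F p) by exact: chart_at_dom.
rewrite (ric_normal_change nu fs soliton Mc Md cp dp).
set phi := test_fun F f C.
have phi1 : C1_fun phi by exact: test_fun_C1.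
have oL := @rep_open R m m.+1 S M F u d.
(* The gradient vanishes on a whole open set, so the second derivatives, and with them the
   Laplacian, vanish at [u p]. *)
have dphi a y : local_dom F u d y -> partial a (phi \o cinv u) y = (fun=> 0) y.
  move=> Ly; have [_ gz] := grad_pair_ge0 phi Su Md Ly.
  have : grad_row (phi \o cinv u) y = 0.
    by apply: gz; rewrite -(gradSE g phi1 phi1 Su Md Ly); have [] := H (cinv u y).
  by move=> /rowP/(_ a); rewrite !mxE.
have hess0 : hessian (chart_metric g F u d) (phi \o cinv u) (u p) = 0.
  apply/matrixP => a b; rewrite [LHS]mxE [RHS]mxE big1 => [|k _]; last first.
    by rewrite dphi // mulr0.
  rewrite subr0; apply: etrans (partial_open a oL (dphi b) Lx) _.
  exact: derive_cst.
have := test_fun_laplacian fs soliton C hmin Su Md Lx.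
rewrite hess0 mulmx0 linear0 up; have [_ -> _] := H p.
by rewrite subrr sub0r => /eqP; rewrite eq_sym oppr_eq0 => /eqP.
Qed.

End Rigidity.

Theorem theorem1p2 (R : realType) (m : nat) (M : manifold R m.+1)
    (g : metric M) (f : M -> R) (lambda : R)
    (hsoliton : gradient_ricci_soliton g f lambda)
    (hshrinking : 0 < lambda)
    (hnontrivial : nontrivial g f)
    (hscal : scalar_curv_ge g ((m.+1%:R - 1) * lambda))
    (S : manifold R m) (hcompact : compact [set: S])
    (F : immersion S M) (nu : unit_normal g F)
    (mu : {measure set (borel S) -> \bar R})
    (hmu : volume_measure (induced_metric g F) mu)
    (hminimal : minimal nu)
    (hstable : stable nu mu) :
  totally_geodesic nu /\ vanishing_normal_ricci nu.
Proof.
have [_ fs soliton] := hsoliton.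
exact: (stable_totally_geodesic fs soliton hscal hcompact hminimal hmu hstable).
Qed.
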